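(* Let $f,g:(\mathbb{R}^2,0)\to(\mathbb{R}^3,0)$ be map-germs for which $0$ is a cuspidal edge. (1) Suppose that $f$ and $g$ have the same invariants $\tau,\kappa_s,\kappa_n,\kappa_c,\kappa_t$ and $\kappa_i$ at $0$, respectively, and that $\kappa_n(0)\ne0$. Then there exist a diffeomorphism-germ $\varphi:(\mathbb{R}^2,0)\to(\mathbb{R}^2,0)$ and an isometry-germ $\Phi:(\mathbb{R}^3,0)\to(\mathbb{R}^3,0)$ such that $$f(u,v)-\Phi\big(g(\varphi(u,v))\big)\in O(4),$$ where $O(4)$ is the set of map-germs $h:(\mathbb{R}^2,0)\to(\mathbb{R}^3,0)$ with $\frac{\partial^{i+j}h}{\partial u^i\partial v^j}(0)=0$ for all $i+j\le3$. (2) If $f$ and $g$ have the same invariants $\kappa_s,\kappa_n,\kappa_c,\kappa_t,\kappa_s'$ and $\kappa_n'$ at $0$, then the same conclusion holds, i.e. there exist a diffeomorphism-germ $\varphi$ of $(\mathbb{R}^2,0)$ and an isometry-germ $\Phi$ of $(\mathbb{R}^3,0)$ with $f-\Phi\circ g\circ\varphi\in O(4)$.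
   Context: All maps are $C^\infty$. A singular point of $f$ is a cuspidal edge if the germ of $f$ there becomes $(u,v)\mapsto(u,v^2,v^3)$ at $0$ after composing with diffeomorphism-germs of source and target. Near a cuspidal edge the singular set $S(f)$ is a regular curve of cuspidal edges, $\ker df$ is one-dimensional along $S(f)$ and transverse to it, and there is a smooth unit normal vector field $\nu$ along $f$. Let $\lambda=\det(f_u,f_v,\nu)$. A pair of vector fields $(\xi,\eta)$ near $0\in\mathbb{R}^2$ is adapted if, on $S(f)$, $\xi$ is tangent to $S(f)$ and $\eta$ is a null vector ($df(\eta)=0$), and $(\xi,\eta)$ is positively oriented. For a vector field $\zeta$, $\zeta f$ denotes the directional derivative $df(\zeta)$, and $\zeta_1\zeta_2 f=\zeta_1(\zeta_2 f)$, etc. Let $\hat\gamma$ be the space curve $f|_{S(f)}$ and $\tau$ its torsion (the curvature of $\hat\gamma$ is nonzero where $\kappa_n\neq0$). At points of $S(f)$ the invariants are (they do not depend on the adapted pair): $$\kappa_s=\operatorname{sgn}(\eta\lambda)\frac{\det(\xi f,\xi\xi f,\nu)}{|\xi f|^3},\qquad \kappa_n=\frac{|\det(\xi f,\eta\eta f,\xi\xi f)|}{|\xi f|^2|\xi f\times\eta\eta f|},\qquad \kappa_c=\frac{|\xi f|^{3/2}\det(\xi f,\eta\eta f,\eta\eta\eta f)}{|\xi f\times\eta\eta f|^{5/2}},$$ $$\kappa_t=\frac{\det(\xi f,\eta\eta f,\xi\eta\eta f)}{|\xi f\times\eta\eta f|^2}-\frac{\det(\xi f,\eta\eta f,\xi\xi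 f)\langle\xi f,\eta\eta f\rangle}{|\xi f|^2|\xi f\times\eta\eta f|^2},$$ $$\kappa_i=\frac{\det(\xi f,\eta\eta f,\xi\xi\xi f)}{|\xi f|^3|\xi f\times\eta\eta f|}-3\frac{\langle\xi f,\xi\xi f\rangle\det(\xi f,\eta\eta f,\xi\xi f)}{|\xi f|^5|\xi f\times\eta\eta f|}.$$ Convention for the derivatives $\kappa_s',\kappa_n'$ at $0$: parametrize $\hat\gamma$ by arc length $s$ with $\hat\gamma(0)=0$, and choose along $S(f)$ the unit normal $\nu=\hat\gamma'\times\eta\eta f/|\hat\gamma'\times\eta\eta f|$, the direction of $s$ being chosen so that $\langle\hat\gamma''(0),\nu(0)\rangle\ge0$ (if this quantity is $0$, either direction is allowed, and ''the same invariants'' means the same for some choice of the directions for $f$ and $g$). Then $\kappa_s'$ and $\kappa_n'$ are the derivatives at $s=0$ of $\kappa_s$ and of $\langle\hat\gamma'',\nu\rangle$; the latter function equals $\kappa_n$ near $s=0$ when $\kappa_n(0)\neq0$. *)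

(* Defs.v *)
From HB Require Import structures.
From mathcomp Require Import all_boot all_order all_algebra.
From mathcomp Require Import all_classical all_reals all_analysis.

Set Implicit Arguments.
Unset Strict Implicit.
Unset Printing Implicit Defensive.

Import Order.TTheory GRing.Theory Num.Theory.
Import numFieldNormedType.Exports.

Local Open Scope ring_scope.
Local Open Scope classical_set_scope.

(* Map-germs are represented by total functions of which only the behaviour
   near the base point matters.  The library norm on 'rV[R]_n is the sup norm,
   which is used here for the topology only; lengths are measured by enorm. *)

Section Smooth.
Context {R : realType} {V W : normedModType R}.

Definition iter_derive (vs : seq V) (h : V -> W) : V -> W :=
  foldr (fun v k => 'D_v k) h vs.

(* C^oo on a neighbourhood of x; the neighbourhood is the same for all orders
   of differentiation. *)
Definition smooth_at (h : V -> W) (x : V) : Prop :=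
  \forall y \near x, forall vs : seq V, differentiable (iter_derive vs h) y.

Definition vf_derive (zeta : V -> V) (h : V -> W) : V -> W :=
  fun p => 'D_(zeta p) h p.

End Smooth.

Definition diffeo_germ {R : realType} {V : normedModType R} (a b : V)
    (phi : V -> V) : Prop :=
  [/\ phi a = b, smooth_at phi a &
      exists psi : V -> V,
        [/\ psi b = a, smooth_at psi b,
            \forall x \near a, psi (phi x) = x &
            \forall y \near b, phi (psi y) = y]].

Section Euclidean.
Context {R : realType}.

Definition dot n (x y : 'rV[R]_n) : R := \sum_(i < n) x 0 i * y 0 i.

Definition enorm n (x : 'rV[R]_n) : R := Num.sqrt (dot x x).

Definition det3 (x y z : 'rV[R]_3) : R :=
  \det (\matrix_(i < 3) nth 0 [:: x; y; z] i).

Definition cross (x y : 'rV[R]_3) : 'rV[R]_3 :=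
  \row_(k < 3) det3 x y (delta_mx 0 k).

Definition isometry_germ n (Phi : 'rV[R]_n -> 'rV[R]_n) : Prop :=
  [/\ Phi 0 = 0, smooth_at Phi 0 &
      exists2 U : set 'rV[R]_n, nbhs (0 : 'rV[R]_n) U &
        forall x y, U x -> U y -> enorm (Phi x - Phi y) = enorm (x - y)].

End Euclidean.

Section CuspidalEdge.
Context {R : realType}.

Implicit Types (f : 'rV[R]_2 -> 'rV[R]_3) (p : 'rV[R]_2).
Implicit Types (xi eta : 'rV[R]_2 -> 'rV[R]_2) (nu : 'rV[R]_2 -> 'rV[R]_3).
Implicit Types (c : R -> 'rV[R]_2) (gamma : R -> 'rV[R]_3).

Definition e_u : 'rV[R]_2 := delta_mx 0 0.
Definition e_v : 'rV[R]_2 := delta_mx 0 1.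

Definition standard_cuspidal_edge p : 'rV[R]_3 :=
  let u := p 0 0 in let v := p 0 1 in
  \row_(k < 3) nth 0 [:: u; v ^+ 2; v ^+ 3] k.

Definition cuspidal_edge f p : Prop :=
  exists (phi : 'rV[R]_2 -> 'rV[R]_2) (Psi : 'rV[R]_3 -> 'rV[R]_3),
    [/\ diffeo_germ 0 p phi, diffeo_germ (f p) 0 Psi &
        \forall x \near (0 : 'rV[R]_2),
          Psi (f (phi x)) = standard_cuspidal_edge x].

Definition sing f : set 'rV[R]_2 := [set p | (\rank ('J f p) < 2)%N].

(* w is the velocity at p of a smooth curve lying in A. *)
Definition tangent_to (A : set 'rV[R]_2) p (w : 'rV[R]_2) : Prop :=
  exists c, [/\ smooth_at c 0, c 0 = p, \forall t \near (0 : R), A (c t) &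
                derive1 c 0 = w].

Definition adapted f xi eta : Prop :=
  [/\ smooth_at xi 0, smooth_at eta 0,
      \forall p \near (0 : 'rV[R]_2), sing f p -> tangent_to (sing f) p (xi p),
      \forall p \near (0 : 'rV[R]_2), sing f p -> vf_derive eta f p = 0 &
      \forall p \near (0 : 'rV[R]_2), 0 < \det (col_mx (xi p) (eta p))].

Definition unit_normal f nu : Prop :=
  smooth_at nu 0 /\
  \forall p \near (0 : 'rV[R]_2),
    [/\ enorm (nu p) = 1, dot ('D_e_u f p) (nu p) = 0 &
        dot ('D_e_v f p) (nu p) = 0].

Definition lambda f nu p : R := det3 ('D_e_u f p) ('D_e_v f p) (nu p).

Definition kappa_s f xi eta nu p : R :=
  let xf := vf_derive xi f in
  let xxf := vf_derive xi xf in
  Num.sg (vf_derive eta (lambda f nu) p) *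
    (det3 (xf p) (xxf p) (nu p) / enorm (xf p) ^+ 3).

Definition kappa_n f xi eta p : R :=
  let xf := vf_derive xi f in
  let xxf := vf_derive xi xf in
  let eef := vf_derive eta (vf_derive eta f) in
  `|det3 (xf p) (eef p) (xxf p)| /
    (enorm (xf p) ^+ 2 * enorm (cross (xf p) (eef p))).

Definition kappa_c f xi eta p : R :=
  let xf := vf_derive xi f in
  let eef := vf_derive eta (vf_derive eta f) in
  let eeef := vf_derive eta eef in
  enorm (xf p) `^ (3 / 2) * det3 (xf p) (eef p) (eeef p) /
    enorm (cross (xf p) (eef p)) `^ (5 / 2).

Definition kappa_t f xi eta p : R :=
  let xf := vf_derive xi f in
  let xxf := vf_derive xi xf in
  let eef := vf_derive eta (vf_derive eta f) in
  let xeef := vf_derive xi eef in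
  det3 (xf p) (eef p) (xeef p) / enorm (cross (xf p) (eef p)) ^+ 2 -
  det3 (xf p) (eef p) (xxf p) * dot (xf p) (eef p) /
    (enorm (xf p) ^+ 2 * enorm (cross (xf p) (eef p)) ^+ 2).

Definition kappa_i f xi eta p : R :=
  let xf := vf_derive xi f in
  let xxf := vf_derive xi xf in
  let xxxf := vf_derive xi xxf in
  let eef := vf_derive eta (vf_derive eta f) in
  det3 (xf p) (eef p) (xxxf p) /
    (enorm (xf p) ^+ 3 * enorm (cross (xf p) (eef p))) -
  3 * (dot (xf p) (xxf p) * det3 (xf p) (eef p) (xxf p) /
    (enorm (xf p) ^+ 5 * enorm (cross (xf p) (eef p)))).

(* Torsion of a regular curve in an arbitrary parametrization. *)
Definition torsion gamma (t : R) : R :=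
  det3 (derive1 gamma t) (derive1n 2 gamma t) (derive1n 3 gamma t) /
    enorm (cross (derive1 gamma t) (derive1n 2 gamma t)) ^+ 2.

(* c is a regular parametrization of the germ at 0 of the singular curve, so
   that f \o c is a parametrization of the space curve f|_S(f). *)
Definition sing_param f c : Prop :=
  [/\ smooth_at c 0, c 0 = 0, derive1 c 0 != 0 & \forall t \near (0 : R), sing f (c t)].

Definition arclength_param f c : Prop :=
  sing_param f c /\ \forall s \near (0 : R), enorm (derive1 (f \o c) s) = 1.

(* The unit normal along the arc-length parametrized singular curve which is
   determined by the direction of the parametrization. *)
Definition curve_normal f eta c (s : R) : 'rV[R]_3 :=
  let w := cross (derive1 (f \o c) s) (vf_derive eta (vf_derive eta f) (c s)) in
  (enorm w)^-1 *: w.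

Definition signed_kappa_n f eta c (s : R) : R :=
  dot (derive1n 2 (f \o c) s) (curve_normal f eta c s).

(* Arc-length parametrization in an allowed direction: when
   signed_kappa_n f eta c 0 = 0, both directions are allowed. *)
Definition directed_param f eta c : Prop :=
  arclength_param f c /\ 0 <= signed_kappa_n f eta c 0.

Definition kappa_s' f xi eta nu c : R := derive1 (kappa_s f xi eta nu \o c) 0.

Definition kappa_n' f eta c : R := derive1 (signed_kappa_n f eta c) 0.

Definition O4 (h : 'rV[R]_2 -> 'rV[R]_3) : Prop :=
  smooth_at h 0 /\
  forall i j : nat, (i + j <= 3)%N ->
    iter_derive (nseq i e_u ++ nseq j e_v) h 0 = 0.

Definition congruent_mod_O4 f (g : 'rV[R]_2 -> 'rV[R]_3) : Prop :=
  exists (phi : 'rV[R]_2 -> 'rV[R]_2) (Phi : 'rV[R]_3 -> 'rV[R]_3),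
    [/\ diffeo_germ 0 0 phi, isometry_germ Phi &
        O4 (fun p => f p - Phi (g (phi p)))].

End CuspidalEdge.

(* Main.v *)
(* Modulo O(4), every cuspidal edge is brought by a coordinate change of the
   source and a rotation of the target to the normal form
     (u, a20/2 u^2 + 1/2 v^2 + a30/6 u^3,
         b20/2 u^2 + b30/6 u^3 + b12/2 u v^2 + b03/6 v^3),
   with singular set {v = 0} and null direction d/dv along it; all coordinate
   changes used have explicit inverses.  In these coordinates
     kappa_s = a20, kappa_n = |b20|, kappa_c = b03, kappa_t = b12, kappa_i = b30,
     torsion = (a20 b30 - b20 a30) / (a20^2 + b20^2),
     kappa_s' = a30 + b20 b12, kappa_n' = b30 - a20 b12,
   the last two when the arc length grows with u.  The remaining freedom is the
   choice of the signs of u and v.  The orientation of the adapted pairs fixes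
   their product, and b20 >= 0 or the direction of the given parametrization
   fixes the sign of u.  Hence in both parts all six coefficients are determined
   by the invariants, and f and g have the same normal form. *)

Require Import Defs.
From HB Require Import structures.
From mathcomp Require Import all_boot all_order all_algebra.
From mathcomp Require Import all_classical all_reals all_analysis.
From mathcomp Require Import ring lra.

Import Order.TTheory GRing.Theory Num.Theory.
Import numFieldNormedType.Exports.

Local Open Scope ring_scope.
Local Open Scope classical_set_scope.

Set Implicit Arguments.
Unset Strict Implicit.
Unset Printing Implicit Defensive.

(** * Smooth germs *)

Section Smooth.
Context {R : realType}.
Implicit Types (V W : normedModType R).

(** Jets are treated algebraically: [van n] is the n-th power of the maximal ideal, so remainders
    are controlled by adding and multiplying orders of vanishing, without integral formulas. In edge
    coordinates the v-derivative vanishes on the axis, hence no monomial u^i v occurs; this is what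
    makes a few explicit coordinate changes sufficient. The obstacle on the side of the invariants
    is that an adapted pair is constrained only on the singular set and arbitrary elsewhere. In edge
    coordinates the constraints become identities on the axis, which may be differentiated in the
    direction of u only. The derivatives of the fields that then appear have to cancel in the
    formulas of the invariants. Moreover [kappa_s'] and [kappa_n'] are derivatives of functions
    along the singular curve, so values at 0 are not enough. There kappa_s and the signed kappa_n
    are rewritten, on the whole axis near 0, as expressions in F_u, F_uu and F_vv from which the
    fields, the unit normal and the sign factor have disappeared. *)

Lemma near_eq_differentiable V W (f g : V -> W) x :
  (\forall y \near x, f y = g y) -> differentiable f x -> differentiable g x.
Proof.
move=> fg df.
have eg : g \o shift x = cst (g x) + 'd f x +o_ 0 id.
  have /eqaddoP ef := diff_locally df.
  apply/eqaddoP => e e0; have := ef e e0.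
  move: (fg); rewrite (near_shift 0)/= => fg0; move: fg0; apply: filterS2 => y /=.
  rewrite subr0 => fgy.
  have -> : (g \o shift x - (cst (g x) + 'd f x)) y = g (y + x) - (g x + 'd f x y) by [].
  have -> : (f \o shift x - (cst (f x) + 'd f x)) y = f (y + x) - (f x + 'd f x y) by [].
  by rewrite (nbhs_singleton fg) fgy.
have dgE : 'd g x = 'd f x :> (V -> W) by apply: diff_unique => //; exact: diff_continuous.
by apply/diff_locallyP; rewrite dgE; split => //; exact: diff_continuous.
Qed.

(** Here n counts how often one may differentiate on [U]. The bound makes inductions close: the
    derivative of a product, composite or quotient is built from functions of the next lower class,
    whereas an induction on the list of directions would not cover the factors that appear. *)
Definition ck V W (U : set V) n (h : V -> W) :=
  forall vs, (size vs < n)%N -> forall y, U y -> differentiable (iter_derive vs h) y.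

Lemma smooth_atP V W (h : V -> W) x :
  smooth_at h x <-> exists2 U, open_nbhs x U & forall n, ck U n h.
Proof.
split=> [sh|[U oU sh]].
  exists [set y | forall vs, differentiable (iter_derive vs h) y]^°.
    by split; [exact: open_interior|exact: sh].
  move=> n vs _ y Uy; exact: (interior_subset Uy).
apply: (filterS _ (open_nbhs_nbhs oU)) => y Uy vs.
exact: (sh (size vs).+1).
Qed.

Lemma iter_derive_rcons V W vs v (h : V -> W) :
  iter_derive (rcons vs v) h = iter_derive vs ('D_v h).
Proof. by rewrite /iter_derive foldr_rcons. Qed.

Lemma ckS V W (U : set V) n (h : V -> W) :
  ck U n.+1 h <-> (forall y, U y -> differentiable h y) /\ forall v, ck U n ('D_v h).
Proof.
split=> [sh|[dh sh]].
  split=> [y Uy|v vs s y Uy]; first exact: (sh [::]).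
  by rewrite -iter_derive_rcons; apply: sh; rewrite ?size_rcons.
case/lastP=> [_ y Uy|vs v]; first exact: dh.
by rewrite size_rcons iter_derive_rcons ltnS => s y Uy; apply: sh.
Qed.

Lemma ckW V W (U : set V) n (h : V -> W) : ck U n.+1 h -> ck U n h.
Proof. by move=> sh vs s; apply: sh; apply: leq_trans s _. Qed.

Lemma iter_derive_ext V W (U : set V) vs (h k : V -> W) : open U ->
  (forall y, U y -> h y = k y) -> forall y, U y -> iter_derive vs h y = iter_derive vs k y.
Proof.
move=> oU hk; elim: vs => [|v vs IH] //= y Uy.
apply: near_eq_derive; apply: (filterS IH).
exact: open_nbhs_nbhs.
Qed.

Lemma ck_ext V W (U : set V) n (h k : V -> W) : open U ->
  (forall y, U y -> h y = k y) -> ck U n h -> ck U n k.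
Proof.
move=> oU hk sh vs s y Uy; apply: (near_eq_differentiable _ (sh vs s y Uy)).
apply: filterS (open_nbhs_nbhs (conj oU Uy)); exact: iter_derive_ext.
Qed.

Lemma ck_sub V W (U U' : set V) n (h : V -> W) : U' `<=` U -> ck U n h -> ck U' n h.
Proof. by move=> sU sh vs s y /sU; apply: sh. Qed.

Lemma ck_cst V W (U : set V) n (c : W) : open U -> ck U n (fun=> c : W).
Proof.
move=> oU; elim: n c => [|n IH] c; first by [].
apply/ckS; split=> [y _|v]; first exact: differentiable_cst.
apply: (ck_ext oU _ (IH 0)) => y _; by rewrite derive_cst.
Qed.

Lemma ckD V W (U : set V) n (h k : V -> W) : open U ->
  ck U n h -> ck U n k -> ck U n (fun y => h y + k y).
Proof.
move=> oU; elim: n h k => [|n IH] h k; first by [].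
move=> /ckS[dh sh] /ckS[dk sk]; apply/ckS; split=> [y Uy|v].
  by apply: differentiableD; [exact: dh|exact: dk].
apply: (ck_ext oU _ (IH _ _ (sh v) (sk v))) => y Uy.
by rewrite deriveD //; apply: diff_derivable; [exact: dh|exact: dk].
Qed.

Lemma ckM V (U : set V) n (h k : V -> R) : open U ->
  ck U n h -> ck U n k -> ck U n (fun y => h y * k y).
Proof.
move=> oU; elim: n h k => [|n IH] h k; first by [].
move=> sh' sk'; move: (sh') (sk').
move=> /ckS[dh sh] /ckS[dk sk]; apply/ckS; split=> [y Uy|v].
  by apply: differentiableM; [exact: dh|exact: dk].
apply: (ck_ext oU _ (ckD oU (IH _ _ (ckW sh') (sk v)) (IH _ _ (ckW sk') (sh v)))) => y Uy.
by rewrite deriveM //; apply: diff_derivable; [exact: dh|exact: dk].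
Qed.

Lemma ck_sum V (U : set V) n m (h : 'I_m -> V -> R) : open U ->
  (forall i, ck U n (h i)) -> ck U n (fun y => \sum_(i < m) h i y).
Proof.
move=> oU; elim: m h => [|m IH] h sh.
  refine (@ck_ext V R U n (fun=> 0) _ oU _ (ck_cst (0 : R) oU)) => y _.
  by rewrite big_ord0.
apply: (ck_ext oU _ (ckD oU (sh ord0) (IH _ (fun i => sh (lift ord0 i))))) => y _.
by rewrite big_ord_recl.
Qed.

Lemma differentiable_row V m (phi : V -> 'rV[R]_m) x :
  (forall i, differentiable (fun y => phi y 0 i) x) -> differentiable phi x.
Proof.
move=> d.
have -> : phi = \sum_(i < m) (fun y => phi y 0 i *: delta_mx 0 i).
  by apply/funext => y; rewrite fct_sumE [LHS]row_sum_delta.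
by apply: differentiable_sum => i; apply: differentiableZl.
Qed.

Lemma derive_coord V m (phi : V -> 'rV[R]_m) x v i : differentiable phi x ->
  ('D_v phi x) 0 i = 'D_v (fun y => phi y 0 i) x.
Proof. by move=> d; rewrite derive_mx ?mxE //; apply: diff_derivable. Qed.

Lemma derive_comp V W m (phi : V -> 'rV[R]_m) (h : 'rV[R]_m -> W) x v :
  differentiable phi x -> differentiable h (phi x) ->
  'D_v (h \o phi) x = \sum_(i < m) 'D_v (fun y => phi y 0 i) x *: 'D_(delta_mx 0 i) h (phi x).
Proof.
move=> dphi dh; rewrite deriveE; last exact: differentiable_comp.
have -> : 'd (h \o phi) x v = 'd h (phi x) ('D_v phi x) by rewrite diff_comp //= (deriveE v dphi).
rewrite (row_sum_delta ('D_v phi x)) linear_sum.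
by apply: eq_bigr => i _; rewrite linearZ /= derive_coord // (deriveE _ dh).
Qed.

(** Induction on the class with [phi] kept: a derivative of the composite is a sum of products of
    derivatives of the coordinates of [phi] with partial derivatives of [h] composed with [phi], and
    the induction hypothesis covers the latter. *)
Lemma ck_comp V m (U : set V) (U' : set 'rV[R]_m) n (phi : V -> 'rV[R]_m)
    (h : 'rV[R]_m -> R) : open U -> (forall y, U y -> U' (phi y)) ->
  (forall i, ck U n (fun y => phi y 0 i)) -> ck U' n h -> ck U n (h \o phi).
Proof.
move=> oU UU'; elim: n h => [|n IH] h sphi; first by [].
move=> /ckS[dh sh].
have dphi y : U y -> differentiable phi y.
  by move=> Uy; apply: differentiable_row => i; have /ckS[d _] := sphi i; exact: d.
apply/ckS; split=> [y Uy|v].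
  by apply: differentiable_comp; [exact: dphi|apply: dh; exact: UU'].
have sphi' i : ck U n (fun y => phi y 0 i) by apply: ckW.
have sDphi i : ck U n ('D_v (fun y => phi y 0 i)) by have /ckS[_] := sphi i.
apply: (ck_ext oU _ (ck_sum oU (fun i => ckM oU (sDphi i) (IH _ sphi' (sh (delta_mx 0 i)))))).
by move=> y Uy; rewrite derive_comp //; [exact: dphi|apply: dh; exact: UU'].
Qed.

(** Bootstrapping: the derivative of 1/h is -(1/h)^2 h', which is of class n as soon as 1/h itself
    is. *)
Lemma ckV V (U : set V) n (h : V -> R) : open U -> (forall y, U y -> h y != 0) ->
  ck U n h -> ck U n (fun y => (h y)^-1).
Proof.
move=> oU h0; elim: n => [|n IH]; first by [].
move=> sh; have /ckS[dh sDh] := sh; have shV := IH (ckW sh).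
apply/ckS; split=> [y Uy|v]; first by apply: differentiableV; [exact: dh|exact: h0].
apply: (ck_ext oU _ (ckM oU (ck_cst (-1 : R) oU) (ckM oU (ckM oU shV shV) (sDh v)))) => y Uy.
rewrite deriveV; [|exact: h0|by apply: diff_derivable; exact: dh].
by rewrite -exprVn mulN1r scaleNr expr2.
Qed.
End Smooth.

Section SmoothAt.
Context {R : realType}.
Implicit Types (V W : normedModType R).

(** Bootstrapping again: the derivative h' / (2 sqrt h) involves the square root only in its own
    class. *)
Lemma ck_sqrt V (U : set V) n (h : V -> R) : open U -> (forall y, U y -> 0 < h y) ->
  ck U n h -> ck U n (fun y => Num.sqrt (h y)).
Proof.
move=> oU h0; have s0 y : U y -> 2 * Num.sqrt (h y) != 0.
  by move=> /h0 hy; rewrite mulf_neq0 ?pnatr_eq0 // sqrtr_eq0 -ltNge.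
elim: n => [|n IH]; first by [].
move=> sh; have /ckS[dh sDh] := sh; have shV := IH (ckW sh).
have ds y : U y -> derivable (Num.sqrt : R -> R) (h y) 1.
  by move=> /h0 hy; apply: ex_derive; exact: is_derive1_sqrt.
apply/ckS; split=> [y Uy|v].
  by apply: differentiable_comp; [exact: dh|apply/derivable1_diffP; exact: ds].
have c2 : ck U n (fun=> 2 : R) by exact: ck_cst.
apply: (ck_ext oU _ (ckM oU (sDh v) (ckV oU s0 (ckM oU c2 shV)))) => y Uy.
have dsy := ds y Uy; have /derivable1_diffP dsy' := dsy.
have -> : 'D_v (fun z => Num.sqrt (h z)) y = 'd (Num.sqrt \o h) y v.
  by apply: deriveE; apply: differentiable_comp => //; exact: dh.
rewrite diff_comp //=; last exact: dh.
by rewrite diff1E // derive1E (deriveE v (dh y Uy)) (@derive_val _ _ _ _ _ _ _ (is_derive1_sqrt (h0 y Uy))).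
Qed.

Lemma smooth_near V W (h : V -> W) x :
  smooth_at h x -> \forall y \near x, smooth_at h y.
Proof. by move=> sh; apply/near_join. Qed.

Lemma smooth_diff V W (h : V -> W) x : smooth_at h x -> differentiable h x.
Proof. by move=> /nbhs_singleton/(_ [::]). Qed.

Lemma smooth_ext V W (h k : V -> W) x :
  (\forall y \near x, h y = k y) -> smooth_at h x -> smooth_at k x.
Proof.
move=> hk /smooth_atP[U [oU Ux] sU]; apply/smooth_atP.
exists (U `&` [set y | h y = k y]^°).
  by split; [apply: openI => //; exact: open_interior|split].
move=> n; apply: (@ck_ext _ _ _ _ _ h).
- by apply: openI => //; exact: open_interior.
- by move=> y [_ /interior_subset].
- by apply: ck_sub (sU n); move=> y [].
Qed.

Lemma smooth_derive V W (h : V -> W) v x : smooth_at h x -> smooth_at ('D_v h) x.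
Proof.
move=> /smooth_atP[U [oU Ux] sU]; apply/smooth_atP; exists U => // n.
by have /ckS[] := sU n.+1.
Qed.

Lemma smooth_cst V W (c : W) (x : V) : smooth_at (fun=> c) x.
Proof.
by apply/smooth_atP; exists setT; [split=> //; exact: openT|move=> n; apply/ck_cst/openT].
Qed.

Lemma smoothD V W (h k : V -> W) x :
  smooth_at h x -> smooth_at k x -> smooth_at (fun y => h y + k y) x.
Proof.
move=> /smooth_atP[U oU sU] /smooth_atP[U' oU' sU']; apply/smooth_atP.
exists (U `&` U'); first exact: open_nbhsI.
move=> n; have [oUU' _] := open_nbhsI oU oU'.
by apply: ckD => //; [apply: ck_sub (sU n); move=> y []|apply: ck_sub (sU' n); move=> y []].
Qed.

Lemma smoothM V (h k : V -> R) x :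
  smooth_at h x -> smooth_at k x -> smooth_at (fun y => h y * k y) x.
Proof.
move=> /smooth_atP[U oU sU] /smooth_atP[U' oU' sU']; apply/smooth_atP.
exists (U `&` U'); first exact: open_nbhsI.
move=> n; have [oUU' _] := open_nbhsI oU oU'.
by apply: ckM => //; [apply: ck_sub (sU n); move=> y []|apply: ck_sub (sU' n); move=> y []].
Qed.

Lemma smoothZ V (c : R) (h : V -> R) x : smooth_at h x -> smooth_at (fun y => c * h y) x.
Proof. by move=> sh; apply: smoothM sh; exact: smooth_cst. Qed.

Lemma smoothN V (h : V -> R) x : smooth_at h x -> smooth_at (fun y => - h y) x.
Proof.
move=> /(smoothZ (-1)); apply: smooth_ext; apply: nearW => y; exact: mulN1r.
Qed.

Lemma smoothB V (h k : V -> R) x :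
  smooth_at h x -> smooth_at k x -> smooth_at (fun y => h y - k y) x.
Proof. by move=> sh sk; apply: smoothD sh (smoothN sk). Qed.

Lemma smoothX V n (h : V -> R) x : smooth_at h x -> smooth_at (fun y => h y ^+ n) x.
Proof.
move=> sh; elim: n => [|n IH]; first exact: smooth_cst.
by apply: smooth_ext (smoothM sh IH); apply: nearW => y; rewrite exprS.
Qed.

Lemma smooth_sum V m (h : 'I_m -> V -> R) x :
  (forall i, smooth_at (h i) x) -> smooth_at (fun y => \sum_(i < m) h i y) x.
Proof.
elim: m h => [|m IH] h sh.
  by apply: smooth_ext (smooth_cst (0 : R) x); apply: nearW => y; rewrite big_ord0.
apply: smooth_ext (smoothD (sh ord0) (IH _ (fun i => sh (lift ord0 i)))).
by apply: nearW => y; rewrite big_ord_recl.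
Qed.

Lemma smooth_cont V W (h : V -> W) x : smooth_at h x -> h y @[y --> x] --> h x.
Proof. by move=> /smooth_diff/differentiable_continuous. Qed.

Lemma smoothV V (h : V -> R) x :
  h x != 0 -> smooth_at h x -> smooth_at (fun y => (h y)^-1) x.
Proof.
move=> h0 sh; have hn0 : \forall y \near x, h y != 0.
  have n0 : nbhs (h x) [set z : R | z != 0].
    by apply: open_nbhs_nbhs; split => //; exact: open_neq.
  exact: (smooth_cont sh n0).
move: sh => /smooth_atP[U [oU Ux] sU]; apply/smooth_atP.
have oUU : open (U `&` [set y | h y != 0]^°) by apply: openI => //; exact: open_interior.
exists (U `&` [set y | h y != 0]^°); first by split.
move=> n; apply: ckV => //; first by move=> y [_ /interior_subset].
by apply: ck_sub (sU n); move=> y [].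
Qed.

Lemma smooth_sqrt V (h : V -> R) x :
  0 < h x -> smooth_at h x -> smooth_at (fun y => Num.sqrt (h y)) x.
Proof.
move=> h0 sh; have hn0 : \forall y \near x, 0 < h y.
  have n0 : nbhs (h x) [set z : R | 0 < z].
    by apply: open_nbhs_nbhs; split => //; exact: open_gt.
  exact: (smooth_cont sh n0).
move: sh => /smooth_atP[U [oU Ux] sU]; apply/smooth_atP.
have oUU : open (U `&` [set y | 0 < h y]^°) by apply: openI => //; exact: open_interior.
exists (U `&` [set y | 0 < h y]^°); first by split.
move=> n; apply: ck_sqrt => //; first by move=> y [_ /interior_subset].
by apply: ck_sub (sU n); move=> y [].
Qed.

(** A derivative may be taken coordinatewise only where the vector-valued map is differentiable, so
    each step recovers this differentiability from the scalar coordinates. *)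
Lemma iter_derive_coord V m (U : set V) (phi : V -> 'rV[R]_m) : open U ->
  (forall i n, ck U n (fun y => phi y 0 i)) ->
  forall vs i y, U y -> iter_derive vs phi y 0 i = iter_derive vs (fun z => phi z 0 i) y.
Proof.
move=> oU sphi; elim=> [|v vs IH] //= i y Uy.
have IHn j z : U z ->
    \forall t \near z, iter_derive vs (fun z => phi z 0 j) t = iter_derive vs phi t 0 j.
  move=> Uz; apply: filterS (open_nbhs_nbhs (conj oU Uz)) => t Ut.
  by rewrite IH.
rewrite derive_coord.
  by apply: near_eq_derive; apply: filterS (IHn i y Uy) => z ->.
apply: differentiable_row => j; apply: (near_eq_differentiable (IHn j y Uy)).
exact: (sphi j (size vs).+1).
Qed.

Lemma smooth_row V m (phi : V -> 'rV[R]_m) x :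
  (forall i, smooth_at (fun y => phi y 0 i) x) -> smooth_at phi x.
Proof.
move=> sphi.
have : \forall y \near x, forall i, smooth_at (fun z => phi z 0 i) y.
  by apply: filter_forall => i; apply: smooth_near.
move=> s; apply/smooth_atP.
exists [set y | forall i, smooth_at (fun z => phi z 0 i) y]^°.
  by split; [exact: open_interior|].
have ckphi i n : ck [set y | forall i, smooth_at (fun z => phi z 0 i) y]^° n (fun y => phi y 0 i).
  by move=> vs _ y /interior_subset/(_ i)/nbhs_singleton.
move=> n vs _ y Uy; apply: differentiable_row => i.
have oU := open_interior [set y | forall i, smooth_at (fun z => phi z 0 i) y].
apply: (@near_eq_differentiable _ _ _ (iter_derive vs (fun z => phi z 0 i))).
  apply: filterS (open_nbhs_nbhs (conj oU Uy)) => z Uz.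
  by rewrite (iter_derive_coord oU).
exact: (ckphi i (size vs).+1).
Qed.

Lemma smooth_coord V m (phi : V -> 'rV[R]_m) x i :
  smooth_at phi x -> smooth_at (fun y => phi y 0 i) x.
Proof.
move=> /smooth_atP[U [oU Ux] sU]; apply/smooth_atP; exists U => //.
suff H vs y : U y -> iter_derive vs phi y 0 i = iter_derive vs (fun z => phi z 0 i) y.
  move=> n vs _ y Uy.
  apply: (@near_eq_differentiable _ _ _ (fun z => iter_derive vs phi z 0 i)).
    by apply: filterS (open_nbhs_nbhs (conj oU Uy)) => z Uz; rewrite H.
  apply: (@differentiable_comp _ _ _ _ (iter_derive vs phi) (fun M : 'rV[R]_m => M 0 i)).
    exact: (sU (size vs).+1).
  exact: differentiable_coord.
elim: vs y => [|v vs IH] //= y Uy.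
rewrite derive_coord; last exact: (sU (size vs).+1).
apply: near_eq_derive.
by apply: filterS (open_nbhs_nbhs (conj oU Uy)) => z Uz; rewrite IH.
Qed.

Lemma smooth_proj m (x : 'rV[R]_m) i : smooth_at (fun y : 'rV[R]_m => y 0 i) x.
Proof.
apply/smooth_atP; exists setT; first by split=> //; exact: openT.
case=> [|n]; first by [].
apply/ckS; split=> [y _|v]; first exact: differentiable_coord.
apply: (ck_ext openT _ (ck_cst ('D_v (fun y : 'rV[R]_m => y 0 i) 0) openT)) => y _.
have E z : 'D_v (fun y : 'rV[R]_m => y 0 i) z = v 0 i.
  by have := derive_mx (@derivable_id _ _ z v); rewrite derive_id; move/matrixP/(_ 0 i); rewrite !mxE => ->.
by rewrite !E.
Qed.

Lemma smooth_id m (x : 'rV[R]_m) : smooth_at id x.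
Proof. by apply: smooth_row => i; exact: smooth_proj. Qed.

Lemma smooth_comp V m (phi : V -> 'rV[R]_m) (h : 'rV[R]_m -> R) x :
  smooth_at phi x -> smooth_at h (phi x) -> smooth_at (h \o phi) x.
Proof.
move=> sphi /smooth_near sh; have nh := smooth_cont sphi sh; rewrite nbhs_simpl /= in nh.
apply/smooth_atP.
pose A := [set y | smooth_at phi y /\ smooth_at h (phi y)].
have nA : nbhs x A by apply: filterI => //; exact: smooth_near.
exists A^°; first by split; [exact: open_interior|].
move=> n; apply: (@ck_comp _ _ _ _ [set y | smooth_at h y]); first exact: open_interior.
- by move=> y /interior_subset [].
- by move=> i vs _ y /interior_subset[/(smooth_coord i)/nbhs_singleton].
- by move=> vs _ y /nbhs_singleton.
Qed.

Lemma smooth_comp_row V m n (phi : V -> 'rV[R]_m) (h : 'rV[R]_m -> 'rV[R]_n) x :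
  smooth_at phi x -> smooth_at h (phi x) -> smooth_at (h \o phi) x.
Proof.
move=> sphi sh; apply: smooth_row => i.
by apply: (@smooth_comp _ _ phi (fun z => h z 0 i)) => //; exact: smooth_coord.
Qed.

Lemma smooth_mulmx V m n (phi : V -> 'rV[R]_m) (M : 'M[R]_(m, n)) x :
  smooth_at phi x -> smooth_at (fun y => phi y *m M) x.
Proof.
move=> sphi; apply: smooth_row => i.
apply: (@smooth_ext _ _ (fun y => \sum_j M j i * phi y 0 j)).
  by apply: nearW => y; rewrite mxE; apply: eq_bigr => j _; rewrite mulrC.
by apply: smooth_sum => j; apply: smoothZ; exact: smooth_coord.
Qed.

Lemma derive_basis W m (h : 'rV[R]_m -> W) p w : differentiable h p ->
  'D_w h p = \sum_(j < m) w 0 j *: 'D_(delta_mx 0 j) h p.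
Proof.
move=> dh; rewrite deriveE // [X in 'd _ _ X](row_sum_delta w) linear_sum.
by apply: eq_bigr => j _; rewrite linearZ /= (deriveE _ dh).
Qed.

(** The direction moves with the point, but near [x] the derivative is a combination of fixed
    partial derivatives with smooth coefficients. *)
Lemma smooth_vf m (zeta : 'rV[R]_m -> 'rV[R]_m) (h : 'rV[R]_m -> R) x :
  smooth_at zeta x -> smooth_at h x -> smooth_at (vf_derive zeta h) x.
Proof.
move=> sz sh.
apply: (@smooth_ext _ _ (fun p => \sum_(j < m) zeta p 0 j * 'D_(delta_mx 0 j) h p)).
  apply: filterS (smooth_near sh) => p /smooth_diff dh.
  by rewrite /vf_derive derive_basis.
by apply: smooth_sum => j; apply: smoothM; [exact: smooth_coord|exact: smooth_derive].
Qed.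

Lemma vf_derive_coord m n (zeta : 'rV[R]_m -> 'rV[R]_m) (h : 'rV[R]_m -> 'rV[R]_n) p i :
  differentiable h p -> vf_derive zeta h p 0 i = vf_derive zeta (fun z => h z 0 i) p.
Proof. by move=> dh; rewrite /vf_derive derive_coord. Qed.

Lemma smooth_vf_row m n (zeta : 'rV[R]_m -> 'rV[R]_m) (h : 'rV[R]_m -> 'rV[R]_n) x :
  smooth_at zeta x -> smooth_at h x -> smooth_at (vf_derive zeta h) x.
Proof.
move=> sz sh; apply: smooth_row => i.
apply: (@smooth_ext _ _ (vf_derive zeta (fun z => h z 0 i))).
  apply: filterS (smooth_near sh) => p /smooth_diff dh.
  by rewrite vf_derive_coord.
by apply: smooth_vf => //; exact: smooth_coord.
Qed.

Lemma smooth_iter V W vs (h : V -> W) x : smooth_at h x -> smooth_at (iter_derive vs h) x.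
Proof. by move=> sh; elim: vs => //= v vs; exact: smooth_derive. Qed.

Lemma near_iter_derive V W vs (h k : V -> W) (x : V) : (\forall y \near x, h y = k y) ->
  \forall y \near x, iter_derive vs h y = iter_derive vs k y.
Proof.
move=> hk; elim: vs => //= v vs IH.
have /near_join := IH; apply: filterS => y; exact: near_eq_derive.
Qed.
End SmoothAt.

(** * Orders of vanishing and jets *)

Section Vanishing.
Context {R : realType}.
Implicit Types (V W : normedModType R).

Lemma is_derive_line V (h : V -> R) y u (s : R) : derivable h (s *: u + y) u ->
  is_derive s 1 (fun s : R => h (s *: u + y)) ('D_u h (s *: u + y)).
Proof.
have E : (fun t : R => t^-1 *: (((fun s : R => h (s *: u + y)) \o shift s) (t *: 1) - h (s *: u + y)))
  = (fun t => t^-1 *: ((h \o shift (s *: u + y)) (t *: u) - h (s *: u + y))).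
  by apply/funext => t /=; rewrite scalerDl -scalerA scale1r addrA.
move=> d; apply: DeriveDef; first by rewrite /derivable E.
by rewrite /derive E.
Qed.

(** The mean value theorem along [u], applied to the difference of two copies of [h] displaced by
    [t *: v], turns the second difference into t times a difference of values of ['D_u h]. The
    first-order expansion of ['D_u h] at [x] then gives the estimate. *)
Lemma second_difference V (h : V -> R) x u v : smooth_at h x -> forall e : R, 0 < e ->
  \forall t \near 0^'+, `|h (t *: u + t *: v + x) - h (t *: u + x) - h (t *: v + x) + h x
    - t ^+ 2 * 'D_v ('D_u h) x| <= e * t ^+ 2.
Proof.
move=> sh e e0; have dk := smooth_diff (smooth_derive u sh).
(* [t * c] bounds the norm of [s *: u + r *: v] for s and r between 0 and t; the 1 keeps [c]
   positive. With the tolerance [e / (2 * c)] each of the two remainders costs at most e t / 2. *)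
pose c := `|u| + `|v| + 1.
have c0 : 0 < c by rewrite ltr_pwDr // addr_ge0.
have e'0 : 0 < e / (2 * c) by rewrite divr_gt0 // mulr_gt0.
have /eqaddoP/(_ _ e'0) := diff_locally dk.
have := smooth_near sh; rewrite (near_shift 0) subr0 => nsh nk.
have /nbhs_ballP[d /= d0 Hd] : nbhs (0 : V) [set y : V | smooth_at h (y + x) /\
   `|'D_u h (y + x) - ('D_u h x + 'd ('D_u h) x y)| <= e / (2 * c) * `|y|].
  apply: filterI; first exact: nsh.
  exact: nk.
near=> t.
have t0 : 0 < t by near: t; exact: nbhs_right_gt.
have tc : t * c < d by rewrite -ltr_pdivlMr //; near: t; apply: nbhs_right_lt; exact: divr_gt0.
have inb s r : 0 <= s <= t -> 0 <= r <= t -> ball (0 : V) d (s *: u + r *: v).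
  move=> /andP[s0 st] /andP[r0 rt]; rewrite -ball_normE /= sub0r normrN.
  apply: le_lt_trans tc; apply: le_trans (ler_normD _ _) _.
  rewrite !normrZ !ger0_norm //.
  have := ler_wpM2r (normr_ge0 u) st; have := ler_wpM2r (normr_ge0 v) rt.
  rewrite /c; nra.
pose phi (s : R) : R := h (s *: u + (t *: v + x)) - h (s *: u + x).
pose dphi (s : R) : R := 'D_u h (s *: u + (t *: v + x)) - 'D_u h (s *: u + x).
have dphiP s : 0 <= s <= t -> is_derive s 1 phi (dphi s).
  move=> st; apply: is_deriveB; apply: is_derive_line; apply: diff_derivable; apply: smooth_diff.
    by rewrite addrA; apply: (Hd (s *: u + t *: v) _).1; apply: inb => //; rewrite lexx ltW.
  have bs : ball (0 : V) d (s *: u + 0 *: v) by apply: inb => //; rewrite lexx ltW.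
  by have := (Hd _ bs).1; rewrite scale0r addr0.
have dphiI s : s \in `]0, t[%R -> is_derive s 1 phi (dphi s).
  by rewrite in_itv /= => /andP[s0 s1]; apply: dphiP; rewrite !ltW.
have cphi : {within `[0, t], continuous phi}.
  apply: derivable_within_continuous => s; rewrite in_itv /= => st.
  by apply: ex_derive; exact: (dphiP s).
have [s sin sE] := MVT t0 dphiI cphi.
have {sin} st : 0 <= s <= t by move: sin; rewrite in_itv /= => /andP[/ltW-> /ltW->].
have -> : h (t *: u + t *: v + x) - h (t *: u + x) - h (t *: v + x) + h x = t * dphi s.
  by rewrite mulrC -[t in RHS]subr0 -sE /phi scale0r !add0r addrA; ring.
have tt : 0 <= t <= t by rewrite lexx ltW.
have t00 : (0 : R) <= 0 <= t by rewrite lexx ltW.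
have b1 := (Hd _ (inb s t st tt)).2; have b2 := (Hd _ (inb s 0 st t00)).2.
have L r1 r2 : 'd ('D_u h) x (r1 *: u + r2 *: v) = r1 * 'd ('D_u h) x u + r2 * 'd ('D_u h) x v.
  by rewrite linearD !linearZ.
rewrite L -addrA in b1; rewrite L mul0r scale0r !addr0 in b2; rewrite (deriveE v dk).
have nv : forall r (w : V), 0 <= r <= t -> `|r *: w| <= t * `|w|.
  move=> r w /andP[r0 rt]; rewrite normrZ ger0_norm //; exact: ler_wpM2r.
have m1 : `|s *: u + t *: v| <= t * c.
  apply: le_trans (ler_normD _ _) _; have := nv s u st; have := nv t v tt; rewrite /c; nra.
have m2 : `|s *: u| <= t * c.
  have := nv s u st; rewrite /c; have := normr_ge0 v; nra.
have {m1}b1 := le_trans b1 (ler_wpM2l (ltW e'0) m1).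
have {m2}b2 := le_trans b2 (ler_wpM2l (ltW e'0) m2).
have E : e / (2 * c) * (t * c) = e * t / 2 by field; rewrite gt_eqF.
rewrite {}E in b1 b2.
have -> : t * dphi s - t ^+ 2 * 'd ('D_u h) x v = t * (dphi s - t * 'd ('D_u h) x v) by ring.
rewrite normrM gtr0_norm // expr2 mulrCA ler_pM2l //.
move: b1 b2; rewrite /dphi /= /GRing.scale /=.
set A := 'D_u h (s *: u + _); set B := 'D_u h (s *: u + x).
set C := 'D_u h x; set p := 'd ('D_u h) x u; set q := 'd ('D_u h) x v.
rewrite !ler_norml => /andP[? ?] /andP[? ?]; apply/andP; split; lra.
Unshelve. all: by end_near. Qed.

(** The second difference is symmetric in [u] and [v], so for small t the gap between the mixed
    derivatives times t^2 is at most e t^2. Commutation matters because [O4] tests derivatives in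
    one order only. *)
Lemma schwarz V (h : V -> R) x u v : smooth_at h x -> 'D_u ('D_v h) x = 'D_v ('D_u h) x.
Proof.
move=> sh; apply/eqP; rewrite -subr_eq0 -normr_le0; apply/ler_addgt0Pl => e e0; rewrite addr0.
have e2 : 0 < e / 2 by rewrite divr_gt0.
have n0 : \forall t \near (0 : R)^'+, 0 < t by exact: nbhs_right_gt.
have [t [t0 []]] := filter_ex (filterI n0 (filterI (second_difference u v sh e2) (second_difference v u sh e2))).
 rewrite (addrC (t *: v) (t *: u)) => b1 b2.
rewrite -(ler_pM2l (exprn_gt0 2 t0)) -[X in X * _](ger0_norm (exprn_ge0 2 (ltW t0))) -normrM.
move: b1 b2; move: ('D_u ('D_v h) x) ('D_v ('D_u h) x) (t ^+ 2) => A B T.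
move: (h (t *: u + t *: v + x)) (h (t *: u + x)) (h (t *: v + x)) (h x) => p q r s.
rewrite !ler_norml => /andP[? ?] /andP[? ?]; apply/andP; split; lra.
Qed.

Fixpoint flat V n (h : V -> R) : Prop :=
  if n is n'.+1 then h 0 = 0 /\ forall v, flat n' ('D_v h) else True.

(* h belongs to the n-th power of the maximal ideal of germs at 0. *)
Definition van V n (h : V -> R) := smooth_at h 0 /\ flat n h.

Lemma flat_ext V n (h k : V -> R) :
  (\forall y \near (0 : V), h y = k y) -> flat n h -> flat n k.
Proof.
elim: n h k => //= n IH h k hk [h0 dh]; split; first by rewrite -(nbhs_singleton hk).
move=> v; apply: IH (dh v); have /near_join := hk; apply: filterS => y; exact: near_eq_derive.
Qed.

Lemma van_ext V n (h k : V -> R) :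
  (\forall y \near (0 : V), h y = k y) -> van n h -> van n k.
Proof. by move=> hk [sh fh]; split; [apply: smooth_ext sh|apply: flat_ext fh]. Qed.

Lemma van_eq V n (h k : V -> R) : (forall y, h y = k y) -> van n h -> van n k.
Proof. by move=> hk; apply: van_ext; exact: nearW. Qed.

Lemma vanS V n (h : V -> R) :
  van n.+1 h <-> [/\ smooth_at h 0, h 0 = 0 & forall v, van n ('D_v h)].
Proof.
split=> [[sh [h0 dh]]|[sh h0 dh]].
  by split=> // v; split; [exact: smooth_derive|exact: dh].
by split=> //=; split=> // v; case: (dh v).
Qed.

Lemma van_smooth V n (h : V -> R) : van n h -> smooth_at h 0.
Proof. by case. Qed.

Lemma van0 V (h : V -> R) : van 0 h <-> smooth_at h 0.
Proof. by split=> [[]|]. Qed.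

Lemma vanW V n (h : V -> R) : van n.+1 h -> van n h.
Proof.
elim: n h => [|n IH] h; first by move/van_smooth/van0.
by move=> /vanS[sh h0 dh]; apply/vanS; split=> // v; apply: IH.
Qed.

Lemma van_le V m n (h : V -> R) : (m <= n)%N -> van n h -> van m h.
Proof.
move=> /subnK <-; elim: (n - m)%N => // k IH; rewrite addSn => /vanW; exact: IH.
Qed.

Lemma van_cst0 V n : van n (fun _ : V => 0).
Proof.
elim: n => [|n IH]; first by apply/van0; exact: smooth_cst.
apply/vanS; split=> [||v] //; first exact: smooth_cst.
by apply: van_eq IH => y; rewrite derive_cst.
Qed.

Lemma vanD V n (h k : V -> R) : van n h -> van n k -> van n (fun y => h y + k y).
Proof.
elim: n h k => [|n IH] h k; first by move=> /van0 ? /van0 ?; apply/van0; exact: smoothD.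
move=> /vanS[sh h0 dh] /vanS[sk k0 dk]; apply/vanS; split=> [||v].
- exact: smoothD.
- by rewrite h0 k0 addr0.
- apply: van_ext (IH _ _ (dh v) (dk v)).
  apply: filterS2 (smooth_near sh) (smooth_near sk) => y /smooth_diff dhy /smooth_diff dky.
  by rewrite deriveD //; exact: diff_derivable.
Qed.

Lemma deriveM_near V (h k : V -> R) v (x : V) : smooth_at h x -> smooth_at k x ->
  \forall y \near x, 'D_v (fun z => h z * k z) y = h y * 'D_v k y + k y * 'D_v h y.
Proof.
move=> sh sk.
apply: filterS2 (smooth_near sh) (smooth_near sk) => y /smooth_diff dhy /smooth_diff dky.
by rewrite deriveM //; exact: diff_derivable.
Qed.

(** Product rule, with induction on the total order m + n, since the two summands lower the order of
    different factors. *)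
Lemma vanM V m n (h k : V -> R) : van m h -> van n k -> van (m + n) (fun y => h y * k y).
Proof.
have [p] := ubnP (m + n); elim: p m n h k => // p IH m n h k.
rewrite ltnS; case emn : (m + n)%N => [|q] mnp vh vk.
  by apply/van0; apply: smoothM; [exact: van_smooth vh|exact: van_smooth vk].
have sh := van_smooth vh; have sk := van_smooth vk.
apply/vanS; split=> [||v]; first exact: smoothM.
  case: m emn vh mnp => [|m] emn vh mnp; last by have /vanS[_ -> _] := vh; rewrite mul0r.
  case: n emn vk mnp => [|n] emn vk mnp //; by have /vanS[_ -> _] := vk; rewrite mulr0.
(* Differentiation lowers the order by one, except at order 0, where [i.-1] is again 0. In that case
   the order is lowered on the other factor by [vanW]. *)
have deriv1 i (l : V -> R) : van i l -> van i.-1 ('D_v l).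
  case: i => [|i]; last by move=> /vanS[].
  by move=> /van_smooth sl; apply/van0; exact: smooth_derive.
have E : \forall y \near (0 : V), h y * 'D_v k y + k y * 'D_v h y = 'D_v (fun z => h z * k z) y.
  by apply: filterS (deriveM_near v sh sk) => y ->.
apply: van_ext E _; apply: vanD.
- case: n emn vk mnp => [|n] emn vk mnp.
    have mE : m = q.+1 by rewrite -emn addn0.
    rewrite -[q]addn0; apply: IH; [by rewrite addn0|by apply: vanW; rewrite -mE|exact: (deriv1 0%N)].
  have mE : q = (m + n)%N by move: emn; rewrite addnS => -[].
  by rewrite mE; apply: IH; [rewrite -mE|exact: vh|exact: (deriv1 n.+1)].
- case: m emn vh mnp => [|m] emn vh mnp.
    have nE : n = q.+1 by rewrite -emn.
    rewrite -[q]addn0; apply: IH; [by rewrite addn0|by apply: vanW; rewrite -nE|exact: (deriv1 0%N)].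
  have mE : q = (n + m)%N by move: emn; rewrite addSn addnC => -[].
  by rewrite mE; apply: IH; [rewrite -mE|exact: vk|exact: (deriv1 m.+1)].
Qed.

Lemma vanMl V n (h k : V -> R) : smooth_at h 0 -> van n k -> van n (fun y => h y * k y).
Proof. by move=> /van0 vh; exact: vanM vh. Qed.

Lemma vanZ V n (c : R) (h : V -> R) : van n h -> van n (fun y => c * h y).
Proof. by apply: vanMl; exact: smooth_cst. Qed.

Lemma vanB V n (h k : V -> R) : van n h -> van n k -> van n (fun y => h y - k y).
Proof. by move=> vh /(vanZ (-1)) vk; apply: van_eq (vanD vh vk) => y; rewrite mulN1r. Qed.

Lemma van_sum V n m (h : 'I_m -> V -> R) :
  (forall i, van n (h i)) -> van n (fun y => \sum_(i < m) h i y).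
Proof.
elim: m h => [|m IH] h sh.
  by apply: van_eq (van_cst0 V n) => y; rewrite big_ord0.
apply: van_eq (vanD (sh ord0) (IH _ (fun i => sh (lift ord0 i)))) => y.
by rewrite big_ord_recl.
Qed.

Lemma derive_comp_near V W m (phi : V -> 'rV[R]_m) (h : 'rV[R]_m -> W) x v :
  smooth_at phi x -> smooth_at h (phi x) -> \forall y \near x,
  'D_v (h \o phi) y = \sum_(i < m) 'D_v (fun y => phi y 0 i) y *: 'D_(delta_mx 0 i) h (phi y).
Proof.
move=> sphi /smooth_near sh; have sh' := smooth_cont sphi sh.
apply: filterS2 (smooth_near sphi) sh' => y /smooth_diff dy /smooth_diff dh.
exact: derive_comp.
Qed.

(** Order count in the chain rule: a derivative of a coordinate of [phi] has order b, the composed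
    partial derivative has order a (b + 1) by induction, and b + a (b + 1) is one less than (a +
    1)(b + 1). *)
Lemma van_comp V m a b (phi : V -> 'rV[R]_m) (h : 'rV[R]_m -> R) :
  phi 0 = 0 -> (forall i, van b.+1 (fun y => phi y 0 i)) ->
  van a h -> van (a * b.+1) (h \o phi).
Proof.
move=> p0 vphi; have sphi : smooth_at phi 0.
  by apply: smooth_row => i; exact: van_smooth (vphi i).
elim: a h => [|a IH] h.
  by move=> /van_smooth sh; apply/van0; apply: smooth_comp; rewrite ?p0.
move=> /vanS[sh h0 dh]; rewrite mulSn addSn; apply/vanS; split=> [||v].
- by apply: smooth_comp; rewrite ?p0.
- by rewrite /= p0.
have sh' : smooth_at h (phi 0) by rewrite p0.
have E := derive_comp_near v sphi sh'.
have {}E : \forall y \near (0 : V), \sum_(i < m) 'D_v (fun y => phi y 0 i) y *: 'D_(delta_mx 0 i) h (phi y) = 'D_v (h \o phi) y.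
  by apply: filterS E => y ->.
apply: van_ext E _; apply: van_sum => i; apply: vanM; first by have /vanS[_ _] := vphi i.
exact: (IH _ (dh _)).
Qed.

Lemma van_iter V n (h : V -> R) vs : van n h -> (size vs < n)%N -> iter_derive vs h 0 = 0.
Proof.
elim/last_ind: vs n h => [|vs v IH] [|n] h // /vanS[sh h0 dh] //.
by rewrite size_rcons ltnS iter_derive_rcons; apply: IH.
Qed.

Notation eu := (@e_u R).
Notation ev := (@e_v R).

Lemma iter_derive_nseqS V W n v (h : V -> W) :
  iter_derive (nseq n.+1 v) h = iter_derive (nseq n v) ('D_v h).
Proof. by elim: n => [|n IH] //=; congr ('D_v _); rewrite -IH. Qed.

Lemma iter_derive_cat V W s1 s2 (h : V -> W) :
  iter_derive (s1 ++ s2) h = iter_derive s1 (iter_derive s2 h).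
Proof. exact: foldr_cat. Qed.

Lemma near_iter_derive_comm V n u v (h : V -> R) x : smooth_at h x ->
  \forall y \near x, iter_derive (nseq n v) ('D_u h) y = 'D_u (iter_derive (nseq n v) h) y.
Proof.
move=> sh; elim: n => [|n IH]; first exact: nearW.
have /near_join := IH; apply: filterS2 (smooth_near (smooth_iter (nseq n v) sh)) => y sy E.
by rewrite /= (schwarz _ _ sy); apply: near_eq_derive.
Qed.

Lemma derive2 W (h : 'rV[R]_2 -> W) p w : differentiable h p ->
  'D_w h p = w 0 0 *: 'D_eu h p + w 0 1 *: 'D_ev h p.
Proof.
have E0 : ord0 = 0 :> 'I_2 by exact: val_inj.
have E1 : lift ord0 ord0 = 1 :> 'I_2 by exact: val_inj.
by move=> dh; rewrite (derive_basis w dh) 2!big_ord_recl big_ord0 addr0 E1 E0.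
Qed.

Lemma van2S n (h : 'rV[R]_2 -> R) : smooth_at h 0 -> h 0 = 0 ->
  van n ('D_eu h) -> van n ('D_ev h) -> van n.+1 h.
Proof.
move=> sh h0 du dv; apply/vanS; split; [by []|by []|move=> w].
apply: van_ext (vanD (vanZ (w 0 0) du) (vanZ (w 0 1) dv)).
by apply: filterS (smooth_near sh) => y /smooth_diff dy; rewrite (derive2 w dy).
Qed.

(** The ideal asks for derivatives in all directions; by linearity the two partial derivatives
    suffice at each stage, and commuting them brings the u-derivatives outermost, as in [O4]. *)
Lemma van_of_iter n (h : 'rV[R]_2 -> R) : smooth_at h 0 ->
  (forall i j, (i + j < n)%N -> iter_derive (nseq i eu ++ nseq j ev) h 0 = 0) -> van n h.
Proof.
elim: n h => [|n IH] h sh dh; first exact/van0.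
apply: van2S; [by []|exact: (dh 0 0)%N| |].
- apply: IH; first exact: smooth_derive.
  move=> i j ij; have := dh i.+1 j ij; rewrite !iter_derive_cat iter_derive_nseqS => <-.
  exact: (nbhs_singleton (near_iter_derive (nseq i eu) (near_iter_derive_comm j eu ev sh))).
- apply: IH; first exact: smooth_derive.
  move=> i j ij; have := dh i j.+1; rewrite addnS ltnS => /(_ ij).
  by rewrite !iter_derive_cat iter_derive_nseqS.
Qed.
End Vanishing.

(** * Third-order jets in the plane *)

Section Jets.
Context {R : realType}.
Implicit Types (V W : normedModType R).
Notation eu := (@e_u R).
Notation ev := (@e_v R).
Notation plane := 'rV[R]_2.

Lemma near_all V (x : V) (P : V -> Prop) : (forall y, P y) -> \forall y \near x, P y.
Proof. by move=> HP; apply: nearW. Qed.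

Definition on_axis (x : plane) : Prop := x 0 1 = 0.

Lemma sum_I2 (W : nmodType) (F : 'I_2 -> W) : \sum_(i < 2) F i = F 0 + F 1.
Proof.
rewrite big_ord_recl big_ord1; congr (F _ + F _); exact: val_inj.
Qed.

Lemma plane_eq (x y : plane) : x 0 0 = y 0 0 -> x 0 1 = y 0 1 -> x = y.
Proof.
move=> h0 h1; apply/rowP => -[[|[|i]] hi] //.
  by rewrite [Ordinal hi](_ : _ = 0) //; exact: val_inj.
by rewrite [Ordinal hi](_ : _ = 1) //; exact: val_inj.
Qed.

Lemma eu0 : eu 0 0 = 1. Proof. by rewrite mxE. Qed.
Lemma eu1 : eu 0 1 = 0. Proof. by rewrite mxE. Qed.
Lemma ev0 : ev 0 0 = 0. Proof. by rewrite mxE. Qed.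
Lemma ev1 : ev 0 1 = 1. Proof. by rewrite mxE. Qed.

Lemma derive_line0 V W (h : V -> W) x w :
  (\forall t \near (0 : R), h (t *: w + x) = h x) -> 'D_w h x = 0.
Proof.
move=> hw; apply: lim_near_cst => //; apply: cvg_within.
by apply: filterS hw => t /= ->; rewrite subrr scaler0.
Qed.

(** The axis is invariant under translations along u, so an identity that holds only on it may be
    differentiated in that direction. *)
Lemma axis_derive (h : plane -> R) :
  (\forall x \near (0 : plane), on_axis x -> h x = 0) ->
  \forall x \near (0 : plane), on_axis x -> 'D_eu h x = 0.
Proof.
move=> h0; have /near_join := h0; apply: filterS => x hx x1.
have hxx := nbhs_singleton hx x1.
apply: derive_line0; rewrite hxx.
have tx : t *: eu + x @[t --> (0 : R)] --> x.
  rewrite -[X in _ --> X]add0r -(scale0r eu); apply: cvgD; last exact: cvg_cst.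
  by apply: cvgZr_tmp; exact: cvg_id.
have := tx _ hx; rewrite /= nbhs_simpl /=; apply: filterS => t; apply.
by rewrite /on_axis !mxE x1 mulr0 addr0.
Qed.

Instance is_derive_proj m (x w : 'rV[R]_m) i : is_derive x w (fun y : 'rV[R]_m => y 0 i : R) (w 0 i).
Proof.
apply: DeriveDef; first by apply: diff_derivable; exact: differentiable_coord.
by have := derive_mx (@derivable_id _ _ x w); rewrite derive_id; move/matrixP/(_ 0 i); rewrite !mxE.
Qed.

Lemma isD_cst V (x w : V) (c : R) : is_derive x w (fun _ : V => c) 0.
Proof. exact: is_derive_cst. Qed.

Lemma isD_add V (f g : V -> R) x w a b : is_derive x w f a -> is_derive x w g b ->
  is_derive x w (fun y => f y + g y) (a + b).
Proof. exact: is_deriveD. Qed.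

Lemma isD_mul V (f g : V -> R) x w a b : is_derive x w f a -> is_derive x w g b ->
  is_derive x w (fun y => f y * g y) (f x * b + g x * a).
Proof. exact: is_deriveM. Qed.

Lemma isD_exp V (f : V -> R) n x w a : is_derive x w f a ->
  is_derive x w (fun y => f y ^+ n.+1) (n.+1%:R * f x ^+ n * a).
Proof.
move=> df; have := @is_deriveX _ _ f n.+1 x w a df.
by have -> : f ^+ n.+1 = (fun y => f y ^+ n.+1) by apply/funext => y; rewrite exprfctE.
Qed.

Definition cubic (c : nat -> nat -> R) (x : plane) : R :=
  let u := x 0 0 in let v := x 0 1 in
  c 0 0 + c 1 0 * u + c 0 1 * v + c 2 0 * u ^+ 2 + c 1 1 * (u * v) + c 0 2 * v ^+ 2
  + c 3 0 * u ^+ 3 + c 2 1 * (u ^+ 2 * v) + c 1 2 * (u * v ^+ 2) + c 0 3 * v ^+ 3.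

(** Coefficients of a partial derivative. The cut-off discards the entries of [c] of total degree
    above 3, which do not belong to [cubic c]. *)
Definition shift_u (c : nat -> nat -> R) i j :=
  if (i + j < 3)%N then i.+1%:R * c i.+1 j else 0.
Definition shift_v (c : nat -> nat -> R) i j :=
  if (i + j < 3)%N then j.+1%:R * c i j.+1 else 0.

Lemma derive_cubic c x w :
  'D_w (cubic c) x = w 0 0 * cubic (shift_u c) x + w 0 1 * cubic (shift_v c) x.
Proof.
have du : is_derive x w (fun x : plane => x 0 0 : R) (w 0 0) by exact: is_derive_proj.
have dv : is_derive x w (fun x : plane => x 0 1 : R) (w 0 1) by exact: is_derive_proj.
(* The differentiation rules produce the derivative as an unknown [d], which [ring] then identifies
   with the claimed value. *)
have [d [dc dE]] : exists d, is_derive x w (cubic c) d /\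
    d = w 0 0 * cubic (shift_u c) x + w 0 1 * cubic (shift_v c) x.
  eexists; split; first by
    rewrite /cubic; repeat first [exact: du|exact: dv|eapply isD_cst|eapply isD_add|eapply isD_mul|eapply isD_exp].
  rewrite /cubic /shift_u /shift_v /=; ring.
by rewrite (@derive_val _ _ _ _ _ _ _ dc) dE.
Qed.

Lemma smooth_cubic c x : smooth_at (cubic c) x.
Proof.
rewrite /cubic; repeat first [exact: smooth_proj|exact: smooth_cst|apply: smoothD
  |apply: smoothM|apply: smoothX].
Qed.

Lemma iter_cubic c i j : (i + j <= 3)%N ->
  iter_derive (nseq i eu ++ nseq j ev) (cubic c) 0 = (i`! * j`!)%:R * c i j.
Proof.
have Du c' : 'D_eu (cubic c') = cubic (shift_u c').
  by apply/funext => x; rewrite derive_cubic eu0 eu1 mul1r mul0r addr0.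
have Dv c' : 'D_ev (cubic c') = cubic (shift_v c').
  by apply/funext => x; rewrite derive_cubic ev0 ev1 mul1r mul0r add0r.
have iDu n c' : iter_derive (nseq n eu) (cubic c') = cubic (iter n shift_u c').
  elim: n => [|n IH] //; rewrite -[nseq n.+1 eu]/(eu :: nseq n eu) iterS -Du -IH; exact: erefl.
have iDv n c' : iter_derive (nseq n ev) (cubic c') = cubic (iter n shift_v c').
  elim: n => [|n IH] //; rewrite -[nseq n.+1 ev]/(ev :: nseq n ev) iterS -Dv -IH; exact: erefl.
have C0 c' : cubic c' 0 = c' 0 0 by rewrite /cubic !mxE; ring.
rewrite iter_derive_cat iDv iDu C0 => {Du Dv iDu iDv C0}.
by case: i => [|[|[|[|i]]]]; case: j => [|[|[|[|j]]]] // _;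
  rewrite /= /shift_u /shift_v /= ?factS ?fact0; ring.
Qed.

Lemma iter_deriveB V vs (h k : V -> R) x : smooth_at h x -> smooth_at k x ->
  \forall y \near x, iter_derive vs (fun z => h z - k z) y = iter_derive vs h y - iter_derive vs k y.
Proof.
move=> sh sk; elim: vs => [|v vs IH]; first exact: nearW.
have /near_join := IH.
apply: filterS3 (smooth_near (smooth_iter vs sh)) (smooth_near (smooth_iter vs sk)).
move=> y /smooth_diff dh /smooth_diff dk E; rewrite /= (near_eq_derive _ E) deriveB //; exact: diff_derivable.
Qed.

Lemma jet_coef (h : plane -> R) c i j : smooth_at h 0 -> van 4 (fun x => h x - cubic c x) ->
  (i + j <= 3)%N -> iter_derive (nseq i eu ++ nseq j ev) h 0 = (i`! * j`!)%:R * c i j.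
Proof.
move=> sh vh ij; rewrite -iter_cubic //; apply/eqP; rewrite -subr_eq0; apply/eqP.
rewrite -(nbhs_singleton (iter_deriveB _ sh (smooth_cubic c 0))).
by apply: (van_iter vh); rewrite size_cat !size_nseq ltnS.
Qed.

(** No remainder formula is involved: it suffices that all derivatives of order at most 3 of the
    difference vanish at 0. *)
Lemma taylor3 (h : plane -> R) c : smooth_at h 0 ->
  (forall i j, (i + j <= 3)%N -> iter_derive (nseq i eu ++ nseq j ev) h 0 = (i`! * j`!)%:R * c i j) ->
  van 4 (fun x => h x - cubic c x).
Proof.
move=> sh hc; apply: van_of_iter; first by apply: smoothB => //; exact: smooth_cubic.
move=> i j ij; rewrite (nbhs_singleton (iter_deriveB _ sh (smooth_cubic c 0))).
by rewrite hc // iter_cubic // subrr.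
Qed.

(* The cubic polynomials without constant term whose v-derivative vanishes on
   the axis: u^i v^j occurs only for j <> 1. *)
Definition axis_jet (p a b c d e : R) (i j : nat) : R :=
  match i, j with
  | 1%N, 0%N => p | 2%N, 0%N => a | 0%N, 2%N => b
  | 3%N, 0%N => c | 1%N, 2%N => d | 0%N, 3%N => e | _, _ => 0
  end.

Lemma axis_jetE p a b c d e x : cubic (axis_jet p a b c d e) x =
  let u := x 0 0 in let v := x 0 1 in
  p * u + a * u ^+ 2 + b * v ^+ 2 + c * u ^+ 3 + d * (u * v ^+ 2) + e * v ^+ 3.
Proof. rewrite /cubic /axis_jet /=; ring. Qed.

(** Differentiating the hypothesis along the axis also kills the coefficients of u v and u^2 v. The
    denominators of the witnesses are the factorials i! j!. *)
Lemma taylor_axis (h : plane -> R) : smooth_at h 0 -> h 0 = 0 ->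
  (\forall x \near (0 : plane), on_axis x -> 'D_ev h x = 0) ->
  exists p a b c d e, van 4 (fun x => h x - cubic (axis_jet p a b c d e) x).
Proof.
move=> sh h0 hv.
pose D i j := iter_derive (nseq i eu ++ nseq j ev) h 0.
exists (D 1 0)%N, (D 2 0 / 2)%N, (D 0 2 / 2)%N, (D 3 0 / 6)%N, (D 1 2 / 2)%N, (D 0 3 / 6)%N.
have hu := axis_derive hv.
have D00 : D 0%N 0%N = 0 by exact: h0.
have D01 : D 0%N 1%N = 0 by exact: (nbhs_singleton hv (mxE _ _ _ _)).
have D11 : D 1%N 1%N = 0 by exact: (nbhs_singleton hu (mxE _ _ _ _)).
have D21 : D 2%N 1%N = 0 by exact: (nbhs_singleton (axis_derive hu) (mxE _ _ _ _)).
apply: taylor3 => // i j; rewrite -/(D i j) => {hv hu h0}.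
move: D D00 D01 D11 D21 => D D00 D01 D11 D21.
by case: i => [|[|[|[|i]]]]; case: j => [|[|[|[|j]]]] // _;
  rewrite /axis_jet ?factS ?fact0 ?mulr0 //; field.
Qed.

Lemma vanN V n (h : V -> R) : van n h -> van n (fun y => - h y).
Proof. by move=> /(vanZ (-1)) vh; apply: van_eq vh => y; rewrite mulN1r. Qed.

Lemma vanD_minn V m n (h k : V -> R) : van m h -> van n k -> van (minn m n) (fun y => h y + k y).
Proof.
by move=> vh vk; apply: vanD; [apply: van_le vh; exact: geq_minl|apply: van_le vk; exact: geq_minr].
Qed.

Lemma vanX V m k (h : V -> R) : van m h -> van (k * m) (fun y => h y ^+ k).
Proof.
move=> vh; elim: k => [|k IH]; first by apply/van0; exact: smooth_cst.
by apply: van_eq (vanM vh IH) => y; rewrite exprS.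
Qed.

Lemma van_cst V (c : R) : van 0 (fun _ : V => c).
Proof. by apply/van0; exact: smooth_cst. Qed.

Lemma van_proj m i : van 1 (fun x : 'rV[R]_m => x 0 i).
Proof. by apply/vanS; split=> [|//|v]; [exact: smooth_proj|rewrite mxE|apply/van0/smooth_derive/smooth_proj]. Qed.

End Jets.

(** Reads an order of vanishing off the syntax: sums take the minimum, products add, powers
    multiply, constants count 0 and coordinates 1. [vanish] compares the result with the required
    order by computation. *)
Ltac vanish_order := lazymatch goal with
  | H : van ?n ?f |- van _ ?f => exact H
  | H : van ?n ?f |- van _ (fun x => ?f x) => exact H
  | |- van _ (fun _ => ?c) => exact: van_cst
  | |- van _ (fun x => fun_of_matrix x _ _) => exact: van_proj
  | |- van _ (fun x => _ + _) => eapply vanD_minn; vanish_order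
  | |- van _ (fun x => - _) => eapply vanN; vanish_order
  | |- van _ (fun x => _ ^+ _) => eapply vanX; vanish_order
  | |- van _ (fun x => _ * _) => eapply vanM; vanish_order
  end.
Ltac vanish := eapply van_le; last vanish_order; exact isT.

Section JetComposition.
Context {R : realType}.
Notation plane := 'rV[R]_2.

(** The jet of [F] has no term linear in v, so an error in the second coordinate of [h] always meets
    a further factor of order at least 1. This is why the second coordinate is needed only modulo
    order 3, but the first one modulo order 4. *)
Lemma jet_comp (F : plane -> R) (h : plane -> plane) c10 c20 c02 c30 c12 c03 p a b c d e q r s :
  van 4 (fun x => F x - cubic (axis_jet c10 c20 c02 c30 c12 c03) x) ->
  smooth_at h 0 -> h 0 = 0 ->
  van 4 (fun x => h x 0 0 - cubic (axis_jet p a b c d e) x) ->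
  van 3 (fun x => h x 0 1 - (q * x 0 1 + r * (x 0 0 * x 0 1) + s * x 0 1 ^+ 2)) ->
  van 4 (fun x => F (h x) - cubic (axis_jet (c10 * p) (c10 * a + c20 * p ^+ 2)
    (c10 * b + c02 * q ^+ 2) (c10 * c + 2 * c20 * p * a + c30 * p ^+ 3)
    (c10 * d + 2 * c20 * p * b + 2 * c02 * q * r + c12 * p * q ^+ 2)
    (c10 * e + 2 * c02 * q * s + c03 * q ^+ 3)) x).
Proof.
move=> vF sh h0; set e1 := fun x => h x 0 0 - _; set e2 := fun x => h x 0 1 - _ => v1 v2.
have vu : van 1 (fun x : plane => x 0 0) := van_proj 0.
have vv : van 1 (fun x : plane => x 0 1) := van_proj 1.
(* [A] and [C] are the nonlinear parts of the two coordinates and [B] is the cubic part of [A]. In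
   the square of the first coordinate, 2 p u times the quadratic part of [A] belongs to the jet,
   while 2 p u [B] has order 4. *)
pose A (x : plane) := a * x 0 0 ^+ 2 + b * x 0 1 ^+ 2 + c * x 0 0 ^+ 3 + d * (x 0 0 * x 0 1 ^+ 2) + e * x 0 1 ^+ 3.
pose B (x : plane) := c * x 0 0 ^+ 3 + d * (x 0 0 * x 0 1 ^+ 2) + e * x 0 1 ^+ 3.
pose C (x : plane) := r * (x 0 0 * x 0 1) + s * x 0 1 ^+ 2.
have E1 x : h x 0 0 = p * x 0 0 + A x + e1 x by rewrite /e1 axis_jetE /A /=; ring.
have E2 x : h x 0 1 = q * x 0 1 + C x + e2 x by rewrite /e2 /C; ring.
have vh i : van 1 (fun x => h x 0 i).
  apply/vanS; split=> [||w]; first exact: smooth_coord.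
    by rewrite h0 mxE.
  by apply/van0/smooth_derive/smooth_coord.
have vA : van 2 A by rewrite /A; vanish.
have vB : van 3 B by rewrite /B; vanish.
have vC : van 2 C by rewrite /C; vanish.
pose D1 x := A x + e1 x; pose D2 x := C x + e2 x.
have vD1 : van 2 D1 by rewrite /D1; vanish.
have vD2 : van 2 D2 by rewrite /D2; vanish.
have vFh := van_comp h0 vh vF.
(* The cubic evaluated at [h x] minus the claimed jet, arranged so that every summand visibly has
   order at least 4. *)
pose rem x := c10 * e1 x + c20 * (A x ^+ 2 + 2 * p * (x 0 0 * B x) + e1 x * (2 * (p * x 0 0 + A x) + e1 x))
  + c02 * (C x ^+ 2 + e2 x * (2 * (q * x 0 1 + C x) + e2 x))
  + c30 * (D1 x * (3 * (p * x 0 0) ^+ 2 + 3 * (p * x 0 0) * D1 x + D1 x ^+ 2))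
  + c12 * (D1 x * (q * x 0 1 + D2 x) ^+ 2 + p * x 0 0 * (D2 x * (2 * (q * x 0 1) + D2 x)))
  + c03 * (D2 x * (3 * (q * x 0 1) ^+ 2 + 3 * (q * x 0 1) * D2 x + D2 x ^+ 2)).
have vrem : van 4 rem by rewrite /rem; vanish.
apply: van_eq (vanD vFh vrem) => x.
rewrite /rem /= !axis_jetE /= E1 E2 /D1 /D2 /A /B /C; ring.
Qed.
End JetComposition.

Ltac smooth_tac := repeat first [assumption | exact: smooth_proj | exact: smooth_cst | apply: smoothD
  | apply: smoothN | apply: smoothM | apply: smoothX].

(** * Coordinate changes preserving the axis *)

Section Coordinates.
Context {R : realType}.
Implicit Types (V W : normedModType R).
Notation eu := (@e_u R).
Notation ev := (@e_v R).
Notation plane := 'rV[R]_2.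

Lemma near_neq0 V (h : V -> R) x : smooth_at h x -> h x != 0 -> \forall y \near x, h y != 0.
Proof.
move=> sh h0; have n0 : nbhs (h x) [set z : R | z != 0].
  by apply: open_nbhs_nbhs; split => //; exact: open_neq.
exact: (smooth_cont sh n0).
Qed.

Lemma near_gt0 V (h : V -> R) x : smooth_at h x -> 0 < h x -> \forall y \near x, 0 < h y.
Proof.
move=> sh h0; have n0 : nbhs (h x) [set z : R | 0 < z].
  by apply: open_nbhs_nbhs; split => //; exact: open_gt.
exact: (smooth_cont sh n0).
Qed.

Lemma near_comp V W (h : V -> W) x y (P : set W) : smooth_at h x -> h x = y ->
  (\forall z \near y, P z) -> \forall z \near x, P (h z).
Proof. by move=> sh <- Ph; exact: (smooth_cont sh Ph). Qed.

Lemma diffeo_comp m (a b c : 'rV[R]_m) (h k : 'rV[R]_m -> 'rV[R]_m) :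
  diffeo_germ a b h -> diffeo_germ b c k -> diffeo_germ a c (k \o h).
Proof.
move=> [ha sh [h' [h'b sh' hK h'K]]] [kb sk [k' [k'c sk' kK k'K]]].
split; first by rewrite /= ha.
  by apply: smooth_comp_row; rewrite ?ha.
exists (h' \o k'); split.
- by rewrite /= k'c.
- by apply: smooth_comp_row; rewrite ?k'c.
- by apply: filterS2 hK (near_comp sh ha kK) => x e1 e2; rewrite /= e2.
- by apply: filterS2 k'K (near_comp sk' k'c h'K) => x e1 e2; rewrite /= e2.
Qed.

Definition mk2 (a b : R) : plane := a *: eu + b *: ev.

Lemma mk20 a b : mk2 a b 0 0 = a.
Proof. by rewrite !mxE mulr1 mulr0 addr0. Qed.

Lemma mk21 a b : mk2 a b 0 1 = b.
Proof. by rewrite !mxE mulr1 mulr0 add0r. Qed.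

Lemma mk2_eq (x : plane) a b : a = x 0 0 -> b = x 0 1 -> mk2 a b = x.
Proof. by move=> ea eb; apply: plane_eq; rewrite ?mk20 ?mk21. Qed.

Lemma smooth_mk2 V (a b : V -> R) x : smooth_at a x -> smooth_at b x -> smooth_at (fun y => mk2 (a y) (b y)) x.
Proof.
move=> sa sb; apply: smooth_row => -[[|[|i]] hi] //.
  by apply: smooth_ext sa; apply: nearW => y; rewrite -[LHS](mk20 (a y) (b y)); congr (mk2 _ _ _ _); exact: val_inj.
by apply: smooth_ext sb; apply: nearW => y; rewrite -[LHS](mk21 (a y) (b y)); congr (mk2 _ _ _ _); exact: val_inj.
Qed.

(** The last condition says that along the axis the image of d/dv is again vertical, so that the
    null direction survives the change of coordinates. *)
Definition axis_map (h : plane -> plane) := [/\ diffeo_germ 0 0 h,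
  \forall x \near (0 : plane), on_axis (h x) <-> on_axis x &
  \forall x \near (0 : plane), on_axis x -> 'D_ev (fun y => h y 0 0) x = 0].

Definition edge_coords (f : plane -> 'rV[R]_3) (phi : plane -> plane) := [/\ diffeo_germ 0 0 phi,
  \forall x \near (0 : plane), sing f (phi x) <-> on_axis x &
  \forall x \near (0 : plane), on_axis x -> 'D_ev (f \o phi) x = 0].

Lemma edge_coords_comp f phi h : smooth_at f 0 ->
  edge_coords f phi -> axis_map h -> edge_coords f (phi \o h).
Proof.
move=> sf [dphi P1 P2] [dh H1 H2]; split; first exact: diffeo_comp dh dphi.
  have [h0 sh _] := dh.
  by apply: filterS2 H1 (near_comp sh h0 P1) => x /= e1 e2; rewrite e2.
have [h0 sh _] := dh; have [p0 sphi _] := dphi.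
have sfphi : smooth_at (f \o phi) (h 0) by rewrite h0; apply: smooth_comp_row; rewrite ?p0.
have := derive_comp_near ev sh sfphi.
apply: filterS3 (filterI H1 H2) (near_comp sh h0 P2) => x [e1 e2] e3 e4 x1.
by rewrite [LHS]e4 sum_I2 e2 // e3 ?scale0r ?scaler0 ?addr0 //; apply/e1.
Qed.

(** Criterion for the last condition of [axis_map]: a smooth function without a term linear in v has
    vanishing v-derivative on the axis. *)
Lemma axis_even (g A B : plane -> R) : smooth_at A 0 -> smooth_at B 0 ->
  (forall t x, A (t *: ev + x) = A x) ->
  (\forall x \near (0 : plane), g x = A x + x 0 1 ^+ 2 * B x) ->
  \forall x \near (0 : plane), on_axis x -> 'D_ev g x = 0.
Proof.
move=> sA sB Aev gE; have /near_join := gE.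
apply: filterS3 (smooth_near sA) (smooth_near sB) => x /smooth_diff dA /smooth_diff dB gEx x1.
rewrite (near_eq_derive _ gEx).
have dA0 : 'D_ev A x = 0 by apply: derive_line0; apply: near_all => t; exact: Aev.
have DA := derivableP (@diff_derivable _ _ _ _ _ ev dA).
have DB := derivableP (@diff_derivable _ _ _ _ _ ev dB).
have D := isD_add DA (isD_mul (isD_exp 1 (is_derive_proj x ev 1)) DB).
by rewrite (@derive_val _ _ _ _ _ _ _ D) dA0 x1; ring.
Qed.

Lemma smooth_div V (h k : V -> R) x : smooth_at h x -> smooth_at k x -> k x != 0 ->
  smooth_at (fun y => h y / k y) x.
Proof. by move=> sh sk k0; apply: smoothM => //; exact: smoothV. Qed.

(* The Moebius denominators make the inverses of [mob_v] and [mob_u] explicit,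
   so that no inverse function theorem is needed. *)
Definition mob_v q r s (x : plane) := mk2 (x 0 0) (x 0 1 * (q + r * x 0 0) / (1 - s * x 0 1)).

Lemma mob_v_axis q r s : q != 0 -> axis_map (mob_v q r s).
Proof.
move=> q0; pose m (x : plane) := q + r * x 0 0; pose n (x : plane) := 1 - s * x 0 1.
(* The denominator of the inverse: w = v m / (1 - s v) solves to v = w / (m + s w), and [m] is
   unchanged because u is fixed. *)
pose k (x : plane) := m x + s * x 0 1.
have sm : smooth_at m 0 by rewrite /m; smooth_tac.
have sn : smooth_at n 0 by rewrite /n; smooth_tac.
have sk : smooth_at k 0 by rewrite /k; smooth_tac.
have m0 : m 0 != 0 by rewrite /m mxE mulr0 addr0.
have n0 : n 0 != 0 by rewrite /n mxE mulr0 subr0 oner_neq0.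
have k0 : k 0 != 0 by rewrite /k mxE mulr0 addr0.
have nm := near_neq0 sm m0; have nn := near_neq0 sn n0; have nk := near_neq0 sk k0.
split.
- split; first by rewrite /mob_v !mxE; apply: mk2_eq; rewrite !mxE ?mul0r.
    apply: smooth_mk2; first exact: smooth_proj.
    apply: (@smooth_div _ (fun x => _ * m x) n) => //; smooth_tac.
  exists (fun y : plane => mk2 (y 0 0) (y 0 1 / (q + r * y 0 0 + s * y 0 1))); split.
  + by apply: mk2_eq; rewrite !mxE ?mul0r.
  + by apply: smooth_mk2; [exact: smooth_proj|apply: (@smooth_div _ _ k) => //; exact: smooth_proj].
  + apply: filterS2 nm nn => x; rewrite /m /n => mx nx.
    apply: mk2_eq; rewrite /mob_v ?mk20 ?mk21 //; field; rewrite ?mx ?nx ?andbT //.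
    by rewrite [X in X != 0](_ : _ = q + r * x 0 0) ?mx //; ring.
  + apply: filterS2 nm nk => x; rewrite /m /k => mx kx.
    apply: mk2_eq; rewrite ?mk20 ?mk21 //; field; rewrite ?mx ?kx ?andbT //.
    by rewrite [X in X != 0](_ : _ = q + r * x 0 0) ?mx //; ring.
- apply: filterS2 nm nn => x mx nx; rewrite /on_axis /mob_v mk21; split => [/eqP|->]; last by rewrite !mul0r.
  by rewrite -/(m x) -/(n x) !mulf_eq0 invr_eq0 (negbTE mx) (negbTE nx) !orbF => /eqP.
- apply: (@axis_even _ (fun x => x 0 0) (fun=> 0)); smooth_tac.
    by move=> t x; rewrite !mxE mulr0 add0r.
  by apply: near_all => x; rewrite mk20 mulr0 addr0.
Qed.

(** The claimed jet times 1 - s v differs from v (q + r u) by r s u v^2 + q s^2 v^3; divided by the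
    unit 1 - s v this is the exact remainder, of order 3. *)
Lemma mob_v_jet q r s : van 4 (fun x => mob_v q r s x 0 0 - cubic (axis_jet 1 0 0 0 0 0) x)
  /\ van 3 (fun x => mob_v q r s x 0 1 - (q * x 0 1 + r * (x 0 0 * x 0 1) + (q * s) * x 0 1 ^+ 2)).
Proof.
split; first by apply: van_eq (van_cst0 _ _) => x; rewrite mk20 axis_jetE /=; ring.
pose n (x : plane) := 1 - s * x 0 1.
have sn : smooth_at n 0 by rewrite /n; smooth_tac.
have n0 : n 0 != 0 by rewrite /n mxE mulr0 subr0 oner_neq0.
have vn : van 0 (fun x => (n x)^-1) by apply/van0; exact: smoothV.
have v : van 3 (fun x : plane => (r * s * (x 0 0 * x 0 1 ^+ 2) + q * s ^+ 2 * x 0 1 ^+ 3) * (n x)^-1) by vanish.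
apply: van_ext v; apply: filterS (near_neq0 sn n0) => x; rewrite /n => nx.
by rewrite mk21; field.
Qed.

(** Expands as q u + q s u^2 + q s^2 u^3 + d u v^2 modulo order 4: the parameters adjust the
    coefficients of u, u^2 and u v^2, and v enters only through its square. *)
Definition mob_u q d s (x : plane) := mk2 (x 0 0 * (q + d * x 0 1 ^+ 2) / (1 - s * x 0 0)) (x 0 1).

Lemma mob_u_axis q d s : q != 0 -> axis_map (mob_u q d s).
Proof.
move=> q0; pose m (x : plane) := q + d * x 0 1 ^+ 2; pose n (x : plane) := 1 - s * x 0 0.
pose k (x : plane) := m x + s * x 0 0.
have sm : smooth_at m 0 by rewrite /m; smooth_tac.
have sn : smooth_at n 0 by rewrite /n; smooth_tac.
have sk : smooth_at k 0 by rewrite /k; smooth_tac.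
have m0 : m 0 != 0 by rewrite /m mxE expr0n mulr0 addr0.
have n0 : n 0 != 0 by rewrite /n mxE mulr0 subr0 oner_neq0.
have k0 : k 0 != 0 by rewrite /k mxE mulr0 addr0.
have nm := near_neq0 sm m0; have nn := near_neq0 sn n0; have nk := near_neq0 sk k0.
split.
- split; first by rewrite /mob_u !mxE; apply: mk2_eq; rewrite !mxE ?mul0r.
    apply: smooth_mk2; last exact: smooth_proj.
    apply: (@smooth_div _ (fun x => _ * m x) n) => //; smooth_tac.
  exists (fun y : plane => mk2 (y 0 0 / (q + d * y 0 1 ^+ 2 + s * y 0 0)) (y 0 1)); split.
  + by apply: mk2_eq; rewrite !mxE ?mul0r.
  + by apply: smooth_mk2; [apply: (@smooth_div _ _ k) => //; exact: smooth_proj|exact: smooth_proj].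
  + apply: filterS2 nm nn => x; rewrite /m /n => mx nx.
    apply: mk2_eq; rewrite /mob_u ?mk20 ?mk21 //; field; rewrite ?mx ?nx ?andbT //.
    by rewrite [X in X != 0](_ : _ = q + d * x 0 1 ^+ 2) ?mx //; ring.
  + apply: filterS2 nm nk => x; rewrite /m /k => mx kx.
    apply: mk2_eq; rewrite ?mk20 ?mk21 //; field; rewrite ?mx ?kx ?andbT //.
    by rewrite [X in X != 0](_ : _ = q + d * x 0 1 ^+ 2) ?mx //; ring.
- by apply: near_all => x; rewrite /on_axis /mob_u mk21.
- apply: (@axis_even _ (fun x => x 0 0 * q / n x) (fun x => x 0 0 * d / n x)).
  + by apply: smooth_div => //; smooth_tac.
  + by apply: smooth_div => //; smooth_tac.
  + by move=> t x; rewrite /n !mxE mulr0 add0r.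
  + by apply: filterS nn => x; rewrite /n mk20 => nx; field.
Qed.

Lemma mob_u_jet q d s : van 4 (fun x => mob_u q d s x 0 0 - cubic (axis_jet q (q * s) 0 (q * s ^+ 2) d 0) x)
  /\ van 3 (fun x => mob_u q d s x 0 1 - (1 * x 0 1 + 0 * (x 0 0 * x 0 1) + 0 * x 0 1 ^+ 2)).
Proof.
split; last by apply: van_eq (van_cst0 _ _) => x; rewrite mk21; ring.
pose n (x : plane) := 1 - s * x 0 0.
have sn : smooth_at n 0 by rewrite /n; smooth_tac.
have n0 : n 0 != 0 by rewrite /n mxE mulr0 subr0 oner_neq0.
have vn : van 0 (fun x => (n x)^-1) by apply/van0; exact: smoothV.
have v : van 4 (fun x : plane => (q * s ^+ 3 * x 0 0 ^+ 4 + s * d * (x 0 0 ^+ 2 * x 0 1 ^+ 2)) * (n x)^-1) by vanish.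
apply: van_ext v; apply: filterS (near_neq0 sn n0) => x; rewrite /n => nx.
by rewrite mk20 axis_jetE /=; field.
Qed.

(** Translation by -k in the coordinate u^-2, so the inverse is the same map with -k. It equals u +
    k u^3 / 2 up to higher order, hence can correct a u^3 coefficient without creating a u^2
    term. *)
Definition sqrt_u k (x : plane) := mk2 (x 0 0 / Num.sqrt (1 - k * x 0 0 ^+ 2)) (x 0 1).

Lemma sqrt_uK k : \forall x \near (0 : plane), sqrt_u (- k) (sqrt_u k x) = x.
Proof.
pose n (x : plane) := 1 - k * x 0 0 ^+ 2.
have sn : smooth_at n 0 by rewrite /n; smooth_tac.
have n0 : 0 < n 0 by rewrite /n mxE expr0n mulr0 subr0 ltr01.
apply: filterS (near_gt0 sn n0) => x; rewrite /n => nx.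
apply: mk2_eq; rewrite /sqrt_u ?mk20 ?mk21 //.
set w := Num.sqrt (1 - k * x 0 0 ^+ 2).
have w0 : 0 < w by rewrite sqrtr_gt0.
have w2 : w ^+ 2 = 1 - k * x 0 0 ^+ 2 by rewrite sqr_sqrtr // ltW.
have -> : 1 - - k * (x 0 0 / w) ^+ 2 = w^-1 ^+ 2.
  have -> : 1 - - k * (x 0 0 / w) ^+ 2 = (w ^+ 2 + k * x 0 0 ^+ 2) / w ^+ 2 by field; exact: lt0r_neq0.
  by rewrite {1}w2 subrK div1r exprVn.
rewrite sqrtr_sqr ger0_norm ?invr_ge0 ?ltW //; field; exact: lt0r_neq0.
Qed.

Lemma smooth_sqrt_u k : smooth_at (sqrt_u k) 0.
Proof.
pose n (x : plane) := 1 - k * x 0 0 ^+ 2.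
have sn : smooth_at n 0 by rewrite /n; smooth_tac.
have n0 : 0 < n 0 by rewrite /n mxE expr0n mulr0 subr0 ltr01.
apply: smooth_mk2; last exact: smooth_proj.
apply: smooth_div; [exact: smooth_proj|exact: smooth_sqrt|].
by rewrite sqrtr_eq0 -ltNge.
Qed.

Lemma sqrt_u_axis k : axis_map (sqrt_u k).
Proof.
have z j : sqrt_u j 0 = 0 by rewrite /sqrt_u; apply: mk2_eq; rewrite !mxE ?mul0r.
split.
- split=> //; first exact: smooth_sqrt_u.
  exists (sqrt_u (- k)); split=> //; [exact: smooth_sqrt_u|exact: sqrt_uK|].
  by have := sqrt_uK (- k); rewrite opprK.
- by apply: near_all => x; rewrite /on_axis mk21.
- have s1 := smooth_coord 0 (smooth_sqrt_u k).
  apply: (axis_even s1 (smooth_cst 0 _)).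
    by move=> t x; rewrite !mk20 !mxE mulr0 add0r.
  by apply: near_all => x; rewrite mulr0 addr0.
Qed.

Lemma sqrt_u_jet k : van 4 (fun x => sqrt_u k x 0 0 - cubic (axis_jet 1 0 0 (k / 2) 0 0) x)
  /\ van 3 (fun x => sqrt_u k x 0 1 - (1 * x 0 1 + 0 * (x 0 0 * x 0 1) + 0 * x 0 1 ^+ 2)).
Proof.
split; last by apply: van_eq (van_cst0 _ _) => x; rewrite mk21; ring.
pose n (x : plane) := 1 - k * x 0 0 ^+ 2.
have sn : smooth_at n 0 by rewrite /n; smooth_tac.
have n0 : 0 < n 0 by rewrite /n mxE expr0n mulr0 subr0 ltr01.
pose w (x : plane) := (Num.sqrt (n x))^-1.
have sw : smooth_at w 0 by apply: smoothV; [rewrite sqrtr_eq0 -ltNge|exact: smooth_sqrt].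
have vw : van 0 w by apply/van0.
(* With w = (1 - k u^2)^(-1/2) one has k u^2 = 1 - w^-2 and w - 1 - (1 - w^-2) / 2 = (w - 1)^2 (2 w
   + 1) / (2 w^2). Replacing (w - 1)^2 by (k u^2)^2 w^4 / (1 + w)^2 shows the remainder as u^5 times
   a smooth function with denominator [m]. *)
pose m (x : plane) := 2 * (1 + w x) ^+ 2.
have w1 : w 0 = 1 by rewrite /w /n mxE expr0n mulr0 subr0 sqrtr1 invr1.
have vm : van 0 (fun x => (m x)^-1).
  by apply/van0; apply: smoothV; [rewrite /m w1 lt0r_neq0 // mulr_gt0 // exprn_gt0|rewrite /m; smooth_tac].
have v : van 4 (fun x : plane => k ^+ 2 * x 0 0 ^+ 5 * w x ^+ 2 * (2 * w x + 1) * (m x)^-1) by vanish.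
apply: van_ext v; apply: filterS (near_gt0 sn n0) => x nx.
have wx : 0 < w x by rewrite invr_gt0 sqrtr_gt0.
have : w x ^+ 2 * n x = 1 by rewrite exprVn sqr_sqrtr ?ltW // mulVf // lt0r_neq0.
rewrite mk20 -/(n x) -/(w x) axis_jetE /m /n /=; move: (w x) wx (x 0 0) => {w m n sn n0 vw sw w1 vm nx} w w0 u E.
have kE : k * u ^+ 2 = 1 - w^-1 ^+ 2.
  have -> : k * u ^+ 2 = 1 - (w ^+ 2 * (1 - k * u ^+ 2)) / w ^+ 2 by field; exact: lt0r_neq0.
  by rewrite E div1r exprVn.
have -> : k ^+ 2 * u ^+ 5 = u * (k * u ^+ 2) ^+ 2 by ring.
have -> : k / 2 * u ^+ 3 = u * (k * u ^+ 2) / 2 by field.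
rewrite kE; field; rewrite lt0r_neq0 //= lt0r_neq0 //; lra.
Qed.

Definition shear_u b e (x : plane) := mk2 (x 0 0 - b * x 0 1 ^+ 2 - e * x 0 1 ^+ 3) (x 0 1).

Lemma shear_uK b e x : shear_u (- b) (- e) (shear_u b e x) = x.
Proof. by apply: mk2_eq; rewrite ?mk20 ?mk21 //; ring. Qed.

Lemma smooth_shear_u b e : smooth_at (shear_u b e) 0.
Proof. apply: smooth_mk2; smooth_tac. Qed.

Lemma shear_u_axis b e : axis_map (shear_u b e).
Proof.
have z c d : shear_u c d 0 = 0 by rewrite /shear_u; apply: mk2_eq; rewrite !mxE //; ring.
split.
- split=> //; first exact: smooth_shear_u.
  exists (shear_u (- b) (- e)); split=> //; first exact: smooth_shear_u.
    by apply: near_all => x; exact: shear_uK.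
  by apply: near_all => x; have := shear_uK (- b) (- e) x; rewrite !opprK.
- by apply: near_all => x; rewrite /on_axis mk21.
- apply: (@axis_even _ (fun x => x 0 0) (fun x => - b - e * x 0 1)); smooth_tac.
    by move=> t x; rewrite !mxE mulr0 add0r.
  by apply: near_all => x; rewrite mk20; ring.
Qed.

Lemma shear_u_jet b e : van 4 (fun x => shear_u b e x 0 0 - cubic (axis_jet 1 0 (- b) 0 0 (- e)) x)
  /\ van 3 (fun x => shear_u b e x 0 1 - (1 * x 0 1 + 0 * (x 0 0 * x 0 1) + 0 * x 0 1 ^+ 2)).
Proof.
by split; apply: van_eq (van_cst0 _ _) => x; rewrite ?mk20 ?mk21 ?axis_jetE /=; ring.
Qed.

Definition flip (s t : R) (x : plane) := mk2 (s * x 0 0) (t * x 0 1).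

Lemma smooth_flip s t : smooth_at (flip s t) 0.
Proof. apply: smooth_mk2; smooth_tac. Qed.

Lemma flip_axis s t : s ^+ 2 = 1 -> t ^+ 2 = 1 -> axis_map (flip s t).
Proof.
move=> s2 t2.
have z : flip s t 0 = 0 by rewrite /flip; apply: mk2_eq; rewrite !mxE //; ring.
have K x : flip s t (flip s t x) = x.
  by apply: mk2_eq; rewrite ?mk20 ?mk21 // mulrA -expr2 ?s2 ?t2 mul1r.
split.
- split=> //; first exact: smooth_flip.
  by exists (flip s t); split=> //; [exact: smooth_flip|apply: near_all|apply: near_all].
- apply: near_all => x; rewrite /on_axis mk21; split=> [/eqP|->]; last exact: mulr0.
  rewrite mulf_eq0 => /orP[/eqP t0|/eqP //]; move: t2; rewrite t0 expr0n => /eqP.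
  by rewrite eq_sym oner_eq0.
- apply: (@axis_even _ (fun x => s * x 0 0) (fun=> 0)); smooth_tac.
    by move=> r x; rewrite !mxE mulr0 add0r.
  by apply: near_all => x; rewrite mk20; ring.
Qed.

Lemma flip_jet s t : van 4 (fun x => flip s t x 0 0 - cubic (axis_jet s 0 0 0 0 0) x)
  /\ van 3 (fun x => flip s t x 0 1 - (t * x 0 1 + 0 * (x 0 0 * x 0 1) + 0 * x 0 1 ^+ 2)).
Proof.
by split; apply: van_eq (van_cst0 _ _) => x; rewrite ?mk20 ?mk21 ?axis_jetE /=; ring.
Qed.
End Coordinates.

(** * Reduction to the normal form *)

Section Cusp.
Context {R : realType}.
Implicit Types (V W : normedModType R).
Notation eu := (@e_u R).
Notation ev := (@e_v R).
Notation plane := 'rV[R]_2.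
Notation space := 'rV[R]_3.

Lemma derive_chain V W m (phi : V -> 'rV[R]_m) (h : 'rV[R]_m -> W) x v :
  differentiable phi x -> differentiable h (phi x) ->
  'D_v (h \o phi) x = 'D_('D_v phi x) h (phi x).
Proof.
move=> dphi dh; rewrite derive_comp // [RHS]derive_basis //.
by apply: eq_bigr => i _; rewrite derive_coord.
Qed.

Lemma diffeo_derive_inv m (a b : 'rV[R]_m) (h k : 'rV[R]_m -> 'rV[R]_m) :
  h a = b -> smooth_at h a -> smooth_at k b -> (\forall x \near a, k (h x) = x) ->
  \forall x \near a, forall w, 'D_('D_w h x) k (h x) = w.
Proof.
move=> hb sh sk kh; have /near_join := kh.
apply: filterS3 (smooth_near sh) (near_comp sh hb (smooth_near sk)) => x sx sk' E w.
rewrite -derive_chain; [|exact: smooth_diff|exact: smooth_diff].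
by rewrite (near_eq_derive w E) derive_id.
Qed.

Lemma diffeo_inj m (a b : 'rV[R]_m) (h : 'rV[R]_m -> 'rV[R]_m) : diffeo_germ a b h ->
  \forall x \near a, forall w, 'D_w h x = 0 -> w = 0.
Proof.
move=> [hb sh [k [ka sk kh hk]]].
apply: filterS (diffeo_derive_inv hb sh sk kh) => x E w w0.
by rewrite -(E w) w0 derive0.
Qed.

(** Vectors are rows, so the null vectors form the left kernel [kermx] of the Jacobian matrix. *)
Lemma sing_derive (f : plane -> space) p : differentiable f p ->
  sing f p <-> exists2 y, y != 0 & 'D_y f p = 0.
Proof.
move=> df; rewrite /sing /=; split=> [rk|[y y0]].
  have : kermx ('J f p) != 0.
    rewrite kermx_eq0 /row_free neq_ltn; by rewrite rk.
  move=> /rowV0Pn[y /sub_kermxP yJ y0]; exists y => //.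
  by rewrite deriveEjacobian.
rewrite deriveEjacobian // => yJ; rewrite ltn_neqAle rank_leq_row andbT.
by apply: contra_neqN y0 => rf; apply/eqP; rewrite -(mulmx_free_eq0 _ rf); apply/eqP.
Qed.

Lemma sing_comp (f : plane -> space) phi : diffeo_germ 0 0 phi -> smooth_at f 0 ->
  \forall x \near (0 : plane), sing f (phi x) <-> exists2 y, y != 0 & 'D_y (f \o phi) x = 0.
Proof.
move=> dphi sf; have inj := diffeo_inj dphi; have [p0 sphi [psi [q0 spsi phiK psiK]]] := dphi.
have inv := near_comp sphi p0 (diffeo_derive_inv q0 spsi sphi psiK).
apply: filterS (filterI (filterI inj inv) (filterI phiK
  (filterI (smooth_near sphi) (near_comp sphi p0 (smooth_near sf))))).
move=> x [[injx invx] [phiKx [sphix sfx]]].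
have ch y : 'D_y (f \o phi) x = 'D_('D_y phi x) f (phi x).
  by rewrite derive_chain //; exact: smooth_diff.
rewrite sing_derive; last exact: smooth_diff.
split=> -[y y0 yf].
  exists ('D_y psi (phi x)).
    by apply: contraNneq y0 => E; rewrite -(invx y) E derive0.
  by rewrite ch; have := invx y; rewrite phiKx => ->.
exists ('D_y phi x); last by rewrite -ch.
by apply: contraNneq y0 => E; rewrite (injx _ E).
Qed.

Lemma ord3 (P : 'I_3 -> Prop) : P 0 -> P 1 -> P 2%:R -> forall i, P i.
Proof.
move=> p0 p1 p2 [[|[|[|i]]] hi] //.
- by rewrite (_ : Ordinal hi = 0) //; exact: val_inj.
- by rewrite (_ : Ordinal hi = 1) //; exact: val_inj.
- by rewrite (_ : Ordinal hi = 2%:R) //; exact: val_inj.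
Qed.

Lemma sum_I3 (W : nmodType) (F : 'I_3 -> W) : \sum_(i < 3) F i = F 0 + F 1 + F 2%:R.
Proof.
rewrite !big_ord_recl big_ord0 addr0 addrA; congr (F _ + F _ + F _); exact: val_inj.
Qed.

Let std := @standard_cuspidal_edge R.

Lemma std_coord x : [/\ std x 0 0 = x 0 0, std x 0 1 = x 0 1 ^+ 2 & std x 0 2%:R = x 0 1 ^+ 3].
Proof. by split; rewrite mxE. Qed.

Lemma smooth_std x : smooth_at std x.
Proof.
apply: smooth_row; apply: ord3.
- by apply: smooth_ext (smooth_proj x 0); apply: near_all => y; have [] := std_coord y.
- by apply: smooth_ext (smoothX 2 (smooth_proj x 1)); apply: near_all => y; have [] := std_coord y.
- by apply: smooth_ext (smoothX 3 (smooth_proj x 1)); apply: near_all => y; have [] := std_coord y.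
Qed.

Lemma derive_std x w : [/\ 'D_w std x 0 0 = w 0 0, 'D_w std x 0 1 = 2 * x 0 1 * w 0 1 &
  'D_w std x 0 2%:R = 3 * x 0 1 ^+ 2 * w 0 1].
Proof.
have d := smooth_diff (smooth_std x).
split; rewrite derive_coord //.
- rewrite (_ : (fun y => std y 0 0) = fun y => y 0 0); last by apply/funext => y; have [] := std_coord y.
  by rewrite (@derive_val _ _ _ _ _ _ _ (is_derive_proj x w 0)).
- rewrite (_ : (fun y => std y 0 1) = fun y => y 0 1 ^+ 2); last by apply/funext => y; have [] := std_coord y.
  by rewrite (@derive_val _ _ _ _ _ _ _ (isD_exp 1 (is_derive_proj x w 1))) expr1.
- rewrite (_ : (fun y => std y 0 2%:R) = fun y => y 0 1 ^+ 3); last by apply/funext => y; have [] := std_coord y.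
  by rewrite (@derive_val _ _ _ _ _ _ _ (isD_exp 2 (is_derive_proj x w 1))).
Qed.

Lemma derive_std_axis x : on_axis x -> 'D_ev std x = 0.
Proof.
rewrite /on_axis => x1; have [E0 E1 E2] := derive_std x ev.
apply/rowP; apply: ord3; rewrite [RHS]mxE.
- by rewrite E0 ev0.
- by rewrite E1 x1 mulr0 mul0r.
- by rewrite E2 x1 expr0n mulr0 mul0r.
Qed.

Lemma derive_lin2 V W (h : V -> W) x (a b : R) u v : differentiable h x ->
  'D_(a *: u + b *: v) h x = a *: 'D_u h x + b *: 'D_v h x.
Proof.
move=> dh; rewrite (deriveE u dh) (deriveE v dh) (deriveE _ dh).
by rewrite linearD linearZ [X in _ + X]linearZ.
Qed.

(** The v-derivative of a composite with the standard cuspidal edge has this shape in each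
    coordinate; after one more derivative only the first term survives at 0. *)
Lemma derive_quad (P Q : plane -> R) : derivable P 0 ev -> derivable Q 0 ev ->
  'D_ev (fun x : plane => 2 * (x 0 1 * P x) + 3 * (x 0 1 ^+ 2 * Q x)) 0 = 2 * P 0.
Proof.
move=> dP dQ.
have D1 := isD_mul (is_derive_proj 0 ev 1) (derivableP dP).
have D2 := isD_mul (isD_exp 1 (is_derive_proj 0 ev 1)) (derivableP dQ).
have D := isD_add (isD_mul (isD_cst 0 ev 2) D1) (isD_mul (isD_cst 0 ev 3) D2).
by rewrite (@derive_val _ _ _ _ _ _ _ D) ev1 [(0 : plane) 0 1]mxE; ring.
Qed.

(** The source diffeomorphism from the definition already works. With A inverse to [Psi], the map
    [f \o phi] is A after the standard edge, and dA is injective, so singular set and null direction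
    are the standard ones. At 0 the derivatives F_u and F_vv are the first partial derivative of A
    and twice the second one, which gives the linear independence needed for a frame. *)
Lemma cusp_coords (f : plane -> space) : smooth_at f 0 -> f 0 = 0 -> cuspidal_edge f 0 ->
  exists2 phi, edge_coords f phi & forall a b : R,
    a *: 'D_eu (f \o phi) 0 + b *: 'D_ev ('D_ev (f \o phi)) 0 = 0 -> a = 0 /\ b = 0.
Proof.
move=> sf f0 [phi [Psi [dphi dPsi fE]]].
have [p0 sphi _] := dphi; have [P0 sPsi [A [A0 sA APsi PsiA]]] := dPsi.
rewrite f0 in P0 A0 sPsi APsi dPsi.
have std0 : std 0 = 0 by apply/rowP; apply: ord3; rewrite !mxE /= ?expr0n.
have fA : \forall x \near (0 : plane), (f \o phi) x = (A \o std) x.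
  have f_phi0 : (f \o phi) 0 = 0 by rewrite /= p0 f0.
  have sfphi : smooth_at (f \o phi) 0 by apply: smooth_comp_row; rewrite ?p0.
  by apply: filterS2 fE (near_comp sfphi f_phi0 APsi) => x /= E1 E2; rewrite /std -E1 E2.
have dA : diffeo_germ 0 0 A by split=> //; exists Psi; split.
have sstd := smooth_std 0.
have injA := near_comp sstd std0 (diffeo_inj dA).
have DF : \forall x \near (0 : plane), forall w, 'D_w (f \o phi) x = 'D_('D_w std x) A (std x).
  have /near_join := fA; apply: filterS2 (near_comp sstd std0 (smooth_near sA)) => x sAx E w.
  rewrite (near_eq_derive w E) derive_chain //; first exact: smooth_diff (smooth_std x).
  exact: smooth_diff.
exists phi.
- split=> //.
    apply: filterS3 (sing_comp dphi sf) injA DF => x -> inj DFx; split=> [[y y0]|x1].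
      rewrite DFx => /inj/rowP s0; apply/eqP; apply: contraNT y0 => x1.
      have [E0 E1 _] := derive_std x y; apply/eqP/plane_eq; rewrite mxE.
        by rewrite -E0 s0 mxE.
      move/eqP: E1; rewrite s0 mxE eq_sym !mulf_eq0 pnatr_eq0 (negbTE x1) /= => /eqP //.
    exists ev; first by apply/eqP => /rowP/(_ 1); rewrite ev1 mxE => /eqP; rewrite oner_eq0.
    by rewrite DFx derive_std_axis // derive0.
  by apply: filterS DF => x DFx x1; rewrite DFx derive_std_axis // derive0.
have Fu : 'D_eu (f \o phi) 0 = 'D_(delta_mx 0 0) A 0.
  rewrite (nbhs_singleton DF) std0; congr ('D_ _ A 0).
  have [E0 E1 E2] := derive_std 0 eu; apply/rowP; apply: ord3; rewrite ?E0 ?E1 ?E2 !mxE //= ?mulr0 ?mul0r //.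
have Fvv : 'D_ev ('D_ev (f \o phi)) 0 = 2 *: 'D_(delta_mx 0 1) A 0.
  have Fv : \forall x \near (0 : plane), 'D_ev (f \o phi) x =
    (2 * x 0 1) *: 'D_(delta_mx 0 1) A (std x) + (3 * x 0 1 ^+ 2) *: 'D_(delta_mx 0 2%:R) A (std x).
    apply: filterS2 DF (near_comp sstd std0 (smooth_near sA)) => x DFx sAx.
    rewrite DFx derive_basis ?sum_I3; last exact: smooth_diff.
    by have [-> -> ->] := derive_std x ev; rewrite ev0 ev1 !mulr1 scale0r add0r.
  have sF : smooth_at ('D_ev (f \o phi)) 0.
    by apply: smooth_derive; apply: smooth_comp_row; rewrite ?p0.
  apply/rowP => k; rewrite derive_coord; last exact: smooth_diff.
  pose Y (i : 'I_3) (x : plane) : R := 'D_(delta_mx 0 i) A (std x) 0 k.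
  have dY i : derivable (Y i) 0 ev.
    apply: diff_derivable; apply: smooth_diff.
    by apply: (@smooth_coord _ _ _ ('D_(delta_mx 0 i) A \o std)); apply: smooth_comp_row; rewrite ?std0 //; exact: smooth_derive.
  have {}Fv : \forall x \near (0 : plane), 'D_ev (f \o phi) x 0 k =
      2 * (x 0 1 * Y 1 x) + 3 * (x 0 1 ^+ 2 * Y 2%:R x).
    apply: filterS Fv => x ->; rewrite /Y.
    move: ('D_(delta_mx 0 1) A (std x)) ('D_(delta_mx 0 2%:R) A (std x)) => P Q.
    by rewrite [LHS]mxE [X in X + _]mxE [X in _ + X]mxE !mulrA.
  rewrite (near_eq_derive _ Fv) (derive_quad (dY 1) (dY 2%:R)) [RHS]mxE /Y std0.
  by [].
move=> a b; rewrite Fu Fvv => E.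
have dA0 := smooth_diff sA.
have : 'D_(a *: delta_mx 0 0 + (b * 2) *: delta_mx 0 1) A 0 = 0.
  by apply: etrans E; rewrite (derive_lin2 _ _ _ _ dA0) scalerA.
have := nbhs_singleton injA; rewrite std0 => inj /inj/rowP w0.
split; first by have := w0 0; rewrite !mxE /= mulr1 mulr0 addr0.
have := w0 1; rewrite !mxE /= mulr1 mulr0 add0r => /eqP; rewrite mulf_eq0 pnatr_eq0 orbF => /eqP //.
Qed.
End Cusp.

(** * Vector algebra in three-space and orthonormal frames *)

Section Vec.
Context {R : realType}.
Notation space := 'rV[R]_3.
Implicit Types (x y z w : space) (M : 'M[R]_3).

Lemma dot3E x y : dot x y = x 0 0 * y 0 0 + x 0 1 * y 0 1 + x 0 2%:R * y 0 2%:R.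
Proof. by rewrite /dot sum_I3. Qed.

Lemma det3E x y z : det3 x y z =
  x 0 0 * (y 0 1 * z 0 2%:R - y 0 2%:R * z 0 1) - x 0 1 * (y 0 0 * z 0 2%:R - y 0 2%:R * z 0 0)
  + x 0 2%:R * (y 0 0 * z 0 1 - y 0 1 * z 0 0).
Proof.
rewrite /det3 (expand_det_row _ 0) sum_I3 /cofactor.
rewrite !(expand_det_row _ 0) !sum_I2 /cofactor !det_mx11 !mxE.
have l2 : lift (0 : 'I_2) (0 : 'I_1) = 1 by exact: val_inj.
have l3 : lift (1 : 'I_2) (0 : 'I_1) = 0 by exact: val_inj.
have l4 : lift (0 : 'I_3) (0 : 'I_2) = 1 by exact: val_inj.
have l5 : lift (0 : 'I_3) (1 : 'I_2) = 2%:R by exact: val_inj.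
have l6 : lift (1 : 'I_3) (0 : 'I_2) = 0 by exact: val_inj.
have l7 : lift (1 : 'I_3) (1 : 'I_2) = 2%:R by exact: val_inj.
have l8 : lift (2%:R : 'I_3) (0 : 'I_2) = 0 by exact: val_inj.
have l9 : lift (2%:R : 'I_3) (1 : 'I_2) = 1 by exact: val_inj.
rewrite !l2 !l3 !l4 !l5 !l6 !l7 !l8 !l9 /=; ring.
Qed.

Lemma crossE x y : [/\ cross x y 0 0 = x 0 1 * y 0 2%:R - x 0 2%:R * y 0 1,
  cross x y 0 1 = x 0 2%:R * y 0 0 - x 0 0 * y 0 2%:R &
  cross x y 0 2%:R = x 0 0 * y 0 1 - x 0 1 * y 0 0].
Proof. by split; rewrite mxE det3E !mxE /=; ring. Qed.

Lemma dotC n (x y : 'rV[R]_n) : dot x y = dot y x.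
Proof. by apply: eq_bigr => i _; rewrite mulrC. Qed.

Lemma dotDl n (x y z : 'rV[R]_n) : dot (x + y) z = dot x z + dot y z.
Proof. by rewrite -big_split; apply: eq_bigr => i _; rewrite mxE mulrDl. Qed.

Lemma dotZl n a (x y : 'rV[R]_n) : dot (a *: x) y = a * dot x y.
Proof. by rewrite /dot mulr_sumr; apply: eq_bigr => i _; rewrite mxE mulrA. Qed.

Lemma dotDr n (x y z : 'rV[R]_n) : dot z (x + y) = dot z x + dot z y.
Proof. by rewrite !(dotC z) dotDl. Qed.

Lemma dotZr n a (x y : 'rV[R]_n) : dot y (a *: x) = a * dot y x.
Proof. by rewrite !(dotC y) dotZl. Qed.

Lemma dot_ge0 n (x : 'rV[R]_n) : 0 <= dot x x.
Proof. by apply: sumr_ge0 => i _; rewrite -expr2 sqr_ge0. Qed.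

Lemma dot_eq0 n (x : 'rV[R]_n) : (dot x x == 0) = (x == 0).
Proof.
apply/eqP/eqP => [E|->]; last by apply: big1 => i _; rewrite mxE mulr0.
apply/rowP => i; rewrite mxE; apply/eqP; rewrite -sqrf_eq0 expr2.
have /psumr_eq0P : forall j : 'I_n, true -> 0 <= x 0 j * x 0 j by move=> j _; rewrite -expr2 sqr_ge0.
by move=> /(_ E i isT) ->.
Qed.

Lemma enorm_sqr n (x : 'rV[R]_n) : enorm x ^+ 2 = dot x x.
Proof. by rewrite sqr_sqrtr // dot_ge0. Qed.

Lemma enorm_gt0 n (x : 'rV[R]_n) : (0 < enorm x) = (x != 0).
Proof. by rewrite sqrtr_gt0 lt_def dot_ge0 andbT dot_eq0. Qed.

Lemma enormZ n a (x : 'rV[R]_n) : enorm (a *: x) = `|a| * enorm x.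
Proof. by rewrite /enorm dotZl dotZr mulrA -expr2 sqrtrM ?sqr_ge0 // sqrtr_sqr. Qed.

Lemma dot_cross x y z : dot (cross x y) z = det3 x y z.
Proof. have [E0 E1 E2] := crossE x y; rewrite dot3E E0 E1 E2 det3E; ring. Qed.

Lemma dot_cross_cross x y z w : dot (cross x y) (cross z w) = dot x z * dot y w - dot x w * dot y z.
Proof.
have [E0 E1 E2] := crossE x y; have [F0 F1 F2] := crossE z w.
by rewrite !dot3E E0 E1 E2 F0 F1 F2; ring.
Qed.

Lemma dot_mulmx n (x y : 'rV[R]_n) : dot x y = (x *m y^T) 0 0.
Proof. by rewrite mxE; apply: eq_bigr => i _; rewrite mxE. Qed.

Lemma dot_rot n (x y : 'rV[R]_n) (M : 'M[R]_n) : M *m M^T = 1%:M -> dot (x *m M) (y *m M) = dot x y.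
Proof. by move=> MM; rewrite !dot_mulmx trmx_mul mulmxA -(mulmxA x) MM mulmx1. Qed.

Lemma det3_rot x y z M : \det M = 1 -> det3 (x *m M) (y *m M) (z *m M) = det3 x y z.
Proof.
move=> dM; rewrite /det3 -[RHS]mulr1 -dM -det_mulmx; congr (\det _).
apply/row_matrixP => i; rewrite row_mul !rowK; move: i; apply: ord3 => //=.
Qed.

(** Gram-Schmidt on [a] and [b], completed by the cross product, which makes the determinant 1. The
    rows of [M] are the frame, so [x *m M^T] lists the coordinates of [x] in it. *)
Lemma frame_exists (a b : space) : (forall s t : R, s *: a + t *: b = 0 -> s = 0 /\ t = 0) ->
  exists M : 'M[R]_3, [/\ M *m M^T = 1%:M, \det M = 1,
    [/\ 0 < (a *m M^T) 0 0, (a *m M^T) 0 1 = 0 & (a *m M^T) 0 2%:R = 0],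
    0 < (b *m M^T) 0 1 & (b *m M^T) 0 2%:R = 0].
Proof.
move=> ind.
have a0 : a != 0.
  by apply/eqP => a0; have [] := ind 1 0; rewrite ?a0 ?scaler0 ?scale0r ?addr0 // => /eqP; rewrite oner_eq0.
have na : 0 < enorm a by rewrite enorm_gt0.
pose e1 := (enorm a)^-1 *: a.
have e11 : dot e1 e1 = 1.
  by rewrite dotZl dotZr -enorm_sqr; field; exact: lt0r_neq0.
have aE : a = enorm a *: e1 by rewrite scalerA divff ?scale1r // lt0r_neq0.
pose c := b + (- dot b e1) *: e1.
have c0 : c != 0.
  apply/eqP => c0; have [] := ind (- dot b e1 / enorm a) 1.
    by rewrite -scalerA scale1r addrC -/e1.
  by move=> _ /eqP; rewrite oner_eq0.
have nc : 0 < enorm c by rewrite enorm_gt0.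
pose e2 := (enorm c)^-1 *: c.
have e22 : dot e2 e2 = 1.
  by rewrite dotZl dotZr -enorm_sqr; field; exact: lt0r_neq0.
have cE : c = enorm c *: e2 by rewrite scalerA divff ?scale1r // lt0r_neq0.
have e12 : dot e1 e2 = 0 by rewrite dotZr dotDr dotZr e11 (dotC e1); ring.
have bE : b = enorm c *: e2 + dot b e1 *: e1 by rewrite -cE /c scaleNr addrNK.
pose e3 := cross e1 e2.
have e13 : dot e1 e3 = 0 by rewrite dotC dot_cross det3E; ring.
have e23 : dot e2 e3 = 0 by rewrite dotC dot_cross det3E; ring.
have e33 : dot e3 e3 = 1 by rewrite dot_cross_cross e11 e22 e12; ring.
pose M : 'M[R]_3 := \matrix_(i < 3) nth 0 [:: e1; e2; e3] i.
have MT (x : space) k : (x *m M^T) 0 k = dot x (nth 0 [:: e1; e2; e3] k).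
  by rewrite mxE; apply: eq_bigr => i _; rewrite !mxE.
exists M; split.
- apply/row_matrixP => i; rewrite row_mul rowK rowE mulmx1; apply/rowP => j.
  rewrite MT mxE; move: i j; apply: ord3; apply: ord3; rewrite /= ?e11 ?e22 ?e33 ?e12 ?e13 ?e23 //.
  + by rewrite dotC e12.
  + by rewrite dotC e13.
  + by rewrite dotC e23.
- by rewrite -/(det3 e1 e2 e3) -dot_cross.
- have da z : dot a z = enorm a * dot e1 z by rewrite {1}aE dotZl.
  by rewrite !MT /= !da e11 e12 e13 mulr1 !mulr0.
- have db : dot b e2 = enorm c * dot e2 e2 + dot b e1 * dot e1 e2 by rewrite {1}bE dotDl !dotZl.
  by rewrite MT /= db e22 e12 mulr0 mulr1 addr0.
- have db : dot b e3 = enorm c * dot e2 e3 + dot b e1 * dot e1 e3 by rewrite {1}bE dotDl !dotZl.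
  by rewrite MT /= db e13 e23 !mulr0 addr0.
Qed.
End Vec.

(** * Normalization of the jets in a frame *)

Section NormalForm.
Context {R : realType}.
Notation eu := (@e_u R).
Notation ev := (@e_v R).
Notation plane := 'rV[R]_2.
Notation space := 'rV[R]_3.
Implicit Types (f : plane -> space) (phi h : plane -> plane) (M : 'M[R]_3).

Lemma derive_mulmx (V : normedModType R) m n (F : V -> 'rV[R]_m) (M : 'M[R]_(m, n)) x w k :
  differentiable F x -> 'D_w (fun y => (F y *m M) 0 k) x = ('D_w F x *m M) 0 k.
Proof.
move=> dF.
have dj j : is_derive x w (fun y => F y 0 j * M j k) ('D_w F x 0 j * M j k).
  have d : is_derive x w (fun y => F y 0 j) ('D_w F x 0 j).
    rewrite derive_coord //; apply: derivableP; apply: diff_derivable.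
    apply: (@differentiable_comp _ _ _ _ F (fun z : 'rV[R]_m => z 0 j)) => //.
    exact: differentiable_coord.
  apply: is_derive_eq (isD_mul d (isD_cst x w (M j k))) _.
  by rewrite mulr0 add0r mulrC.
rewrite [RHS]mxE (_ : (fun y => _) = \sum_j (fun y => F y 0 j * M j k)).
  by rewrite derive_sum => [|j]; [apply: eq_bigr => j _; rewrite (@derive_val _ _ _ _ _ _ _ (dj j))|exact: ex_derive].
by apply/funext => y; rewrite mxE fct_sumE.
Qed.

Definition frame_jet f phi M (k : 'I_3) (c : nat -> nat -> R) :=
  van 4 (fun x => (f (phi x) *m M^T) 0 k - cubic c x).

(** Only the coefficient of v^2 is tracked, because the changes that simplify the first coordinate
    alter the other coefficients in ways that do not matter before the last step. *)
Definition tail_jet f phi M k b := exists a c d e, frame_jet f phi M k (axis_jet 0 a b c d e).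

Lemma frame_jet_comp f phi M h k c10 c20 c02 c30 c12 c03 p a b c d e q r s :
  frame_jet f phi M k (axis_jet c10 c20 c02 c30 c12 c03) -> axis_map h ->
  van 4 (fun x => h x 0 0 - cubic (axis_jet p a b c d e) x) /\
  van 3 (fun x => h x 0 1 - (q * x 0 1 + r * (x 0 0 * x 0 1) + s * x 0 1 ^+ 2)) ->
  frame_jet f (phi \o h) M k (axis_jet (c10 * p) (c10 * a + c20 * p ^+ 2)
    (c10 * b + c02 * q ^+ 2) (c10 * c + 2 * c20 * p * a + c30 * p ^+ 3)
    (c10 * d + 2 * c20 * p * b + 2 * c02 * q * r + c12 * p * q ^+ 2)
    (c10 * e + 2 * c02 * q * s + c03 * q ^+ 3)).
Proof.
move=> F [[h0 sh _] _ _] [j1 j2].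
rewrite /frame_jet in F *.
exact: (@jet_comp R (fun x => (f (phi x) *m M^T) 0 k) h _ _ _ _ _ _ _ _ _ _ _ _ _ _ _ F sh h0 j1 j2).
Qed.

Lemma tail_jet_comp f phi M h k b' p a b c d e :
  tail_jet f phi M k b' -> axis_map h ->
  van 4 (fun x => h x 0 0 - cubic (axis_jet p a b c d e) x) /\
  van 3 (fun x => h x 0 1 - (1 * x 0 1 + 0 * (x 0 0 * x 0 1) + 0 * x 0 1 ^+ 2)) ->
  tail_jet f (phi \o h) M k b'.
Proof.
move=> [c20 [c30 [c12 [c03 F]]]] ah jh.
have := frame_jet_comp F ah jh; rewrite !mul0r !add0r expr1n mulr1 => G.
by do 4![eexists]; exact: G.
Qed.

Definition normal_coords f phi M (a20 a30 b20 b30 b12 b03 : R) :=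
  [/\ edge_coords f phi, M *m M^T = 1%:M, \det M = 1 &
    [/\ frame_jet f phi M 0 (axis_jet 1 0 0 0 0 0),
        frame_jet f phi M 1 (axis_jet 0 (a20 / 2) (1 / 2) (a30 / 6) 0 0) &
        frame_jet f phi M 2%:R (axis_jet 0 (b20 / 2) 0 (b30 / 6) (b12 / 2) (b03 / 6))]].

Lemma frame_jet_eq f phi M k p a b c d e p' a' b' c' d' e' :
  frame_jet f phi M k (axis_jet p a b c d e) ->
  p = p' -> a = a' -> b = b' -> c = c' -> d = d' -> e = e' ->
  frame_jet f phi M k (axis_jet p' a' b' c' d' e').
Proof. by move=> F <- <- <- <- <- <-. Qed.

(** Intermediate stage: the second and third coordinates keep their v^2 coefficients [B] and 0 while
    the first coordinate is reduced to u. *)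
Definition pre_normal f phi M p a b c d e B := [/\ edge_coords f phi,
  frame_jet f phi M 0 (axis_jet p a b c d e), tail_jet f phi M 1 B & tail_jet f phi M 2%:R 0].

Lemma pre_normal_comp f phi M h p a b c d e B p' a' b' c' d' e' :
  smooth_at f 0 -> pre_normal f phi M p a b c d e B -> axis_map h ->
  van 4 (fun x => h x 0 0 - cubic (axis_jet p' a' b' c' d' e') x) /\
  van 3 (fun x => h x 0 1 - (1 * x 0 1 + 0 * (x 0 0 * x 0 1) + 0 * x 0 1 ^+ 2)) ->
  pre_normal f (phi \o h) M (p * p') (p * a' + a * p' ^+ 2) (p * b' + b)
    (p * c' + 2 * a * p' * a' + c * p' ^+ 3) (p * d' + 2 * a * p' * b' + d * p') (p * e' + e) B.
Proof.
move=> sf [ec F0 F1 F2] ah jh; split.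
- exact: edge_coords_comp.
- by apply: frame_jet_eq (frame_jet_comp F0 ah jh) _ _ _ _ _ _; ring.
- exact: tail_jet_comp F1 ah jh.
- exact: tail_jet_comp F2 ah jh.
Qed.

(** The frame is built from F_u and F_vv at 0. Hence only the first coordinate has a linear term,
    and the third one has no v^2 term. *)
Lemma pre_normal_exist f : smooth_at f 0 -> f 0 = 0 -> cuspidal_edge f 0 ->
  exists phi M p a b c d e B, [/\ M *m M^T = 1%:M, \det M = 1, 0 < p, 0 < B &
    pre_normal f phi M p a b c d e B].
Proof.
move=> sf f0 cf; have [phi ec ind] := cusp_coords sf f0 cf.
have [M [MM dM [a0 a1 a2] b1 b2]] := frame_exists ind.
have [[p0 sphi _] _ axv] := ec.
have sF : smooth_at (f \o phi) 0 by apply: smooth_comp_row; rewrite ?p0.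
have jets (k : 'I_3) : exists a c d e, frame_jet f phi M k
    (axis_jet (('D_eu (f \o phi) 0 *m M^T) 0 k) a (('D_ev ('D_ev (f \o phi)) 0 *m M^T) 0 k / 2) c d e).
  pose G y := (f (phi y) *m M^T) 0 k.
  have sG : smooth_at G 0 by apply: smooth_coord; exact: (smooth_mulmx M^T sF).
  have DG w : \forall x \near (0 : plane), 'D_w G x = ('D_w (f \o phi) x *m M^T) 0 k.
    by apply: filterS (smooth_near sF) => x /smooth_diff dF; rewrite -derive_mulmx.
  have G0 : G 0 = 0 by rewrite /G p0 f0 mul0mx mxE.
  have vG : \forall x \near (0 : plane), on_axis x -> 'D_ev G x = 0.
    by apply: filterS2 (DG ev) axv => x -> E /E ->; rewrite mul0mx mxE.
  have [p [a [b [c [d [e J]]]]]] := taylor_axis sG G0 vG.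
  exists a, c, d, e; apply: frame_jet_eq (J) _ erefl _ erefl erefl erefl.
    have := jet_coef (i := 1) (j := 0) sG J isT; rewrite !factS !fact0 /= mul1r => <-.
    exact: (nbhs_singleton (DG eu)).
  have := jet_coef (i := 0) (j := 2) sG J isT; rewrite !factS !fact0 /= => E.
  have -> : b = 'D_ev ('D_ev G) 0 / 2 by rewrite E; field.
  congr (_ / 2); rewrite (near_eq_derive _ (DG ev)).
  exact: (derive_mulmx M^T ev k (smooth_diff (smooth_derive ev sF))).
have [a [c [d [e F0]]]] := jets 0; have F1 := jets 1; have F2 := jets 2%:R.
rewrite a1 in F1; rewrite a2 b2 mul0r in F2.
exists phi, M; do 7![eexists]; split; [exact: MM|exact: dM|exact: a0|exact: (divr_gt0 b1 (ltr0n _ 2))|].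
by split; [exact: ec|exact: F0|exact: F1|exact: F2].
Qed.

Lemma normal_coords_exist f : smooth_at f 0 -> f 0 = 0 -> cuspidal_edge f 0 ->
  exists phi M a20 a30 b20 b30 b12 b03, normal_coords f phi M a20 a30 b20 b30 b12 b03.
Proof.
move=> sf f0 cf.
have [phi [M [p [a [b [c [d [e [B [MM dM p0 B0 P]]]]]]]]]] := pre_normal_exist sf f0 cf.
have {p0} p0 : p != 0 by exact: lt0r_neq0.
(* The parameters are read off the jet of [mob_u]: q = 1/p normalizes the linear term, q s = - a /
   p^3 cancels the u^2 term, and the middle parameter cancels u v^2. *)
have P1 := pre_normal_comp sf P (mob_u_axis (- d / p ^+ 2) (- a / p ^+ 2) (invr_neq0 p0))
  (mob_u_jet p^-1 (- d / p ^+ 2) (- a / p ^+ 2)).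
have {P1} [psi [b' [c' [e' P1]]]] : exists psi b' c' e', pre_normal f psi M 1 0 b' c' 0 e' B.
  case: P1 => ec F0 F1 F2; do 4![eexists]; split; [exact: ec| |exact: F1|exact: F2].
  by apply: frame_jet_eq F0 _ _ erefl erefl _ erefl; field.
(* Since the linear coefficient is 1 and the u^2 term is gone, adding k u^3 / 2 changes only the u^3
   coefficient of the first coordinate; k = -2 c' cancels it. *)
have P2 := pre_normal_comp sf P1 (sqrt_u_axis (- (2 * c'))) (sqrt_u_jet (- (2 * c'))).
have {P1 P2} [psi2 P2] : exists psi, pre_normal f psi M 1 0 b' 0 0 e' B.
  case: P2 => ec F0 F1 F2; eexists; split; [exact: ec| |exact: F1|exact: F2].
  by apply: frame_jet_eq F0 _ _ _ _ _ _; field.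
have P3 := pre_normal_comp sf P2 (shear_u_axis b' e') (shear_u_jet b' e').
have {P2 P3} [psi3 [ec F0 [a1 [c1 [d1 [e1 F1]]]] [a2 [c2 [d2 [e2 F2]]]]]] :
    exists psi, pre_normal f psi M 1 0 0 0 0 0 B.
  case: P3 => ec F0 F1 F2; eexists; split; [exact: ec| |exact: F1|exact: F2].
  by apply: frame_jet_eq F0 _ _ _ _ _ _; ring.
(* The first coordinate is now u, which [mob_v] leaves alone. The scaling [q] turns the v^2
   coefficient of the second coordinate into 1/2, and [r], [s] solve 2 B q r + d1 q^2 = 0 and 2 B
   q^2 s + e1 q^3 = 0. They do not affect the jet of the third coordinate, which has no v^2 term. *)
pose q := (Num.sqrt (2 * B))^-1.
have B2 : 0 < 2 * B by rewrite mulr_gt0.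
have q0 : q != 0 by rewrite invr_neq0 // sqrtr_eq0 -ltNge.
have q2 : B * q ^+ 2 = 1 / 2 by rewrite exprVn sqr_sqrtr ?ltW //; field; exact: lt0r_neq0.
have {B2} BN0 : B != 0 by exact: lt0r_neq0.
pose r := - d1 * q / (2 * B); pose s := - e1 * q / (2 * B).
have ah := @mob_v_axis _ q r s q0; have jh := mob_v_jet q r s.
exists (psi3 \o mob_v q r s), M, (2 * a1), (6 * c1), (2 * a2), (6 * c2), (2 * (d2 * q ^+ 2)), (6 * (e2 * q ^+ 3)).
split; [exact: edge_coords_comp sf ec ah|exact: MM|exact: dM|split].
- by apply: frame_jet_eq (frame_jet_comp F0 ah jh) _ _ _ _ _ _; ring.
- apply: frame_jet_eq (frame_jet_comp F1 ah jh) _ _ _ _ _ _.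
  + by ring.
  + by field.
  + by rewrite mul0r add0r q2.
  + by field.
  + by rewrite /r; field.
  + by rewrite /s; field.
- by apply: frame_jet_eq (frame_jet_comp F2 ah jh) _ _ _ _ _ _; field.
Qed.

(** Reversal of u is undone in the first coordinate by the rotation diag(s, 1, s), a half-turn about
    the second axis when s = -1; reversing the third coordinate as well keeps the determinant 1.
    Reversal of v is felt only by the v^3 term, as v otherwise enters through its square. *)
Lemma normal_coords_flip f phi M s t a20 a30 b20 b30 b12 b03 : smooth_at f 0 ->
  s ^+ 2 = 1 -> t ^+ 2 = 1 -> normal_coords f phi M a20 a30 b20 b30 b12 b03 ->
  exists N, normal_coords f (phi \o flip s t) N a20 (s * a30) (s * b20) b30 b12 (s * t * b03).
Proof.
move=> sf s2 t2 [ec MM dM [F0 F1 F2]].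
pose D : 'M[R]_3 := diag_mx (\row_j nth 0 [:: s; 1; s] j).
have DD : D *m D^T = 1%:M.
  rewrite tr_diag_mx mulmx_diag -diag_const_mx; congr diag_mx.
  by apply/rowP; apply: ord3; rewrite !mxE /= -?expr2 ?s2 ?expr1n.
have DM (x : space) k : (x *m (D *m M)^T) 0 k = nth 0 [:: s; 1; s] k * (x *m M^T) 0 k.
  by rewrite trmx_mul tr_diag_mx mulmxA mul_mx_diag mxE mulrC mxE.
have ah := @flip_axis R s t s2 t2; have jh := flip_jet s t.
have jet k c c' : frame_jet f (phi \o flip s t) M k c ->
    (forall x, nth 0 [:: s; 1; s] k * cubic c x = cubic c' x) -> frame_jet f (phi \o flip s t) (D *m M) k c'.
  move=> F E; apply: van_eq (vanZ (nth 0 [:: s; 1; s] k) F) => x.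
  by rewrite mulrBr E DM.
exists (D *m M); split.
- exact: edge_coords_comp.
- by rewrite trmx_mul mulmxA -(mulmxA D) MM mulmx1.
- rewrite det_mulmx dM det_diag !big_ord_recl big_ord0 !mxE /= !mulr1 mul1r -expr2 s2 //.
- have s3 : s ^+ 3 = s by rewrite exprS s2 mulr1.
  have t3 : t ^+ 3 = t by rewrite exprS t2 mulr1.
  split.
  + apply: jet (frame_jet_comp F0 ah jh) _ => x; rewrite !axis_jetE /=.
    by transitivity (s ^+ 2 * x 0 0); [ring|rewrite s2; ring].
  + by apply: jet (frame_jet_comp F1 ah jh) _ => x; rewrite !axis_jetE s2 t2 s3 t3 /=; field.
  + apply: jet (frame_jet_comp F2 ah jh) _ => x; rewrite !axis_jetE s2 t2 s3 t3 /=.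
    transitivity (s * b20 / 2 * x 0 0 ^+ 2 + s ^+ 2 * (b30 / 6) * x 0 0 ^+ 3
      + s ^+ 2 * (b12 / 2) * (x 0 0 * x 0 1 ^+ 2) + s * t * (b03 / 6) * x 0 1 ^+ 3).
      by ring.
    by rewrite s2; field.
Qed.
End NormalForm.

(** * Equal normal forms give congruent germs *)

Section Congruence.
Context {R : realType}.
Notation plane := 'rV[R]_2.
Notation space := 'rV[R]_3.
Implicit Types (f g : plane -> space) (phi : plane -> plane) (M N : 'M[R]_3).

Lemma iter_derive_row (V : normedModType R) m (h : V -> 'rV[R]_m) vs x k : smooth_at h x ->
  \forall y \near x, iter_derive vs h y 0 k = iter_derive vs (fun z => h z 0 k) y.
Proof.
move=> sh; elim: vs => [|v vs IH]; first exact: nearW.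
have /near_join := IH.
apply: filterS2 (smooth_near (smooth_iter vs sh)) => y /smooth_diff d E /=.
by rewrite derive_coord //; apply: near_eq_derive.
Qed.

(** The frame coordinates of [f \o phi] and [g \o chi] agree modulo order 4. Composition with the
    inverse [psi] of [phi] preserves this order, and returning from the frame by [M] leaves [f]
    minus the image of [g \o (chi \o psi)] under the orthogonal matrix [T]. *)
Lemma normal_coords_congruent f g phi chi M N a20 a30 b20 b30 b12 b03 :
  f 0 = 0 -> g 0 = 0 -> smooth_at f 0 -> smooth_at g 0 ->
  normal_coords f phi M a20 a30 b20 b30 b12 b03 ->
  normal_coords g chi N a20 a30 b20 b30 b12 b03 -> congruent_mod_O4 f g.
Proof.
move=> f0 g0 sf sg [[[p0 sphi [psi [q0 spsi phiK psiK]]] _ _] MM _ [F0 F1 F2]].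
move=> [[dchi _ _] NN _ [G0 G1 G2]].
have dpsi : diffeo_germ 0 0 psi by split=> //; exists phi; split.
have [c0 schi _] := dchi.
pose K j x := (f (phi x) *m M^T) 0 j - (g (chi x) *m N^T) 0 j.
have vK j : van 4 (K j).
  have [c [Fj Gj]] : exists c, frame_jet f phi M j c /\ frame_jet g chi N j c.
    by move: j; apply: ord3; eexists; split; [exact: F0|exact: G0|exact: F1|exact: G1|exact: F2|exact: G2].
  by apply: van_eq (vanB Fj Gj) => x; rewrite /K; ring.
have MM' : M^T *m M = 1%:M by exact: mulmx1C.
have NN' : N^T *m N = 1%:M by exact: mulmx1C.
pose T := N^T *m M.
have TT : T *m T^T = 1%:M.
  by rewrite /T trmx_mul trmxK mulmxA -(mulmxA N^T) MM mulmx1.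
have sT : smooth_at (fun y : space => y *m T) 0 by apply: smooth_mulmx; exact: smooth_id.
have sgp : smooth_at (g \o (chi \o psi)) 0.
  have schipsi : smooth_at (chi \o psi) 0 by apply: smooth_comp_row; rewrite ?q0.
  by apply: smooth_comp_row => //; rewrite /= q0 c0.
exists (chi \o psi), (fun y => y *m T); split; first exact: diffeo_comp dpsi dchi.
  split=> //; first exact: mul0mx.
  exists setT; first exact: filterT.
  by move=> x y _ _; rewrite -mulmxBl /enorm dot_rot.
set h := (X in O4 X).
have sh : smooth_at h 0.
  apply: smoothD sf _.
  apply: smooth_row => k; apply: (@smooth_ext _ _ _ (fun p => - ((g (chi (psi p)) *m T) 0 k))).
    by apply: near_all => y; rewrite [RHS]mxE.
  apply: smoothN; apply: smooth_coord.
  exact: (@smooth_mulmx _ _ _ _ _ T _ sgp).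
have vh k : van 4 (fun p => h p 0 k).
  have v1 i : van 1 (fun p => psi p 0 i).
    apply/vanS; split=> [||w]; [exact: smooth_coord|by rewrite q0 mxE|].
    by apply/van0/smooth_derive/smooth_coord.
  have := van_sum (fun j => vanZ (M j k) (van_comp q0 v1 (vK j))).
  apply: van_ext; apply: filterS psiK => p pE.
  rewrite /h -{2}pE /K /=; set A := f _; set B := g _.
  have -> : A - B *m T = (A *m M^T - B *m N^T) *m M.
    by rewrite mulmxBl -!mulmxA MM' mulmx1.
  by rewrite [RHS]mxE; apply: eq_bigr => j _; rewrite mulrC !mxE.
split=> // i j ij; apply/rowP => k; rewrite [RHS]mxE.
rewrite (nbhs_singleton (iter_derive_row _ k sh)).
by apply: (van_iter (vh k)); rewrite size_cat !size_nseq ltnS.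
Qed.
End Congruence.

(** * Invariants in normal coordinates *)

#[local] Opaque derive e_u e_v.

Ltac smooth_rec := lazymatch goal with
  | H : smooth_at ?f ?x |- smooth_at ?f ?x => exact H
  | H : smooth_at ?f ?x |- smooth_at (fun y => ?f y) ?x => exact H
  | |- smooth_at (fun _ => ?c) _ => exact: smooth_cst
  | |- smooth_at (fun y => fun_of_matrix y _ _) _ => exact: smooth_proj
  | |- smooth_at (fun y => derive _ y _) _ => apply: smooth_derive; smooth_rec
  | |- smooth_at (fun y => _ + _) _ => apply: smoothD; smooth_rec
  | |- smooth_at (fun y => - _) _ => apply: smoothN; smooth_rec
  | |- smooth_at (fun y => _ * _) _ => apply: smoothM; smooth_rec
  | |- smooth_at (fun y => _ ^+ _) _ => apply: smoothX; smooth_rec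
  end.

(** * Iterated derivatives along fields that are adapted to the axis *)

Section AxisFields.
Context {R : realType}.
Notation eu := (@e_u R).
Notation ev := (@e_v R).
Notation plane := 'rV[R]_2.
Notation space := 'rV[R]_3.
Implicit Types (h g k : plane -> R) (xi eta zeta : plane -> plane).

Lemma near_axis0 (P : plane -> Prop) : (\forall x \near (0 : plane), on_axis x -> P x) -> P 0.
Proof. by move=> /nbhs_singleton; apply; rewrite /on_axis mxE. Qed.

Lemma deriveD_smooth (V : normedModType R) (f g : V -> R) w x : smooth_at f x -> smooth_at g x ->
  'D_w (fun y => f y + g y) x = 'D_w f x + 'D_w g x.
Proof. by move=> /smooth_diff df /smooth_diff dg; rewrite deriveD //; exact: diff_derivable. Qed.

Lemma deriveM_smooth (V : normedModType R) (f g : V -> R) w x : smooth_at f x -> smooth_at g x ->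
  'D_w (fun y => f y * g y) x = f x * 'D_w g x + g x * 'D_w f x.
Proof. by move=> sf sg; exact: (nbhs_singleton (deriveM_near w sf sg)). Qed.

Lemma derive_comb (V : normedModType R) (a b c d : V -> R) w x :
  smooth_at a x -> smooth_at b x -> smooth_at c x -> smooth_at d x ->
  'D_w (fun y => a y * b y + c y * d y) x =
    a x * 'D_w b x + b x * 'D_w a x + (c x * 'D_w d x + d x * 'D_w c x).
Proof. by move=> *; rewrite deriveD_smooth ?deriveM_smooth; try smooth_rec. Qed.

Lemma axis_eq g k : smooth_at g 0 -> smooth_at k 0 -> (\forall x \near (0 : plane), on_axis x -> g x = k x) ->
  \forall x \near (0 : plane), on_axis x -> 'D_eu g x = 'D_eu k x.
Proof.
move=> sg sk gk.
have d : (\forall x \near (0 : plane), on_axis x -> g x - k x = 0) by apply: filterS gk => x E /E ->; rewrite subrr.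
apply: filterS3 (axis_derive d) (smooth_near sg) (smooth_near sk) => x E sgx skx /E.
rewrite deriveB; [|exact/diff_derivable/smooth_diff|exact/diff_derivable/smooth_diff].
by move/eqP; rewrite subr_eq0 => /eqP.
Qed.

Lemma vf_near zeta h : smooth_at h 0 ->
  \forall x \near (0 : plane), vf_derive zeta h x = zeta x 0 0 * 'D_eu h x + zeta x 0 1 * 'D_ev h x.
Proof. by move=> sh; apply: filterS (smooth_near sh) => x /smooth_diff d; rewrite /vf_derive derive2. Qed.

(** On the axis [xi] points along it, so there the derivative sees only the restriction of [h],
    which may be replaced by any [k] with the same restriction. Iterated derivatives thus become
    computable although [xi] is unconstrained off the axis. *)
Lemma vf_tangent xi h k : smooth_at xi 0 -> (\forall x \near (0 : plane), on_axis x -> xi x 0 1 = 0) ->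
  smooth_at h 0 -> smooth_at k 0 -> (\forall x \near (0 : plane), on_axis x -> h x = k x) ->
  \forall x \near (0 : plane), on_axis x -> vf_derive xi h x = xi x 0 0 * 'D_eu k x.
Proof.
move=> sxi xi1 sh sk hk.
apply: filterS3 xi1 (vf_near xi sh) (axis_eq sh sk hk) => x e1 -> e3 x1.
by rewrite e1 // e3 // mul0r addr0.
Qed.

Section Scalar.
Variables (xi eta : plane -> plane) (h : plane -> R).
Hypotheses (sxi : smooth_at xi 0) (seta : smooth_at eta 0) (sh : smooth_at h 0).
Hypothesis xi1 : \forall x \near (0 : plane), on_axis x -> xi x 0 1 = 0.
Hypothesis eta0 : \forall x \near (0 : plane), on_axis x -> eta x 0 0 = 0.
Hypothesis hv : \forall x \near (0 : plane), on_axis x -> 'D_ev h x = 0.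

Let rho x := xi x 0 0.
Let alpha x := eta x 0 0.
Let beta x := eta x 0 1.

Let srho : smooth_at rho 0. Proof. exact: smooth_coord. Qed.
Let salpha : smooth_at alpha 0. Proof. exact: smooth_coord. Qed.
Let sbeta : smooth_at beta 0. Proof. exact: smooth_coord. Qed.

Lemma vf_xi : \forall x \near (0 : plane), on_axis x -> vf_derive xi h x = rho x * 'D_eu h x.
Proof. by apply: vf_tangent => //; exact: near_all. Qed.

Let h2 x := rho x * 'D_eu ('D_eu h) x + 'D_eu h x * 'D_eu rho x.

Lemma vf_xi2 : \forall x \near (0 : plane), on_axis x -> vf_derive xi (vf_derive xi h) x = rho x * h2 x.
Proof.
have s1 : smooth_at (fun x => rho x * 'D_eu h x) 0 by smooth_rec.
have t := vf_tangent sxi xi1 (smooth_vf sxi sh) s1 vf_xi.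
by apply: filterS3 t (smooth_near srho) (smooth_near sh) => x E sr sx /E ->; rewrite deriveM_smooth //; try smooth_rec.
Qed.

Lemma vf_xi3 : vf_derive xi (vf_derive xi (vf_derive xi h)) 0 =
  rho 0 * (rho 0 * (rho 0 * 'D_eu ('D_eu ('D_eu h)) 0 + 'D_eu ('D_eu h) 0 * 'D_eu rho 0
    + ('D_eu h 0 * 'D_eu ('D_eu rho) 0 + 'D_eu rho 0 * 'D_eu ('D_eu h) 0)) + h2 0 * 'D_eu rho 0).
Proof.
have s1 : smooth_at (fun x => rho x * h2 x) 0 by rewrite /h2; try smooth_rec.
have t := vf_tangent sxi xi1 (smooth_vf sxi (smooth_vf sxi sh)) s1 vf_xi2.
rewrite (near_axis0 t) deriveM_smooth; [|smooth_rec|rewrite /h2; smooth_rec].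
by rewrite /h2 deriveD_smooth ?deriveM_smooth; try smooth_rec.
Qed.

Let H := vf_derive eta h.
Let sH : smooth_at H 0. Proof. exact: smooth_vf. Qed.

Let HE : \forall x \near (0 : plane), H x = alpha x * 'D_eu h x + beta x * 'D_ev h x.
Proof. exact: vf_near. Qed.

Let H0 : \forall x \near (0 : plane), on_axis x -> H x = 0.
Proof. by apply: filterS3 HE eta0 hv => x -> e1 e2 x1; rewrite /alpha e1 // e2 // mul0r mulr0 addr0. Qed.

Let HvE : \forall x \near (0 : plane), 'D_ev H x =
  alpha x * 'D_ev ('D_eu h) x + 'D_eu h x * 'D_ev alpha x +
  (beta x * 'D_ev ('D_ev h) x + 'D_ev h x * 'D_ev beta x).
Proof.
have /near_join := HE.
apply: filterS3 (smooth_near sh) (filterI (smooth_near salpha) (smooth_near sbeta)) => x sx [sa sb] E.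
rewrite (near_eq_derive _ E).
exact: (derive_comb ev sa (smooth_derive eu sx) sb (smooth_derive ev sx)).
Qed.

Let huv : \forall x \near (0 : plane), on_axis x -> 'D_ev ('D_eu h) x = 0.
Proof. by apply: filterS2 (axis_derive hv) (smooth_near sh) => x E sx /E; rewrite (schwarz _ _ sx). Qed.

Let Hv : \forall x \near (0 : plane), on_axis x -> 'D_ev H x = 'D_eu h x * 'D_ev alpha x + beta x * 'D_ev ('D_ev h) x.
Proof.
apply: filterS3 HvE eta0 (filterI hv huv) => x -> e0 [e1 e2] x1.
by rewrite /alpha e0 // e1 // e2 // !mul0r addr0 add0r.
Qed.

(** The v-derivative of [H] on the axis. The term with the v-derivative of [alpha] is present
    because [eta] is vertical only on the axis itself. *)
Let h11 x := 'D_eu h x * 'D_ev alpha x + beta x * 'D_ev ('D_ev h) x.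

Lemma vf_eta2 : \forall x \near (0 : plane), on_axis x -> vf_derive eta H x = beta x * h11 x.
Proof.
by apply: filterS3 (vf_near eta sH) eta0 Hv => x -> e0 e1 x1; rewrite e0 // e1 // mul0r add0r.
Qed.

Lemma vf_xi_eta2 : vf_derive xi (vf_derive eta H) 0 =
  rho 0 * (beta 0 * ('D_eu h 0 * 'D_eu ('D_ev alpha) 0 + 'D_ev alpha 0 * 'D_eu ('D_eu h) 0
    + (beta 0 * 'D_eu ('D_ev ('D_ev h)) 0 + 'D_ev ('D_ev h) 0 * 'D_eu beta 0)) + h11 0 * 'D_eu beta 0).
Proof.
have s1 : smooth_at (fun x => beta x * h11 x) 0 by rewrite /h11; try smooth_rec.
have t := vf_tangent sxi xi1 (smooth_vf seta sH) s1 vf_eta2.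
rewrite (near_axis0 t) deriveM_smooth; [|smooth_rec|rewrite /h11; smooth_rec].
by rewrite /h11 deriveD_smooth ?deriveM_smooth; try smooth_rec.
Qed.

(** This needs a v-derivative of [vf_derive eta H], so identities on the axis are not enough: the
    formulas for that function and for the v-derivative of [H] are differentiated on a full
    neighbourhood, and the quantities vanishing on the axis are set to 0 only afterwards. *)
Lemma vf_eta3 : vf_derive eta (vf_derive eta H) 0 =
  beta 0 * (h11 0 * 'D_ev beta 0 + beta 0 * ('D_eu h 0 * 'D_ev ('D_ev alpha) 0
    + 2 * 'D_ev ('D_ev h) 0 * 'D_ev beta 0 + beta 0 * 'D_ev ('D_ev ('D_ev h)) 0)).
Proof.
have sG : smooth_at (vf_derive eta H) 0 by exact: smooth_vf.
have a0 : alpha 0 = 0 := near_axis0 eta0.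
have hv0 := near_axis0 hv; have huv0 := near_axis0 huv.
have Hu0 := near_axis0 (axis_derive H0); have Hv0 := near_axis0 Hv.
have GE : \forall x \near (0 : plane), vf_derive eta H x = alpha x * 'D_eu H x + beta x * 'D_ev H x.
  exact: vf_near.
rewrite (nbhs_singleton (vf_near eta sG)) -/(alpha 0) -/(beta 0) a0 mul0r add0r; congr (_ * _).
rewrite -/(h11 0) in Hv0 *; clearbody H alpha beta rho.
move: (h11 0) Hv0 => K Hv0.
apply: etrans (near_eq_derive ev GE) _.
rewrite (derive_comb ev salpha (smooth_derive eu sH) sbeta (smooth_derive ev sH)).
rewrite a0 Hu0 Hv0 !mul0r !add0r.
have HvvE := near_eq_derive ev HvE.
have sD1 w : smooth_at ('D_w h) 0 := smooth_derive w sh.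
have sD2 w w' : smooth_at ('D_w' ('D_w h)) 0 := smooth_derive w' (sD1 w).
have sDa := smooth_derive ev salpha; have sDb := smooth_derive ev sbeta.
have sP : smooth_at (fun x => alpha x * 'D_ev ('D_eu h) x + 'D_eu h x * 'D_ev alpha x) 0 by smooth_rec.
have sQ : smooth_at (fun x => beta x * 'D_ev ('D_ev h) x + 'D_ev h x * 'D_ev beta x) 0 by smooth_rec.
rewrite (deriveD_smooth ev sP sQ) (derive_comb ev salpha (sD2 eu ev) (sD1 eu) sDa) in HvvE.
rewrite (derive_comb ev sbeta (sD2 ev ev) (sD1 ev) sDb) in HvvE.
rewrite a0 hv0 huv0 in HvvE.
have alg (L db hvv hu avv av b hvvv p q r : R) :
    r = 0 * p + 0 * av + (hu * avv + av * 0) + (b * hvvv + hvv * db + (0 * q + db * hvv)) ->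
    b * r + L * db = L * db + b * (hu * avv + 2 * hvv * db + b * hvvv) by move=> ->; ring.
exact: alg HvvE.
Qed.
End Scalar.
End AxisFields.

(** * The invariants as functions of vectors, and their rotation invariance *)

Section VectorInvariants.
Context {R : realType}.
Notation eu := (@e_u R).
Notation ev := (@e_v R).
Notation plane := 'rV[R]_2.
Notation space := 'rV[R]_3.

Lemma enorm_rot n (x : 'rV[R]_n) (M : 'M[R]_n) : M *m M^T = 1%:M -> enorm (x *m M) = enorm x.
Proof. by move=> MM; rewrite /enorm dot_rot. Qed.

Lemma enorm_cross_rot (x y : space) (M : 'M[R]_3) : M *m M^T = 1%:M ->
  enorm (cross (x *m M) (y *m M)) = enorm (cross x y).
Proof. by move=> MM; rewrite /enorm !dot_cross_cross !dot_rot. Qed.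

(** As in the next definitions, the vectors at one point are the arguments, so that rotation
    invariance and evaluation become linear algebra; [s] stands for the derivative of [lambda] along
    [eta]. *)
Definition ks (s : R) (x xx n : space) : R := Num.sg s * (det3 x xx n / enorm x ^+ 3).

Lemma kappa_sE (f : plane -> space) xi eta nu p :
  kappa_s f xi eta nu p = ks (vf_derive eta (lambda f nu) p) (vf_derive xi f p)
    (vf_derive xi (vf_derive xi f) p) (nu p).
Proof. by rewrite /kappa_s /ks. Qed.

Definition kn (x e xx : space) : R := `|det3 x e xx| / (enorm x ^+ 2 * enorm (cross x e)).

Definition kc (x e eee : space) : R :=
  enorm x `^ (3 / 2) * det3 x e eee / enorm (cross x e) `^ (5 / 2).

Definition kt (x e xe xx : space) : R :=
  det3 x e xe / enorm (cross x e) ^+ 2 -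
  det3 x e xx * dot x e / (enorm x ^+ 2 * enorm (cross x e) ^+ 2).

Definition ki (x e xx xxx : space) : R :=
  det3 x e xxx / (enorm x ^+ 3 * enorm (cross x e)) -
  3 * (dot x xx * det3 x e xx / (enorm x ^+ 5 * enorm (cross x e))).

Lemma kappa_cE (f : plane -> space) xi eta p :
  kappa_c f xi eta p = kc (vf_derive xi f p) (vf_derive eta (vf_derive eta f) p)
    (vf_derive eta (vf_derive eta (vf_derive eta f)) p).
Proof. by rewrite /kappa_c /kc. Qed.

Lemma kappa_nE (f : plane -> space) xi eta p :
  kappa_n f xi eta p = kn (vf_derive xi f p) (vf_derive eta (vf_derive eta f) p)
    (vf_derive xi (vf_derive xi f) p).
Proof. by rewrite /kappa_n /kn. Qed.

Lemma kappa_tE (f : plane -> space) xi eta p :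
  kappa_t f xi eta p = kt (vf_derive xi f p) (vf_derive eta (vf_derive eta f) p)
    (vf_derive xi (vf_derive eta (vf_derive eta f)) p) (vf_derive xi (vf_derive xi f) p).
Proof. by rewrite /kappa_t /kt. Qed.

Lemma kappa_iE (f : plane -> space) xi eta p :
  kappa_i f xi eta p = ki (vf_derive xi f p) (vf_derive eta (vf_derive eta f) p)
    (vf_derive xi (vf_derive xi f) p) (vf_derive xi (vf_derive xi (vf_derive xi f)) p).
Proof. by rewrite /kappa_i /ki. Qed.

Section Rotation.
Variable (N : 'M[R]_3).
Hypotheses (NN : N *m N^T = 1%:M) (dN : \det N = 1).

Lemma kn_rot x e xx : kn (x *m N) (e *m N) (xx *m N) = kn x e xx.
Proof. by rewrite /kn det3_rot // enorm_rot // enorm_cross_rot. Qed.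

Lemma kn_pull x e xx x' e' xx' : x' = x *m N -> e' = e *m N -> xx' = xx *m N ->
  kn x e xx = kn x' e' xx'.
Proof. by move=> -> -> ->; rewrite kn_rot. Qed.

Lemma kc_rot x e eee : kc (x *m N) (e *m N) (eee *m N) = kc x e eee.
Proof. by rewrite /kc (det3_rot _ _ _ dN) (enorm_rot _ NN) (enorm_cross_rot _ _ NN). Qed.

Lemma kc_pull x e eee x' e' eee' : x' = x *m N -> e' = e *m N -> eee' = eee *m N ->
  kc x e eee = kc x' e' eee'.
Proof. by move=> -> -> ->; rewrite kc_rot. Qed.

Lemma kt_rot x e xe xx : kt (x *m N) (e *m N) (xe *m N) (xx *m N) = kt x e xe xx.
Proof. by rewrite /kt !det3_rot // enorm_rot // enorm_cross_rot // dot_rot. Qed.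

Lemma kt_pull x e xe xx x' e' xe' xx' : x' = x *m N -> e' = e *m N -> xe' = xe *m N -> xx' = xx *m N ->
  kt x e xe xx = kt x' e' xe' xx'.
Proof. by move=> -> -> -> ->; rewrite kt_rot. Qed.

Lemma ki_rot x e xx xxx : ki (x *m N) (e *m N) (xx *m N) (xxx *m N) = ki x e xx xxx.
Proof. by rewrite /ki !det3_rot // enorm_rot // enorm_cross_rot // dot_rot. Qed.

Lemma ki_pull x e xx xxx x' e' xx' xxx' : x' = x *m N -> e' = e *m N -> xx' = xx *m N -> xxx' = xxx *m N ->
  ki x e xx xxx = ki x' e' xx' xxx'.
Proof. by move=> -> -> -> ->; rewrite ki_rot. Qed.

Lemma ks_pull s s' x xx n x' xx' n' : Num.sg s = Num.sg s' ->
  x' = x *m N -> xx' = xx *m N -> n' = n *m N -> ks s x xx n = ks s' x' xx' n'.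
Proof.
by move=> ss -> -> ->; rewrite /ks (det3_rot _ _ _ dN) (enorm_rot _ NN) ss.
Qed.
End Rotation.
End VectorInvariants.

(** * Evaluation at a point *)

Section Values.
Context {R : realType}.
Notation space := 'rV[R]_3.
Implicit Types (x e a b c n xx xxx xe eee : space).

Lemma enorm_eq x r : 0 <= r -> dot x x = r ^+ 2 -> enorm x = r.
Proof. by move=> r0 E; rewrite /enorm E sqrtr_sqr ger0_norm. Qed.

(** Multiplicativity of the determinant: the right-hand side is the determinant of the matrix of
    mutual dot products. It serves to eliminate the unknown unit normal. *)
Lemma gram x y z a b c : det3 x y z * det3 a b c =
  dot x a * (dot y b * dot z c - dot y c * dot z b)
  - dot x b * (dot y a * dot z c - dot y c * dot z a)
  + dot x c * (dot y a * dot z b - dot y b * dot z a).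
Proof. rewrite !det3E !dot3E; ring. Qed.

Section AtPoint.
Variables (x e : space) (rho beta : R).
Hypotheses (pos : 0 < rho * beta) (x0 : x 0 0 = rho) (x1 : x 0 1 = 0) (x2 : x 0 2%:R = 0).
Hypotheses (e1 : e 0 1 = beta ^+ 2) (e2 : e 0 2%:R = 0).

Let rN0 : rho != 0. Proof. by apply: contraTneq pos => ->; rewrite mul0r ltxx. Qed.
Let bN0 : beta != 0. Proof. by apply: contraTneq pos => ->; rewrite mulr0 ltxx. Qed.

Let nx : enorm x = `|rho|.
Proof. by apply: enorm_eq => //; rewrite dot3E x0 x1 x2 real_normK ?num_real //; ring. Qed.

Let nxe : enorm (cross x e) = `|rho| * beta ^+ 2.
Proof.
apply: enorm_eq; first by rewrite mulr_ge0 // sqr_ge0.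
by rewrite dot_cross_cross !dot3E x0 x1 x2 e1 e2 exprMn real_normK ?num_real //; ring.
Qed.

(** [x] lies on the first axis and [e] in the plane of the first two, so each determinant of the
    invariants reduces to a third coordinate. *)
Let d z : det3 x e z = rho * beta ^+ 2 * z 0 2%:R.
Proof. rewrite det3E x0 x1 x2 e1 e2; ring. Qed.

Lemma kn_val xx k : xx 0 2%:R = rho ^+ 2 * k -> kn x e xx = `|k|.
Proof.
move=> E; rewrite /kn nx nxe d E.
have -> : `|rho * beta ^+ 2 * (rho ^+ 2 * k)| = `|rho| ^+ 3 * `|beta| ^+ 2 * `|k|.
  by rewrite -!normrX -!normrM; congr `|_|; ring.
have : `|rho| != 0 by rewrite normr_eq0.
have : `|beta| != 0 by rewrite normr_eq0.
rewrite -(real_normK (num_real beta)).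
move: `|rho| `|beta| `|k| => r b l b0 r0; field; by rewrite r0 b0.
Qed.

(** This is where the orientation of the adapted pair enters: since [rho * beta] is positive, rho
    beta^5 equals the product of the absolute values, and the sign of [k] is recovered. *)
Lemma kc_val eee k : eee 0 2%:R = beta ^+ 3 * k -> kc x e eee = k.
Proof.
move=> E; rewrite /kc nx nxe d E.
have r0 : 0 < `|rho| by rewrite normr_gt0.
have b0 : 0 < `|beta| by rewrite normr_gt0.
rewrite -(real_normK (num_real beta)).
have -> : rho * `|beta| ^+ 2 * (beta ^+ 3 * k) = `|rho| * `|beta| ^+ 5 * k.
  have -> : `|rho| * `|beta| ^+ 5 = `|rho * beta| * `|beta| ^+ 4 by rewrite normrM; ring.
  rewrite (gtr0_norm pos).
  have -> : `|beta| ^+ 4 = (`|beta| ^+ 2) ^+ 2 by rewrite -exprM.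
  rewrite real_normK ?num_real //; ring.
rewrite powRM ?exprn_ge0 //.
have -> : (`|beta| ^+ 2) `^ (5 / 2) = `|beta| ^+ 5 :> R.
  have -> : 5 / 2 = 2^-1 * 5%:R :> R by rewrite mulrC.
  by rewrite powRrM powR12_sqrt ?sqr_ge0 // sqrtr_sqr normr_id powR_mulrn.
have R5 : `|rho| `^ (5 / 2) = `|rho| `^ (3 / 2) * `|rho| :> R.
  rewrite -{3}[`|rho|]powRr1 //.
  by rewrite -powRD ?gt_eqF ?implybT //; congr (_ `^ _); field.
rewrite R5.
have : `|rho| `^ (3 / 2) != 0 by rewrite gt_eqF // powR_gt0.
move/lt0r_neq0: r0; move/lt0r_neq0: b0.
move: (`|rho| `^ (3 / 2)) `|rho| `|beta| => p r b b0 r0 p0; field; by rewrite b0 r0 p0.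
Qed.

(** The part [e 0 0 * k], caused by the tangential component of [e], is cancelled by the second term
    of [kt]. *)
Lemma kt_val xe xx k l : xx 0 2%:R = rho ^+ 2 * k ->
  xe 0 2%:R = rho * (e 0 0 * k + beta ^+ 2 * l) -> kt x e xe xx = l.
Proof.
move=> Exx Exe; rewrite /kt nx nxe !d Exx Exe dot3E x0 x1 x2.
have -> : (`|rho| * beta ^+ 2) ^+ 2 = rho ^+ 2 * beta ^+ 4 by rewrite exprMn real_normK ?num_real //; ring.
rewrite real_normK ?num_real //; move: (e 0 0) => w.
by field; rewrite rN0 bN0.
Qed.

(** The part 3 rho^2 s k, caused by the varying length of the tangent field, is cancelled by the
    second term of [ki]. *)
Lemma ki_val xx xxx s k l : xx 0 0 = rho * s -> xx 0 2%:R = rho ^+ 2 * k ->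
  xxx 0 2%:R = rho ^+ 3 * l + 3 * rho ^+ 2 * s * k -> ki x e xx xxx = l.
Proof.
move=> E0 E2 E3; rewrite /ki nx nxe !d E2 E3 dot3E x0 x1 x2 E0.
by case: (ger0P rho) => _; field; rewrite rN0 bN0.
Qed.
End AtPoint.

(** [gram] expresses det(a, c, n)^2 and det(a, c, n) det(a, b, n) by dot products of [a], [b], [c]
    alone. The sign factor supplies the sign of det(a, c, n), and [beta] has the sign of [rho]; so
    neither the choice of [n] nor that of the fields is visible in the result. *)
Lemma ks_val a b c n (rho beta m : R) : 0 < rho * beta -> enorm n = 1 -> dot a n = 0 -> dot c n = 0 ->
  0 < dot a a * dot c c - dot a c ^+ 2 ->
  ks (beta * det3 a c n) (rho *: a) ((rho * rho) *: b + m *: a) n =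
  (dot a a * dot b c - dot a c * dot b a) /
    (enorm a ^+ 3 * Num.sqrt (dot a a * dot c c - dot a c ^+ 2)).
Proof.
move=> pos n1 an cn W0.
have nn : dot n n = 1 by rewrite -enorm_sqr n1 expr1n.
have rN0 : rho != 0 by apply: contraTneq pos => ->; rewrite mul0r ltxx.
have W : det3 a c n ^+ 2 = dot a a * dot c c - dot a c ^+ 2.
  by rewrite expr2 gram an cn nn (dotC c a) (dotC n a) (dotC n c) an cn; ring.
have ND : det3 a c n * det3 a b n = dot a a * dot b c - dot a c * dot b a.
  by rewrite gram an cn nn (dotC c b) (dotC c a) (dotC a b); ring.
have a0 : enorm a != 0.
  by apply: contraTneq W0 => /eqP; rewrite -sqrf_eq0 enorm_sqr dot_eq0 => /eqP ->;
    rewrite !dot3E !mxE !mul0r !addr0 mul0r expr0n subrr ltxx.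
rewrite -W sqrtr_sqr -ND /ks enormZ.
have -> : det3 (rho *: a) ((rho * rho) *: b + m *: a) n = rho ^+ 3 * det3 a b n.
  rewrite !det3E !mxE; ring.
have D0 : det3 a c n != 0 by rewrite -sqrf_eq0 W gt_eqF.
rewrite sgrM.
have -> : Num.sg beta = Num.sg rho.
  have : Num.sg (rho * beta) = 1 by rewrite gtr0_sg.
  rewrite sgrM; case: (sgrP rho) => [//|_|_]; rewrite ?mul0r ?mul1r ?mulN1r.
  - by move=> _ /eqP; rewrite eq_sym oner_eq0.
  - by [].
  - by move=> /eqP; rewrite eqr_oppLR => /eqP.
move: (det3 a c n) (det3 a b n) (enorm a) D0 a0 => D d r D0 r0.
have S3 (z : R) : z != 0 -> `|z| = Num.sg z * z /\ (Num.sg z) ^+ 2 = 1.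
  by move=> z0; rewrite -normrEsg sqr_sg z0.
have [-> s2] := S3 _ rN0; have [-> t2] := S3 _ D0.
have s0 : Num.sg rho != 0 by rewrite sgr_eq0.
have t0 : Num.sg D != 0 by rewrite sgr_eq0.
move: (Num.sg rho) (Num.sg D) s2 t2 s0 t0 => s t s2 t2 s0 t0.
transitivity (t * (s ^+ 2)^-1 * (d / r ^+ 3)); first by field; rewrite rN0 r0 s0.
rewrite s2; transitivity (t ^+ 2 * (d / r ^+ 3) / t); first by field; rewrite t0 r0.
rewrite t2; by field; rewrite D0 t0 r0.
Qed.
End Values.

#[local] Opaque ks kn kc kt ki.

(** * Naturality under changes of coordinates *)

Section Pull.
Context {R : realType}.
Notation eu := (@e_u R).
Notation ev := (@e_v R).
Notation plane := 'rV[R]_2.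
Notation space := 'rV[R]_3.

Lemma derive_mulmx_row (V : normedModType R) m n (F : V -> 'rV[R]_m) (M : 'M[R]_(m, n)) x w :
  smooth_at F x -> 'D_w (fun y => F y *m M) x = 'D_w F x *m M.
Proof.
move=> sF; apply/rowP => k; rewrite derive_coord; last exact/smooth_diff/smooth_mulmx.
by rewrite derive_mulmx //; exact: smooth_diff.
Qed.

Lemma det2E (A : 'M[R]_2) : \det A = A 0 0 * A 1 1 - A 0 1 * A 1 0.
Proof.
rewrite (expand_det_row _ 0) sum_I2 /cofactor !det_mx11 !mxE /=.
have l1 : lift (0 : 'I_2) (0 : 'I_1) = 1 by exact: val_inj.
have l2 : lift (1 : 'I_2) (0 : 'I_1) = 0 by exact: val_inj.
rewrite !l1 !l2; ring.
Qed.

Lemma det_col2 (x y : plane) : \det (col_mx x y) = x 0 0 * y 0 1 - x 0 1 * y 0 0.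
Proof.
rewrite det2E.
have e0 : (0 : 'I_2) = lshift 1 (0 : 'I_1) by exact: val_inj.
have e1 : (1 : 'I_2) = rshift 1 (0 : 'I_1) by exact: val_inj.
have c0 j : col_mx x y 0 j = x 0 j by rewrite {1}e0 col_mxEu.
have c1 j : col_mx x y 1 j = y 0 j by rewrite {1}e1 col_mxEd.
by rewrite !c0 !c1.
Qed.

Variables (phi psi : plane -> plane).
Hypotheses (p0 : phi 0 = 0) (sphi : smooth_at phi 0) (q0 : psi 0 = 0) (spsi : smooth_at psi 0).
Hypotheses (phiK : \forall x \near (0 : plane), psi (phi x) = x).
Hypotheses (psiK : \forall x \near (0 : plane), phi (psi x) = x).

(** The pullback of a vector field by [phi], written with the derivative of the inverse [psi];
    [pullK] is its characteristic property. *)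
Definition pull (zeta : plane -> plane) (x : plane) := vf_derive zeta psi (phi x).

Lemma smooth_pull zeta : smooth_at zeta 0 -> smooth_at (pull zeta) 0.
Proof.
by move=> sz; apply: (@smooth_comp_row _ _ _ _ phi (vf_derive zeta psi)) => //; rewrite p0; exact: smooth_vf_row.
Qed.

Lemma pullK zeta : \forall x \near (0 : plane), 'D_(pull zeta x) phi x = zeta (phi x).
Proof.
have := near_comp sphi p0 (diffeo_derive_inv q0 spsi sphi psiK).
by apply: filterS2 phiK => x e1 e2; have := e2 (zeta (phi x)); rewrite e1.
Qed.

(** Hypothesis and conclusion are identities of germs of the same form, so the lemma can be iterated
    for higher derivatives. *)
Lemma vf_pull zeta m n (h : plane -> 'rV[R]_m) (H : plane -> 'rV[R]_n) (N : 'M[R]_(m, n)) :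
  smooth_at h 0 -> (\forall x \near (0 : plane), H x = h (phi x) *m N) ->
  \forall x \near (0 : plane), vf_derive (pull zeta) H x = vf_derive zeta h (phi x) *m N.
Proof.
move=> sh /near_join HE.
apply: filterS3 HE (pullK zeta) (filterI (smooth_near sphi) (near_comp sphi p0 (smooth_near sh))).
move=> x E K [sx shx]; rewrite /vf_derive (near_eq_derive _ E).
have shp : smooth_at (h \o phi) x by exact: smooth_comp_row.
rewrite (derive_mulmx_row N _ shp) derive_chain; [|exact: smooth_diff|exact: smooth_diff].
by rewrite K.
Qed.

Lemma vf_pull_scalar zeta (h H : plane -> R) :
  smooth_at h 0 -> (\forall x \near (0 : plane), H x = h (phi x)) ->
  \forall x \near (0 : plane), vf_derive (pull zeta) H x = vf_derive zeta h (phi x).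
Proof.
move=> sh /near_join HE.
apply: filterS3 HE (pullK zeta) (filterI (smooth_near sphi) (near_comp sphi p0 (smooth_near sh))).
move=> x E K [sx shx]; rewrite /vf_derive (near_eq_derive _ E).
by rewrite (derive_chain (pull zeta x) (smooth_diff sx) (smooth_diff shx)) K.
Qed.

Variables (f : plane -> space) (xi eta : plane -> plane) (N : 'M[R]_3).
Hypotheses (sf : smooth_at f 0) (sxi : smooth_at xi 0) (seta : smooth_at eta 0).
Hypotheses (NN : N *m N^T = 1%:M) (dN : \det N = 1).

Let F x := f (phi x) *m N.

Let FE : \forall x \near (0 : plane), F x = f (phi x) *m N. Proof. exact: near_all. Qed.

Lemma kappas_pull : \forall x \near (0 : plane),
  [/\ kappa_n f xi eta (phi x) = kappa_n F (pull xi) (pull eta) x,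
      kappa_c f xi eta (phi x) = kappa_c F (pull xi) (pull eta) x,
      kappa_t f xi eta (phi x) = kappa_t F (pull xi) (pull eta) x &
      kappa_i f xi eta (phi x) = kappa_i F (pull xi) (pull eta) x].
Proof.
have sx := smooth_vf_row sxi sf; have sxx := smooth_vf_row sxi sx.
have se := smooth_vf_row seta sf; have see := smooth_vf_row seta se.
have X := vf_pull xi sf FE; have XX := vf_pull xi sx X; have XXX := vf_pull xi sxx XX.
have E := vf_pull eta sf FE; have EE := vf_pull eta se E.
have EEE := vf_pull eta see EE; have XEE := vf_pull xi see EE.
apply: filterS3 (filterI X (filterI XX XXX)) (filterI EE EEE) XEE.
move=> x [x1 [x2 x3]] [e2 e3] xe.
rewrite !kappa_nE !kappa_cE !kappa_tE !kappa_iE; split.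
- by apply: (kn_pull NN dN); [exact: x1|exact: e2|exact: x2].
- by apply: (kc_pull NN dN); [exact: x1|exact: e2|exact: e3].
- by apply: (kt_pull NN dN); [exact: x1|exact: e2|exact: xe|exact: x2].
- by apply: (ki_pull NN dN); [exact: x1|exact: e2|exact: x2|exact: x3].
Qed.
End Pull.

(** * Derivatives of dot products, determinants and normalized quotients *)

Section VectorCalculus.
Context {R : realType}.
Notation space := 'rV[R]_3.
Implicit Types (V : normedModType R).

Lemma isD_dot V (X Y : V -> space) (x y : space) p w : (forall i, is_derive p w (fun z => X z 0 i) (x 0 i)) ->
  (forall i, is_derive p w (fun z => Y z 0 i) (y 0 i)) ->
  is_derive p w (fun z => dot (X z) (Y z)) (dot x (Y p) + dot (X p) y).
Proof.
move=> dX dY.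
rewrite (_ : (fun z => _) = (fun z => X z 0 0 * Y z 0 0 + X z 0 1 * Y z 0 1 + X z 0 2%:R * Y z 0 2%:R)).
  have d i := isD_mul (dX i) (dY i).
  apply: is_derive_eq (isD_add (isD_add (d 0) (d 1)) (d 2%:R)) _.
  rewrite !dot3E; ring.
by apply/funext => z; rewrite dot3E.
Qed.

Lemma isD_det3 V (X Y Z : V -> space) (x y z : space) p w : (forall i, is_derive p w (fun z => X z 0 i) (x 0 i)) ->
  (forall i, is_derive p w (fun z => Y z 0 i) (y 0 i)) ->
  (forall i, is_derive p w (fun q => Z q 0 i) (z 0 i)) ->
  is_derive p w (fun q => det3 (X q) (Y q) (Z q)) (det3 x (Y p) (Z p) + det3 (X p) y (Z p) + det3 (X p) (Y p) z).
Proof.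
move=> dX dY dZ.
have isN (f : V -> R) a : is_derive p w f a -> is_derive p w (fun y => - f y) (- a) by exact: is_deriveN.
rewrite (_ : (fun z => _) = (fun q => X q 0 0 * (Y q 0 1 * Z q 0 2%:R + - (Y q 0 2%:R * Z q 0 1))
  + - (X q 0 1 * (Y q 0 0 * Z q 0 2%:R + - (Y q 0 2%:R * Z q 0 0)))
  + X q 0 2%:R * (Y q 0 0 * Z q 0 1 + - (Y q 0 1 * Z q 0 0)))).
  have m i j := isD_add (isD_mul (dY i) (dZ j)) (isN _ _ (isD_mul (dY j) (dZ i))).
  have d i j k := isD_mul (dX i) (m j k).
  apply: is_derive_eq (isD_add (isD_add (d 0 1 2%:R) (isN _ _ (d 1 0 2%:R))) (d 2%:R 0 1)) _.
  rewrite !det3E; ring.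
by apply/funext => q; rewrite det3E.
Qed.

Lemma smooth_isD V (X : V -> space) p w i : smooth_at X p ->
  is_derive p w (fun z => X z 0 i) ('D_w X p 0 i).
Proof.
move=> sX; rewrite derive_coord; last exact: smooth_diff.
by apply: derivableP; apply: diff_derivable; apply: smooth_diff; exact: smooth_coord.
Qed.

Lemma derive_dot V (X Y : V -> space) p w : smooth_at X p -> smooth_at Y p ->
  'D_w (fun z => dot (X z) (Y z)) p = dot ('D_w X p) (Y p) + dot (X p) ('D_w Y p).
Proof. by move=> sX sY; apply: derive_val; apply: isD_dot => i; exact: smooth_isD. Qed.

Lemma derive_det3 V (X Y Z : V -> space) p w : smooth_at X p -> smooth_at Y p -> smooth_at Z p ->
  'D_w (fun q => det3 (X q) (Y q) (Z q)) p =
  det3 ('D_w X p) (Y p) (Z p) + det3 (X p) ('D_w Y p) (Z p) + det3 (X p) (Y p) ('D_w Z p).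
Proof. by move=> sX sY sZ; apply: derive_val; apply: isD_det3 => i; exact: smooth_isD. Qed.

Lemma smooth_dot V (X Y : V -> space) p : smooth_at X p -> smooth_at Y p ->
  smooth_at (fun z => dot (X z) (Y z)) p.
Proof.
move=> sX sY; apply: (@smooth_ext _ _ _ (fun z => X z 0 0 * Y z 0 0 + X z 0 1 * Y z 0 1 + X z 0 2%:R * Y z 0 2%:R)).
  by apply: near_all => z; rewrite dot3E.
by apply: smoothD; [apply: smoothD|]; apply: smoothM; apply: smooth_coord.
Qed.

Lemma smooth_det3 V (X Y Z : V -> space) p : smooth_at X p -> smooth_at Y p -> smooth_at Z p ->
  smooth_at (fun q => det3 (X q) (Y q) (Z q)) p.
Proof.
move=> sX sY sZ.
have c (G : V -> space) i : smooth_at G p -> smooth_at (fun z => G z 0 i) p by exact: smooth_coord.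
apply: (@smooth_ext _ _ _ (fun q => X q 0 0 * (Y q 0 1 * Z q 0 2%:R - Y q 0 2%:R * Z q 0 1)
  - X q 0 1 * (Y q 0 0 * Z q 0 2%:R - Y q 0 2%:R * Z q 0 0)
  + X q 0 2%:R * (Y q 0 0 * Z q 0 1 - Y q 0 1 * Z q 0 0))).
  by apply: near_all => q; rewrite det3E.
by apply: smoothD; [apply: smoothB|]; apply: smoothM (c _ _ _) _ => //; apply: smoothB; apply: smoothM; apply: c.
Qed.

Lemma derive_sqrt V (P : V -> R) p w : smooth_at P p -> P p = 1 -> 'D_w P p = 0 ->
  'D_w (fun z => Num.sqrt (P z)) p = 0.
Proof.
move=> sP P1 dP.
have pos : 0 < P p by rewrite P1.
have ss := smooth_sqrt pos sP.
have E : \forall z \near p, Num.sqrt (P z) * Num.sqrt (P z) = P z.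
  by apply: filterS (near_gt0 sP pos) => z z0; rewrite -expr2 sqr_sqrtr // ltW.
have := near_eq_derive w E; rewrite dP (deriveM_smooth w ss ss) P1 sqrtr1 !mul1r.
by move=> /eqP; rewrite -mulr2n mulrn_eq0 /= => /eqP.
Qed.

(** The denominator D equals 1 at [p] and is stationary there in direction [w], so value and
    derivative are those of the numerator. Differentiating K D = N avoids differentiating the
    quotient. *)
Lemma derive_quotient V (N P W : V -> R) n p w : smooth_at N p -> smooth_at P p -> smooth_at W p ->
  P p = 1 -> W p = 1 -> 'D_w P p = 0 -> 'D_w W p = 0 ->
  let K := fun z => N z / (Num.sqrt (P z) ^+ n * Num.sqrt (W z)) in
  [/\ smooth_at K p, K p = N p & 'D_w K p = 'D_w N p].
Proof.
move=> sN sP sW P1 W1 dP dW K.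
have P0 : 0 < P p by rewrite P1.
have W0 : 0 < W p by rewrite W1.
pose s z := Num.sqrt (P z); pose t z := Num.sqrt (W z); pose D z := s z ^+ n * t z.
have s_s : smooth_at s p := smooth_sqrt P0 sP.
have s_t : smooth_at t p := smooth_sqrt W0 sW.
have sD : smooth_at D p by apply: smoothM => //; exact: smoothX.
have s1 : s p = 1 by rewrite /s P1 sqrtr1.
have t1 : t p = 1 by rewrite /t W1 sqrtr1.
have D1 : D p = 1 by rewrite /D s1 t1 expr1n mulr1.
have dX k : 'D_w (fun z => s z ^+ k) p = 0.
  elim: k => [|k IH].
    have E0 : \forall z \near p, s z ^+ 0 = 1 by exact: near_all.
    by rewrite (near_eq_derive w E0) derive_cst.
  have ES : \forall z \near p, s z ^+ k.+1 = s z * s z ^+ k by apply: near_all => z; rewrite exprS.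
  by rewrite (near_eq_derive w ES) (deriveM_smooth w s_s (smoothX k s_s)) IH derive_sqrt // !mulr0 addr0.
have dD : 'D_w D p = 0.
  by rewrite (deriveM_smooth w (smoothX n s_s) s_t) dX derive_sqrt // !mulr0 addr0.
have DN : D p != 0 by rewrite D1 oner_neq0.
have sK : smooth_at K p by apply: smooth_div.
have Kp : K p = N p by rewrite /K -/(s p) -/(t p) -/(D p) D1 divr1.
split=> //.
have E : \forall z \near p, K z * D z = N z.
  by apply: filterS (near_neq0 sD DN) => z z0; rewrite /K -/(s z) -/(t z) -/(D z) divfK.
by rewrite -(near_eq_derive w E) (deriveM_smooth w sK sD) dD D1 mulr0 add0r mul1r.
Qed.
End VectorCalculus.

(** * Adapted pairs in edge coordinates *)

Section PulledFields.
Context {R : realType}.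
Notation eu := (@e_u R).
Notation ev := (@e_v R).
Notation plane := 'rV[R]_2.
Notation space := 'rV[R]_3.

Definition jac (phi : plane -> plane) x : R :=
  'D_eu phi x 0 0 * 'D_ev phi x 0 1 - 'D_eu phi x 0 1 * 'D_ev phi x 0 0.

Lemma smooth_jac phi x : smooth_at phi x -> smooth_at (jac phi) x.
Proof.
move=> sp; have s w i : smooth_at (fun y => 'D_w phi y 0 i) x.
  by apply: smooth_coord; exact: smooth_derive.
by apply: smoothB; apply: smoothM.
Qed.

Lemma det3_comb (x y z : space) (a b c d : R) :
  det3 (a *: x + b *: y) (c *: x + d *: y) z = (a * d - b * c) * det3 x y z.
Proof. rewrite !det3E !mxE; ring. Qed.

Lemma det_comb (x y : plane) (a b c d : R) :
  \det (col_mx (a *: x + b *: y) (c *: x + d *: y)) = (a * d - b * c) * \det (col_mx x y).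
Proof. rewrite !det_col2 !mxE; ring. Qed.

Variables (phi psi : plane -> plane) (f : plane -> space) (xi eta : plane -> plane)
  (nu : plane -> space) (N : 'M[R]_3).
Hypotheses (p0 : phi 0 = 0) (sphi : smooth_at phi 0) (q0 : psi 0 = 0) (spsi : smooth_at psi 0).
Hypotheses (phiK : \forall x \near (0 : plane), psi (phi x) = x).
Hypotheses (psiK : \forall x \near (0 : plane), phi (psi x) = x).
Hypotheses (NN : N *m N^T = 1%:M) (dN : \det N = 1).
Hypotheses (sf : smooth_at f 0) (ec : edge_coords f phi) (adm : adapted f xi eta).
Hypotheses (J0 : 0 < jac phi 0).

Let F x := f (phi x) *m N.
Hypothesis Fu0 : 'D_eu F 0 0 0 != 0.

Let sF : smooth_at F 0.
Proof.
have s : smooth_at (f \o phi) 0 by apply: smooth_comp_row; rewrite ?p0.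
exact: (smooth_mulmx N s).
Qed.

Let FE : \forall x \near (0 : plane), F x = f (phi x) *m N. Proof. exact: near_all. Qed.

Lemma Fv_axis : \forall x \near (0 : plane), on_axis x -> 'D_ev F x = 0.
Proof.
have [_ _ H] := ec.
have s : smooth_at (f \o phi) 0 by apply: smooth_comp_row; rewrite ?p0.
apply: filterS2 H (smooth_near s) => x E sx /E e.
by rewrite (derive_mulmx_row N ev sx) e mul0mx.
Qed.

Lemma sing_axis : \forall p \near (0 : plane), sing f p <-> on_axis (psi p).
Proof.
have [_ H _] := ec.
by apply: filterS2 psiK (near_comp spsi q0 H) => x ->.
Qed.

(** The curve that realizes the tangent vector runs in the singular set; its image under [psi] runs
    in the axis, so its velocity has no v-component. *)
Lemma pull_xi_axis : \forall x \near (0 : plane), on_axis x -> pull phi psi xi x 0 1 = 0.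
Proof.
have [_ H _] := ec; have [_ _ T _ _] := adm.
have /near_join S := sing_axis.
apply: filterS3 H (near_comp sphi p0 (filterI T S)) (near_comp sphi p0 (smooth_near spsi)).
move=> x Hx [Tx Sx] sx x1; have /Tx [c [sc c0 sc' dc]] := Hx.2 x1.
have sc0 : smooth_at psi (c 0) by rewrite c0.
have ax : \forall t \near (0 : R), (psi \o c) t 0 1 = 0.
  by apply: filterS2 sc' (near_comp sc c0 Sx) => t e1 e2; exact: (e2.1 e1).
rewrite /pull /vf_derive -dc derive1E -c0.
rewrite -(derive_chain _ (smooth_diff sc) (smooth_diff sc0)).
rewrite derive_coord; last by apply: smooth_diff; exact: smooth_comp_row.
by rewrite (near_eq_derive _ ax) derive_cst.
Qed.

(** On the axis F_v = 0, so a null vector has u-component times F_u equal to 0, and the first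
    coordinate of F_u is nonzero near 0. *)
Lemma pull_eta_axis : \forall x \near (0 : plane), on_axis x -> pull phi psi eta x 0 0 = 0.
Proof.
have [_ H _] := ec; have [_ seta _ T _] := adm.
have sFu : smooth_at (fun x => 'D_eu F x 0 0) 0 by apply: smooth_coord; exact: smooth_derive.
have P := vf_pull p0 sphi q0 spsi phiK psiK eta sf FE.
apply: filterS3 (filterI H (near_comp sphi p0 T)) (filterI P (near_neq0 sFu Fu0)) (filterI Fv_axis (smooth_near sF)).
move=> x [Hx Tx] [Px Fux] [Fvx sx] x1.
move: Px; rewrite Tx; last exact: Hx.2.
rewrite mul0mx /vf_derive (derive2 _ (smooth_diff sx)) Fvx // scaler0 addr0 => /rowP/(_ 0).
by rewrite [LHS]mxE [RHS]mxE => /eqP; rewrite mulf_eq0 (negbTE Fux) orbF => /eqP.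
Qed.

(** The determinant of the original pair is that of the pulled pair times the positive Jacobian
    determinant, and on the axis the pulled pair is diagonal. *)
Lemma pull_pos : \forall x \near (0 : plane), on_axis x ->
  0 < pull phi psi xi x 0 0 * pull phi psi eta x 0 1.
Proof.
have [sxi seta _ _ D] := adm.
have Kx := pullK p0 sphi q0 spsi phiK psiK xi; have Ke := pullK p0 sphi q0 spsi phiK psiK eta.
apply: filterS3 (filterI Kx Ke) (filterI (near_comp sphi p0 D) (near_gt0 (smooth_jac sphi) J0))
  (filterI (filterI pull_xi_axis pull_eta_axis) (smooth_near sphi)).
move=> x [kx ke] [Dx Jx] [[x1 e0] sx] ax.
have Ex := esym kx; rewrite (derive2 _ (smooth_diff sx)) in Ex.
have Ee := esym ke; rewrite (derive2 _ (smooth_diff sx)) in Ee.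
move: Dx; rewrite Ex Ee det_comb det_col2.
have alg (r s a b j : R) : 0 < j -> s = 0 -> a = 0 -> 0 < (r * b - s * a) * j -> 0 < r * b.
  by move=> jp -> ->; rewrite mul0r subr0 pmulr_lgt0.
exact: alg Jx (x1 ax) (e0 ax).
Qed.

Hypothesis un : unit_normal f nu.

Definition pull_normal x := nu (phi x) *m N.

Lemma smooth_pull_normal : smooth_at pull_normal 0.
Proof.
have [snu _] := un.
have s : smooth_at (nu \o phi) 0 by apply: smooth_comp_row; rewrite ?p0.
exact: (smooth_mulmx N s).
Qed.

Let DF w : \forall x \near (0 : plane), 'D_w F x = ('D_w phi x 0 0 *: 'D_eu f (phi x) + 'D_w phi x 0 1 *: 'D_ev f (phi x)) *m N.
Proof.
apply: filterS2 (smooth_near sphi) (near_comp sphi p0 (smooth_near sf)) => x sx sfx.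
have s : smooth_at (f \o phi) x by exact: smooth_comp_row.
rewrite (derive_mulmx_row N w s) (derive_chain w (smooth_diff sx) (smooth_diff sfx)).
by rewrite (derive2 _ (smooth_diff sfx)).
Qed.

Let dot_comb0 (a b n : space) (s t : R) : dot a n = 0 -> dot b n = 0 ->
  dot ((s *: a + t *: b) *m N) (n *m N) = 0.
Proof. by move=> an bn; rewrite dot_rot // dotDl !dotZl an bn !mulr0 addr0. Qed.

Lemma pull_normalP : \forall x \near (0 : plane), [/\ enorm (pull_normal x) = 1,
  dot ('D_eu F x) (pull_normal x) = 0 & dot ('D_ev F x) (pull_normal x) = 0].
Proof.
have [_ U] := un.
apply: filterS3 (near_comp sphi p0 U) (DF eu) (DF ev) => x [n1 nu0 nv0] -> ->.
split; [by rewrite enorm_rot|exact: dot_comb0|exact: dot_comb0].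
Qed.

Lemma smooth_lambda (g : plane -> space) n x : smooth_at g x -> smooth_at n x -> smooth_at (lambda g n) x.
Proof. by move=> sg sn; apply: smooth_det3 => //; exact: smooth_derive. Qed.

Lemma lambda_pull : \forall x \near (0 : plane), lambda F pull_normal x = jac phi x * lambda f nu (phi x).
Proof.
apply: filterS2 (DF eu) (DF ev) => x e1 e2.
by rewrite /lambda e1 e2 det3_rot // det3_comb.
Qed.

(** [lambda] acquires the positive factor [jac phi]. Because [lambda] vanishes on the axis, the
    product rule gives its derivative along [eta] the same factor, and the sign in [kappa_s] is
    unchanged. *)
Lemma kappa_s_pull : \forall x \near (0 : plane), on_axis x ->
  kappa_s f xi eta nu (phi x) = kappa_s F (pull phi psi xi) (pull phi psi eta) pull_normal x.
Proof.
have [sxi seta _ _ _] := adm; have [snu _] := un.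
have sx := smooth_vf_row sxi sf.
have X := vf_pull p0 sphi q0 spsi phiK psiK xi sf FE.
have XX := vf_pull p0 sphi q0 spsi phiK psiK xi sx X.
have sl := smooth_lambda sf snu.
have slp : smooth_at (lambda f nu \o phi) 0 by apply: smooth_comp; rewrite ?p0.
have L : \forall x \near (0 : plane), (lambda f nu \o phi) x = lambda f nu (phi x) by exact: near_all.
have E := vf_pull_scalar p0 sphi q0 spsi phiK psiK eta sl L.
have /near_join LP := lambda_pull.
apply: filterS3 (filterI X XX) (filterI E (filterI LP (smooth_near slp)))
  (filterI Fv_axis (filterI (near_gt0 (smooth_jac sphi) J0) (smooth_near sphi))).
move=> x [x1 x2] [Ex [LPx slx]] [Fv0 [Jx sphix]] ax.
have l0 : lambda f nu (phi x) = 0.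
  have := nbhs_singleton LPx; rewrite /lambda Fv0 // => /esym/eqP.
  rewrite [X in _ == X](_ : _ = 0); last by rewrite det3E !mxE; ring.
  by rewrite mulf_eq0 gt_eqF //= => /eqP.
have D : vf_derive (pull phi psi eta) (lambda F pull_normal) x = jac phi x * vf_derive eta (lambda f nu) (phi x).
  rewrite -Ex /vf_derive (near_eq_derive _ LPx).
  have := deriveM_smooth (pull phi psi eta x) (smooth_jac sphix) slx.
  by rewrite /= l0 mul0r addr0.
rewrite !kappa_sE; apply: (ks_pull NN dN); [|exact: x1|exact: x2|by []].
by rewrite D sgrM (gtr0_sg Jx) mul1r.
Qed.
End PulledFields.

(** * Germs in normal form and their invariants at 0 *)

Section Model.
Context {R : realType}.
Notation eu := (@e_u R).
Notation ev := (@e_v R).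
Notation plane := 'rV[R]_2.
Notation space := 'rV[R]_3.

Lemma vf_coord_near zeta (G : plane -> space) g k : smooth_at G 0 ->
  (\forall x \near (0 : plane), G x 0 k = g x) ->
  \forall x \near (0 : plane), vf_derive zeta G x 0 k = vf_derive zeta g x.
Proof.
move=> sG /near_join H; apply: filterS2 H (smooth_near sG) => x E sx.
by rewrite vf_derive_coord; [exact: (near_eq_derive _ E)|exact: smooth_diff].
Qed.

(** [rho] is the u-component of [xi], [beta] the v-component of [eta]; [ru], [ruu], [bu], [bv] are
    derivatives of these, and [av], [auv], [avv] derivatives of the u-component of [eta]. The zeros
    and ones are jet values of the normal form inserted into the formulas for iterated derivatives.
    No derivative of a field survives in the values. *)
Lemma kappas_alg (x xx xxx e eee xe : space) (b20 b30 b12 b03 bu bv av auv avv rho beta ru ruu : R) :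
  0 < rho * beta -> x 0 0 = rho * 1 -> x 0 1 = rho * 0 -> x 0 2%:R = rho * 0 ->
  e 0 0 = beta * (1 * av + beta * 0) -> e 0 1 = beta * (0 * av + beta * 1) ->
  e 0 2%:R = beta * (0 * av + beta * 0) ->
  xx 0 0 = rho * (rho * 0 + 1 * ru) -> xx 0 2%:R = rho * (rho * b20 + 0 * ru) ->
  xxx 0 2%:R = rho * (rho * (rho * b30 + b20 * ru + (0 * ruu + ru * b20)) + (rho * b20 + 0 * ru) * ru) ->
  eee 0 2%:R = beta * ((0 * av + beta * 0) * bv + beta * (0 * avv + 2 * 0 * bv + beta * b03)) ->
  xe 0 2%:R = rho * (beta * (0 * auv + av * b20 + (beta * b12 + 0 * bu)) + (0 * av + beta * 0) * bu) ->
  [/\ kn x e xx = `|b20|, kc x e eee = b03, kt x e xe xx = b12 & ki x e xx xxx = b30].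
Proof.
move=> rb X0 X1 X2 E0 E1 E2 XX0 XX2 XXX2 EEE2 XEE2; split.
- by apply: (kn_val rb); [rewrite X0|rewrite X1|rewrite X2|rewrite E1|rewrite E2|rewrite XX2]; ring.
- by apply: (kc_val rb); [rewrite X0|rewrite X1|rewrite X2|rewrite E1|rewrite E2|rewrite EEE2]; ring.
- have XX2' : xx 0 2%:R = rho ^+ 2 * b20 by rewrite XX2; ring.
  by apply: (kt_val rb _ _ _ _ _ XX2'); [rewrite X0|rewrite X1|rewrite X2|rewrite E1|rewrite E2|rewrite XEE2 E0]; ring.
- have XX0' : xx 0 0 = rho * ru by rewrite XX0; ring.
  have XX2' : xx 0 2%:R = rho ^+ 2 * b20 by rewrite XX2; ring.
  by apply: (ki_val rb _ _ _ _ _ XX0' XX2'); [rewrite X0|rewrite X1|rewrite X2|rewrite E1|rewrite E2|rewrite XXX2]; ring.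
Qed.

(** The normal form after [phi] and the frame have been absorbed into [F], so that what follows
    concerns a single map. *)
Definition model (F : plane -> space) (a20 a30 b20 b30 b12 b03 : R) :=
  [/\ smooth_at F 0, \forall x \near (0 : plane), on_axis x -> 'D_ev F x = 0,
    van 4 (fun x => F x 0 0 - cubic (axis_jet 1 0 0 0 0 0) x),
    van 4 (fun x => F x 0 1 - cubic (axis_jet 0 (a20 / 2) (1 / 2) (a30 / 6) 0 0) x) &
    van 4 (fun x => F x 0 2%:R - cubic (axis_jet 0 (b20 / 2) 0 (b30 / 6) (b12 / 2) (b03 / 6)) x)].

Section Values.
Variables (F : plane -> space) (a20 a30 b20 b30 b12 b03 : R).
Hypothesis mF : model F a20 a30 b20 b30 b12 b03.

Definition jet_values (h : plane -> R) (du duu dvv duuu duvv dvvv : R) :=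
  [/\ 'D_eu h 0 = du, 'D_eu ('D_eu h) 0 = duu, 'D_ev ('D_ev h) 0 = dvv &
  [/\ 'D_eu ('D_eu ('D_eu h)) 0 = duuu, 'D_eu ('D_ev ('D_ev h)) 0 = duvv & 'D_ev ('D_ev ('D_ev h)) 0 = dvvv]].

Lemma axis_jet_values h p a b c d e : smooth_at h 0 ->
  van 4 (fun x => h x - cubic (axis_jet p a b c d e) x) ->
  jet_values h p (2 * a) (2 * b) (6 * c) (2 * d) (6 * e).
Proof.
move=> sh J; split; [| | |split].
- have := jet_coef (i := 1) (j := 0) sh J isT; rewrite !factS !fact0 /= mul1r; exact.
- exact: (jet_coef (i := 2) (j := 0) sh J isT).
- exact: (jet_coef (i := 0) (j := 2) sh J isT).
- exact: (jet_coef (i := 3) (j := 0) sh J isT).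
- exact: (jet_coef (i := 1) (j := 2) sh J isT).
- exact: (jet_coef (i := 0) (j := 3) sh J isT).
Qed.

Let sF : smooth_at F 0. Proof. by have [] := mF. Qed.
Let sk k : smooth_at (fun x => F x 0 k) 0. Proof. exact: smooth_coord. Qed.

Lemma model_jets : [/\ jet_values (fun x => F x 0 0) 1 0 0 0 0 0,
  jet_values (fun x => F x 0 1) 0 a20 1 a30 0 0 &
  jet_values (fun x => F x 0 2%:R) 0 b20 0 b30 b12 b03].
Proof.
have [_ _ J0 J1 J2] := mF.
have m (n : R) y : n != 0 -> n * (y / n) = y by move=> n0; rewrite mulrCA divff ?mulr1.
have n2 : (2 : R) != 0 by rewrite pnatr_eq0.
have n6 : (6 : R) != 0 by rewrite pnatr_eq0.
have eqj h a b c d e f a' b' c' d' e' f' : jet_values h a b c d e f ->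
  [/\ a = a', b = b' & c = c'] -> [/\ d = d', e = e' & f = f'] -> jet_values h a' b' c' d' e' f'.
  by move=> J [<- <- <-] [<- <- <-].
split.
- by apply: eqj (axis_jet_values (sk 0) J0) _ _; split; ring.
- by apply: eqj (axis_jet_values (sk 1) J1) _ _; split; rewrite ?m //; ring.
- by apply: eqj (axis_jet_values (sk 2%:R) J2) _ _; split; rewrite ?m //; ring.
Qed.

Section Fields.
Variables xi eta : plane -> plane.
Hypotheses (sxi : smooth_at xi 0) (seta : smooth_at eta 0).
Hypothesis xi1 : \forall x \near (0 : plane), on_axis x -> xi x 0 1 = 0.
Hypothesis eta0 : \forall x \near (0 : plane), on_axis x -> eta x 0 0 = 0.
Hypothesis pos : 0 < xi 0 0 0 * eta 0 0 1.

Let hv k : \forall x \near (0 : plane), on_axis x -> 'D_ev (fun x => F x 0 k) x = 0.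
Proof.
have [_ H _ _ _] := mF.
by apply: filterS2 H (smooth_near sF) => x E sx /E e; rewrite -derive_coord ?e ?mxE //; exact: smooth_diff.
Qed.

Lemma model_kappas : [/\ kappa_n F xi eta 0 = `|b20|, kappa_c F xi eta 0 = b03,
  kappa_t F xi eta 0 = b12 & kappa_i F xi eta 0 = b30].
Proof.
have [[u0 uu0 vv0 [uuu0 uvv0 vvv0]] [u1 uu1 vv1 [uuu1 uvv1 vvv1]] [u2 uu2 vv2 [uuu2 uvv2 vvv2]]] := model_jets.
have FE k : \forall x \near (0 : plane), F x 0 k = F x 0 k by exact: near_all.
have sx := smooth_vf_row sxi sF; have sxx := smooth_vf_row sxi sx.
have se := smooth_vf_row seta sF; have see := smooth_vf_row seta se.
have X k := vf_coord_near xi sF (FE k); have XX k := vf_coord_near xi sx (X k).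
have XXX k := nbhs_singleton (vf_coord_near xi sxx (XX k)).
have E k := vf_coord_near eta sF (FE k); have EE k := vf_coord_near eta se (E k).
have EEE k := nbhs_singleton (vf_coord_near eta see (EE k)).
have XEE k := nbhs_singleton (vf_coord_near xi see (EE k)).
have {X} X k := etrans (nbhs_singleton (X k)) (near_axis0 (vf_xi sxi (sk k) xi1)).
have {XX} XX k := etrans (nbhs_singleton (XX k)) (near_axis0 (vf_xi2 sxi (sk k) xi1)).
have {XXX} XXX k := etrans (XXX k) (vf_xi3 sxi (sk k) xi1).
have {EE} EE k := etrans (nbhs_singleton (EE k)) (near_axis0 (vf_eta2 seta (sk k) eta0 (hv k))).
have {EEE} EEE k := etrans (EEE k) (vf_eta3 seta (sk k) eta0 (hv k)).
have {XEE} XEE k := etrans (XEE k) (vf_xi_eta2 sxi seta (sk k) xi1 eta0 (hv k)).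
have X0 := X 0; have X1 := X 1; have X2 := X 2%:R.
have E0 := EE 0; have E1 := EE 1; have E2 := EE 2%:R.
have XX0 := XX 0; have XX2 := XX 2%:R; have XXX2 := XXX 2%:R; have EEE2 := EEE 2%:R; have XEE2 := XEE 2%:R.
clear FE X EE XX XXX EEE XEE E.
rewrite u0 in X0; rewrite u1 in X1; rewrite u2 in X2.
rewrite u0 vv0 in E0; rewrite u1 vv1 in E1; rewrite u2 vv2 in E2.
rewrite u0 uu0 in XX0; rewrite u2 uu2 in XX2; rewrite u2 uu2 uuu2 in XXX2.
rewrite u2 vv2 vvv2 in EEE2; rewrite u2 uu2 vv2 uvv2 in XEE2.
rewrite kappa_nE kappa_cE kappa_tE kappa_iE.
exact: (kappas_alg pos X0 X1 X2 E0 E1 E2 XX0 XX2 XXX2 EEE2 XEE2).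
Qed.
End Fields.
End Values.
End Model.

#[local] Opaque dot det3.

(** * Kappa_s and the signed kappa_n as functions along the axis *)

Section AxisFunctions.
Context {R : realType}.
Notation eu := (@e_u R).
Notation ev := (@e_v R).
Notation plane := 'rV[R]_2.
Notation space := 'rV[R]_3.

(** By Lagrange's identity, the squared norm of [cross a c]. *)
Definition axis_W (a c : space) : R := dot a a * dot c c - dot a c ^+ 2.
(** With a = F_u, b = F_uu and c = F_vv, this and [axis_kn] are kappa_s and the kappa_n signed by
    the direction of growing u. Containing neither fields nor unit normal, they can be
    differentiated along u. *)
Definition axis_ks (a b c : space) : R :=
  (dot a a * dot b c - dot a c * dot b a) / (Num.sqrt (dot a a) ^+ 3 * Num.sqrt (axis_W a c)).
Definition axis_kn (a b c : space) : R :=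
  det3 a c b / (Num.sqrt (dot a a) ^+ 2 * Num.sqrt (axis_W a c)).

Lemma torsion_alg (a b d : space) (a20 a30 b20 b30 : R) :
  [/\ a 0 0 = 1, a 0 1 = 0 & a 0 2%:R = 0] -> [/\ b 0 0 = 0, b 0 1 = a20 & b 0 2%:R = b20] ->
  [/\ d 0 0 = 0, d 0 1 = a30 & d 0 2%:R = b30] ->
  det3 a b d / enorm (cross a b) ^+ 2 = (a20 * b30 - b20 * a30) / (a20 ^+ 2 + b20 ^+ 2).
Proof.
move=> [a0 a1 a2] [b0 b1 b2] [d0 d1 d2].
rewrite enorm_sqr dot_cross_cross !dot3E det3E a0 a1 a2 b0 b1 b2 d0 d1 d2.
congr (_ / _); ring.
Qed.

Section AlongLine.
Variables (V : normedModType R) (p w : V) (A B C : V -> space) (a b c b' c' : space) (a20 a30 b20 b30 b12 : R).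
Hypotheses (sA : smooth_at A p) (sB : smooth_at B p) (sC : smooth_at C p).
Hypotheses (Ea : A p = a) (Eb : B p = b) (Ec : C p = c).
Hypotheses (dA : 'D_w A p = b) (dB : 'D_w B p = b') (dC : 'D_w C p = c').
Hypotheses (aE : [/\ a 0 0 = 1, a 0 1 = 0 & a 0 2%:R = 0]) (bE : [/\ b 0 0 = 0, b 0 1 = a20 & b 0 2%:R = b20])
  (cE : [/\ c 0 0 = 0, c 0 1 = 1 & c 0 2%:R = 0]) (b'E : [/\ b' 0 0 = 0, b' 0 1 = a30 & b' 0 2%:R = b30])
  (c'E : [/\ c' 0 0 = 0, c' 0 1 = 0 & c' 0 2%:R = b12]).

Let sAA := smooth_dot sA sA.
Let sAC := smooth_dot sA sC.
Let sBA := smooth_dot sB sA.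
Let sBC := smooth_dot sB sC.
Let sCC := smooth_dot sC sC.
Let sW : smooth_at (fun x => axis_W (A x) (C x)) p.
Proof. exact: (smoothB (smoothM sAA sCC) (smoothX 2 sAC)). Qed.

Let alg : [/\ [/\ dot a a = 1, dot b a = 0, dot a c = 0, dot c c = 1 & dot b c = a20],
   [/\ dot b' c = a30, dot b c' = b20 * b12, dot a c' = 0 & dot c c' = 0],
   det3 a c b = b20 & [/\ det3 b c b = 0, det3 a c' b = - (a20 * b12) & det3 a c b' = b30]].
Proof.
have [[a0 a1 a2] [b0 b1 b2] [c0 c1 c2] [d0 d1 d2] [e0 e1 e2]] := And5 aE bE cE b'E c'E.
rewrite !dot3E !det3E a0 a1 a2 b0 b1 b2 c0 c1 c2 d0 d1 d2 e0 e1 e2.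
by split; [split|split| |split]; ring.
Qed.

(** At the base point [a] and [c] are orthonormal, [b] is orthogonal to [a] and [c'] to [c]; so both
    normalizing factors are 1 and stationary, as [derive_quotient] demands. *)
Lemma axis_base : [/\ dot (A p) (A p) = 1, axis_W (A p) (C p) = 1,
  'D_w (fun x => dot (A x) (A x)) p = 0 & 'D_w (fun x => axis_W (A x) (C x)) p = 0].
Proof.
have [[aa ba ac cc bc] [b'c bc' ac' cc'] _ _] := alg.
have dP : 'D_w (fun x => dot (A x) (A x)) p = 0 by rewrite (derive_dot w sA sA) dA Ea (dotC a b) ba addr0.
split=> //; first by rewrite Ea.
  by rewrite /axis_W Ea Ec aa ac cc expr0n subr0 mulr1.
have dCC : 'D_w (fun x => dot (C x) (C x)) p = 0.
  by rewrite (derive_dot w sC sC) Ec dC dotC cc' addr0.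
have WE : \forall x \near p, axis_W (A x) (C x) = dot (A x) (A x) * dot (C x) (C x) + (- dot (A x) (C x)) * dot (A x) (C x).
  by apply: near_all => x; rewrite mulNr -expr2.
rewrite (near_eq_derive w WE) (derive_comb w sAA sCC (smoothN sAC) sAC).
by rewrite dP dCC Ea Ec ac !(mulr0, mul0r, oppr0, addr0).
Qed.

(** To first order only [dot b c] changes the numerator: its derivative [dot b' c] + [dot b c'] is
    a30 + b20 b12, and the other terms contain a vanishing factor. *)
Lemma axis_ks_val : let K x := axis_ks (A x) (B x) (C x) in
  [/\ smooth_at K p, K p = a20 & 'D_w K p = a30 + b20 * b12].
Proof.
move=> K; have [P1 W1 dP dW] := axis_base.
have [[aa ba ac cc bc] [b'c bc' ac' cc'] _ _] := alg.
pose N x := dot (A x) (A x) * dot (B x) (C x) + (- dot (A x) (C x)) * dot (B x) (A x).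
have sN : smooth_at N p := smoothD (smoothM sAA sBC) (smoothM (smoothN sAC) sBA).
have [sK K0 dK] := derive_quotient 3 sN sAA sW P1 W1 dP dW.
have E : \forall x \near p, (fun x => N x / (Num.sqrt (dot (A x) (A x)) ^+ 3 * Num.sqrt (axis_W (A x) (C x)))) x = K x.
  by apply: near_all => x; rewrite /N mulNr.
split.
- exact: smooth_ext E sK.
- by rewrite -(nbhs_singleton E) K0 /N Ea Eb Ec aa bc ac; ring.
rewrite -(near_eq_derive w E) dK (derive_comb w sAA sBC (smoothN sAC) sBA).
have -> : 'D_w (fun x => - dot (A x) (C x)) p = - 'D_w (fun x => dot (A x) (C x)) p.
  by apply: deriveN; exact/diff_derivable/smooth_diff.
rewrite dP (derive_dot w sB sC) (derive_dot w sA sC) dA dB dC Ea Eb Ec aa ba ac b'c bc'.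
move: ('D_w _ _) => q; ring.
Qed.

(** The derivative of the determinant has three terms: differentiating [a] gives a repeated vector,
    [c] gives - a20 b12, and [b] gives b30. *)
Lemma axis_kn_val : let K x := axis_kn (A x) (B x) (C x) in
  [/\ smooth_at K p, K p = b20 & 'D_w K p = b30 - a20 * b12].
Proof.
have [P1 W1 dP dW] := axis_base.
have [_ _ d0 [d1 d2 d3]] := alg.
have [sK K0 dK] := derive_quotient 2 (smooth_det3 sA sC sB) sAA sW P1 W1 dP dW.
split; [exact: sK|by rewrite [LHS]K0 Ea Eb Ec|].
rewrite [LHS]dK (derive_det3 w sA sC sB) dA dB dC Ea Eb Ec d1 d2 d3; ring.
Qed.
End AlongLine.

Variables (F : plane -> space) (a20 a30 b20 b30 b12 b03 : R).
Hypothesis mF : model F a20 a30 b20 b30 b12 b03.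

Let sF : smooth_at F 0. Proof. by have [] := mF. Qed.
Let A := 'D_eu F.
Let B := 'D_eu A.
Let C := 'D_ev ('D_ev F).
Let sA : smooth_at A 0. Proof. exact: smooth_derive. Qed.
Let sB : smooth_at B 0. Proof. exact: smooth_derive. Qed.
Let sC : smooth_at C 0. Proof. by do 2!apply: smooth_derive. Qed.

Lemma model_vals : exists a b c b' c' : space,
  [/\ A 0 = a, B 0 = b, C 0 = c, 'D_eu B 0 = b' & 'D_eu C 0 = c'] /\
  [/\ [/\ a 0 0 = 1, a 0 1 = 0 & a 0 2%:R = 0], [/\ b 0 0 = 0, b 0 1 = a20 & b 0 2%:R = b20],
      [/\ c 0 0 = 0, c 0 1 = 1 & c 0 2%:R = 0], [/\ b' 0 0 = 0, b' 0 1 = a30 & b' 0 2%:R = b30] &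
      [/\ c' 0 0 = 0, c' 0 1 = 0 & c' 0 2%:R = b12]].
Proof.
have [[u0 uu0 vv0 [uuu0 uvv0 _]] [u1 uu1 vv1 [uuu1 uvv1 _]] [u2 uu2 vv2 [uuu2 uvv2 _]]] := model_jets mF.
have c vs k := nbhs_singleton (iter_derive_row vs k sF).
exists (A 0), (B 0), (C 0), ('D_eu B 0), ('D_eu C 0); split=> //.
split; split.
- by rewrite -u0; exact: (c [:: eu] 0).
- by rewrite -u1; exact: (c [:: eu] 1).
- by rewrite -u2; exact: (c [:: eu] 2%:R).
- by rewrite -uu0; exact: (c [:: eu; eu] 0).
- by rewrite -uu1; exact: (c [:: eu; eu] 1).
- by rewrite -uu2; exact: (c [:: eu; eu] 2%:R).
- by rewrite -vv0; exact: (c [:: ev; ev] 0).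
- by rewrite -vv1; exact: (c [:: ev; ev] 1).
- by rewrite -vv2; exact: (c [:: ev; ev] 2%:R).
- by rewrite -uuu0; exact: (c [:: eu; eu; eu] 0).
- by rewrite -uuu1; exact: (c [:: eu; eu; eu] 1).
- by rewrite -uuu2; exact: (c [:: eu; eu; eu] 2%:R).
- by rewrite -uvv0; exact: (c [:: eu; ev; ev] 0).
- by rewrite -uvv1; exact: (c [:: eu; ev; ev] 1).
- by rewrite -uvv2; exact: (c [:: eu; ev; ev] 2%:R).
Qed.

Lemma model_regular : \forall x \near (0 : plane),
  0 < dot (A x) (A x) /\ 0 < axis_W (A x) (C x).
Proof.
have [a [b [c [b' [c' [[Ea Eb Ec Eb' Ec'] [aE bE cE b'E c'E]]]]]]] := model_vals.
have [P1 W1 _ _] := axis_base sA sC Ea Ec Eb Ec' aE bE cE b'E c'E.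
have sP := smooth_dot sA sA.
have sW := smoothB (smoothM sP (smooth_dot sC sC)) (smoothX 2 (smooth_dot sA sC)).
have P0 : 0 < dot (A 0) (A 0) by rewrite P1.
have W0 : 0 < dot (A 0) (A 0) * dot (C 0) (C 0) - dot (A 0) (C 0) ^+ 2 by rewrite -/(axis_W _ _) W1.
by apply: filterS2 (near_gt0 sP P0) (near_gt0 sW W0) => x.
Qed.

Lemma model_speed : enorm (A 0) = 1.
Proof.
have [a [_ [_ [_ [_ [[-> _ _ _ _] [[a0 a1 a2] _ _ _ _]]]]]]] := model_vals.
by apply: enorm_eq => //; rewrite dot3E a0 a1 a2; ring.
Qed.

Lemma model_torsion : det3 (A 0) (B 0) ('D_eu B 0) / enorm (cross (A 0) (B 0)) ^+ 2 =
  (a20 * b30 - b20 * a30) / (a20 ^+ 2 + b20 ^+ 2).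
Proof.
have [a [b [_ [b' [_ [[Ea Eb _ Eb' _] [aE bE _ b'E _]]]]]]] := model_vals.
subst a b b'; exact: torsion_alg aE bE b'E.
Qed.

Definition Ks x := axis_ks (A x) (B x) (C x).
Definition Kn x := axis_kn (A x) (B x) (C x).

Lemma Ks_jet : [/\ smooth_at Ks 0, Ks 0 = a20 & 'D_eu Ks 0 = a30 + b20 * b12].
Proof.
have [a [b [c [b' [c' [[Ea Eb Ec Eb' Ec'] [aE bE cE b'E c'E]]]]]]] := model_vals.
exact: (axis_ks_val sA sB sC Ea Eb Ec Eb Eb' Ec' aE bE cE b'E c'E).
Qed.

Lemma Kn_jet : [/\ smooth_at Kn 0, Kn 0 = b20 & 'D_eu Kn 0 = b30 - a20 * b12].
Proof.
have [a [b [c [b' [c' [[Ea Eb Ec Eb' Ec'] [aE bE cE b'E c'E]]]]]]] := model_vals.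
exact: (axis_kn_val sA sB sC Ea Eb Ec Eb Eb' Ec' aE bE cE b'E c'E).
Qed.
End AxisFunctions.

(** * Comparison of kappa_s with its expression along the axis *)

Section AxisValues.
Context {R : realType}.
Notation eu := (@e_u R).
Notation ev := (@e_v R).
Notation plane := 'rV[R]_2.
Notation space := 'rV[R]_3.

Variables (F : plane -> space) (a20 a30 b20 b30 b12 b03 : R).
Hypothesis mF : model F a20 a30 b20 b30 b12 b03.
Let sF : smooth_at F 0. Proof. by have [] := mF. Qed.
Let Fv : \forall x \near (0 : plane), on_axis x -> 'D_ev F x = 0. Proof. by have [] := mF. Qed.

Variables (xi eta : plane -> plane) (n : plane -> space).
Hypotheses (sxi : smooth_at xi 0) (seta : smooth_at eta 0) (sn : smooth_at n 0).
Hypothesis xi1 : \forall x \near (0 : plane), on_axis x -> xi x 0 1 = 0.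
Hypothesis eta0 : \forall x \near (0 : plane), on_axis x -> eta x 0 0 = 0.
Hypothesis pos : \forall x \near (0 : plane), on_axis x -> 0 < xi x 0 0 * eta x 0 1.
Hypothesis normal : \forall x \near (0 : plane),
  [/\ enorm (n x) = 1, dot ('D_eu F x) (n x) = 0 & dot ('D_ev F x) (n x) = 0].

Let sk k : smooth_at (fun x => F x 0 k) 0. Proof. exact: smooth_coord. Qed.
Let FE k : \forall x \near (0 : plane), F x 0 k = F x 0 k. Proof. exact: near_all. Qed.
Let row vs k := iter_derive_row vs k sF.

Lemma model_xi : \forall x \near (0 : plane), on_axis x -> vf_derive xi F x = xi x 0 0 *: 'D_eu F x.
Proof.
apply: filterS2 xi1 (smooth_near sF) => x e1 sx ax.
by rewrite /vf_derive (derive2 _ (smooth_diff sx)) e1 // scale0r addr0.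
Qed.

Lemma near_row (P : plane -> 'I_3 -> Prop) : (forall k, \forall x \near (0 : plane), P x k) ->
  \forall x \near (0 : plane), forall k, P x k.
Proof. by move=> H; apply: filterS3 (H 0) (H 1) (H 2%:R) => x h0 h1 h2; exact: ord3. Qed.

(** The coefficient [m] can stay unspecified: it multiplies F_u, which drops out of a determinant
    that already contains a multiple of F_u. *)
Lemma model_xi2 : \forall x \near (0 : plane), on_axis x -> exists m,
  vf_derive xi (vf_derive xi F) x = (xi x 0 0 * xi x 0 0) *: 'D_eu ('D_eu F) x + m *: 'D_eu F x.
Proof.
have sx := smooth_vf_row sxi sF.
have H := near_row (fun k => vf_coord_near xi sx (vf_coord_near xi sF (FE k))).
have G := near_row (fun k => vf_xi2 sxi (sk k) xi1).
apply: filterS3 H G (filterI (near_row (row [:: eu])) (near_row (row [:: eu; eu]))) => x h g [r1 r2] ax.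
exists (xi x 0 0 * 'D_eu (fun y => xi y 0 0) x).
apply/rowP => k; rewrite h g //.
have alg (r hu huu ru au auu : R) : au = hu -> auu = huu -> r * (r * huu + hu * ru) = r * r * auu + r * ru * au.
  by move=> -> ->; ring.
by rewrite !mxE; apply: alg; [exact: r1|exact: r2].
Qed.

Lemma model_eta2 : \forall x \near (0 : plane), on_axis x -> exists m,
  vf_derive eta (vf_derive eta F) x = (eta x 0 1 ^+ 2) *: 'D_ev ('D_ev F) x + m *: 'D_eu F x.
Proof.
have hv k : \forall x \near (0 : plane), on_axis x -> 'D_ev (fun x => F x 0 k) x = 0.
  apply: filterS2 Fv (smooth_near sF) => x E sx ax.
  by rewrite -(derive_coord _ _ (smooth_diff sx)) (E ax) mxE.
have se := smooth_vf_row seta sF.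
have H := near_row (fun k => vf_coord_near eta se (vf_coord_near eta sF (FE k))).
have G := near_row (fun k => vf_eta2 seta (sk k) eta0 (hv k)).
apply: filterS3 H G (filterI (near_row (row [:: eu])) (near_row (row [:: ev; ev]))) => x h g [r1 r2] ax.
exists (eta x 0 1 * 'D_ev (fun y => eta y 0 0) x).
apply/rowP => k; rewrite h g //.
have alg (b hu hvv av au cc : R) : au = hu -> cc = hvv -> b * (hu * av + b * hvv) = b ^+ 2 * cc + b * av * au.
  by move=> -> ->; ring.
by rewrite !mxE; apply: alg; [exact: r1|exact: r2].
Qed.

(** On the axis [eta] is vertical, and of the three terms of the differentiated determinant the two
    that still contain F_v vanish. *)
Lemma model_lambda : \forall x \near (0 : plane), on_axis x ->
  vf_derive eta (lambda F n) x = eta x 0 1 * det3 ('D_eu F x) ('D_ev ('D_ev F) x) (n x).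
Proof.
have sl := smooth_lambda sF sn.
apply: filterS3 (vf_near eta sl) (filterI eta0 Fv) (filterI (smooth_near sF) (smooth_near sn)).
move=> x -> [e0 fv] [sx snx] ax; rewrite e0 // mul0r add0r; congr (_ * _).
rewrite [LHS](derive_det3 ev (smooth_derive eu sx) (smooth_derive ev sx) snx) fv //.
have d1 (p q : space) : det3 p 0 q = 0 by rewrite det3E !mxE; ring.
by rewrite !d1 add0r addr0.
Qed.

(** Orthogonality of F_v and [n] holds on a neighbourhood; its v-derivative on the axis, where F_v =
    0, leaves only this product. *)
Lemma model_normal_vv : \forall x \near (0 : plane), on_axis x -> dot ('D_ev ('D_ev F) x) (n x) = 0.
Proof.
have Z : \forall x \near (0 : plane), dot ('D_ev F x) (n x) = 0 by apply: filterS normal => x [].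
have /near_join Z' := Z.
apply: filterS3 Z' Fv (filterI (smooth_near sF) (smooth_near sn)) => x z fv [sx snx] ax.
have := near_eq_derive ev z; rewrite (derive_dot ev (smooth_derive ev sx) snx) derive_cst fv //.
have d0 (q : space) : dot 0 q = 0 by rewrite dot3E !mxE; ring.
by rewrite d0 addr0.
Qed.

Lemma kappa_s_axis : \forall x \near (0 : plane), on_axis x -> kappa_s F xi eta n x = Ks F x.
Proof.
apply: filterS3 (filterI model_xi model_xi2) (filterI model_lambda model_normal_vv) (filterI normal (filterI pos (model_regular mF))).
move=> x [X XX] [L Z] [[n1 nu _] [ps [p0 W0]]] ax.
have [m {}XX] := XX ax.
have Z0 := Z ax; have ps0 := ps ax.
rewrite kappa_sE X // XX L // (ks_val _ _ ps0 n1 nu Z0 W0).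
by rewrite /Ks /axis_ks /axis_W /enorm.
Qed.
End AxisValues.

(** * Curves running in the axis *)

Section AxisCurves.
Context {R : realType}.
Notation eu := (@e_u R).
Notation ev := (@e_v R).
Notation plane := 'rV[R]_2.
Notation space := 'rV[R]_3.

Lemma derive_scale (V : normedModType R) (s : V -> R) (Y : V -> space) p w : smooth_at s p -> smooth_at Y p ->
  smooth_at (fun q => s q *: Y q) p /\
  'D_w (fun q => s q *: Y q) p = s p *: 'D_w Y p + 'D_w s p *: Y p.
Proof.
move=> ss sY.
have E k : \forall q \near p, (s q *: Y q) 0 k = s q * Y q 0 k by apply: near_all => q; rewrite mxE.
have sk k : smooth_at (fun q => s q * Y q 0 k) p by apply: smoothM ss (smooth_coord k sY).
have sZ : smooth_at (fun q => s q *: Y q) p.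
  by apply: smooth_row => k; apply: smooth_ext (sk k); apply: filterS (E k) => q ->.
split=> //; apply/rowP => k; rewrite (derive_coord _ _ (smooth_diff sZ)) (near_eq_derive w (E k)).
rewrite (deriveM_smooth w ss (smooth_coord k sY)) -(derive_coord _ _ (smooth_diff sY)) !mxE; ring.
Qed.

Lemma curve_chain (W : normedModType R) (H : plane -> W) (c : R -> plane) :
  smooth_at c 0 -> c 0 = 0 -> (\forall t \near (0 : R), c t 0 1 = 0) -> smooth_at H 0 ->
  \forall t \near (0 : R), 'D_1 (H \o c) t = 'D_1 (fun t => c t 0 0) t *: 'D_eu H (c t).
Proof.
move=> sc c0 ax sH; have /near_join ax' := ax.
apply: filterS3 (smooth_near sc) (near_comp sc c0 (smooth_near sH)) ax' => t sct sHt axt.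
rewrite (derive_chain _ (smooth_diff sct) (smooth_diff sHt)) (derive2 _ (smooth_diff sHt)).
rewrite !(derive_coord _ _ (smooth_diff sct)) (near_eq_derive _ axt) derive_cst.
by rewrite scale0r addr0.
Qed.

Section OnCurve.
Variables (F : plane -> space) (c : R -> plane).
Hypotheses (sF : smooth_at F 0) (sc : smooth_at c 0) (c0 : c 0 = 0).
Hypothesis ax : \forall t \near (0 : R), c t 0 1 = 0.
Let x t := c t 0 0.
Let sx : smooth_at x 0. Proof. exact: smooth_coord. Qed.
Let sD1 := smooth_derive (1 : R) sx.
Let sD2 := smooth_derive (1 : R) sD1.
Let A := 'D_eu F.
Let B := 'D_eu A.
Let D := 'D_eu B.
Let sA : smooth_at A 0 := smooth_derive eu sF.
Let sB : smooth_at B 0 := smooth_derive eu sA.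
Let scomp (H : plane -> space) : smooth_at H 0 -> smooth_at (H \o c) 0.
Proof. by move=> sH; apply: smooth_comp_row; rewrite ?c0. Qed.

Lemma curve_d1 : \forall t \near (0 : R), derive1 (F \o c) t = 'D_1 x t *: A (c t).
Proof. by apply: filterS (curve_chain sc c0 ax sF) => t <-; rewrite derive1E. Qed.

Lemma curve_d2 : \forall t \near (0 : R), derive1n 2 (F \o c) t =
  'D_1 x t ^+ 2 *: B (c t) + 'D_1 ('D_1 x) t *: A (c t).
Proof.
have /near_join E := curve_d1.
apply: filterS3 E (curve_chain sc c0 ax sA) (filterI (smooth_near sD1) (smooth_near (scomp sA))) => t Et At [s1 s2].
rewrite derive1nS derive1n1 derive1E (near_eq_derive _ Et).
have [_ ->] := derive_scale (1 : R) s1 s2.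
by rewrite At scalerA -expr2.
Qed.

Lemma curve_d3 : exists m n, derive1n 3 (F \o c) 0 = 'D_1 x 0 ^+ 3 *: D 0 + m *: B 0 + n *: A 0.
Proof.
have sX2 := smoothX 2 sD1.
have [s1 d1] := derive_scale (1 : R) sX2 (scomp sB).
have [s2 d2] := derive_scale (1 : R) sD2 (scomp sA).
rewrite derive1nS derive1E (near_eq_derive _ curve_d2).
have -> : 'D_1 (fun t => 'D_1 x t ^+ 2 *: B (c t) + 'D_1 ('D_1 x) t *: A (c t)) 0 =
  'D_1 (fun t => 'D_1 x t ^+ 2 *: (B \o c) t) 0 + 'D_1 (fun t => 'D_1 ('D_1 x) t *: (A \o c) t) 0.
  exact: deriveD (diff_derivable (smooth_diff s1)) (diff_derivable (smooth_diff s2)).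
rewrite d1 d2 (nbhs_singleton (curve_chain sc c0 ax sB)) (nbhs_singleton (curve_chain sc c0 ax sA)).
rewrite /= c0 -/x -/D.
exists ('D_1 (fun t => 'D_1 x t ^+ 2) 0 + 'D_1 ('D_1 x) 0 * 'D_1 x 0), ('D_1 ('D_1 ('D_1 x)) 0).
have alg (p q r s : R) (d b a : space) :
  s ^+ 2 *: (s *: d) + p *: b + (q *: (s *: b) + r *: a) = s ^+ 3 *: d + (p + q * s) *: b + r *: a.
  by apply/rowP => k; rewrite !mxE; ring.
exact: alg.
Qed.

(** The lower-order terms of the derivatives drop out of the determinant and the cross product;
    numerator and denominator both scale with the sixth power of the speed in u. *)
Lemma curve_torsion : 'D_1 x 0 != 0 ->
  torsion (F \o c) 0 = det3 (A 0) (B 0) (D 0) / enorm (cross (A 0) (B 0)) ^+ 2.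
Proof.
move=> x0; have [m [n E3]] := curve_d3; rewrite /torsion E3.
rewrite (nbhs_singleton curve_d1) (nbhs_singleton curve_d2) c0.
move: ('D_1 x 0) ('D_1 ('D_1 x) 0) (A 0) (B 0) (D 0) x0 => s q a b d s0.
have -> : det3 (s *: a) (s ^+ 2 *: b + q *: a) (s ^+ 3 *: d + m *: b + n *: a) = s ^+ 6 * det3 a b d.
  rewrite !det3E !mxE; ring.
have -> : enorm (cross (s *: a) (s ^+ 2 *: b + q *: a)) ^+ 2 = s ^+ 6 * enorm (cross a b) ^+ 2.
  rewrite !enorm_sqr !dot_cross_cross !(dotDl, dotDr, dotZl, dotZr); ring.
by rewrite -mulf_div divff ?mul1r // expf_neq0.
Qed.

Lemma curve_derive (h : plane -> R) : smooth_at h 0 -> derive1 (h \o c) 0 = 'D_1 x 0 * 'D_eu h 0.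
Proof. by move=> sh; rewrite derive1E (nbhs_singleton (curve_chain sc c0 ax sh)) c0. Qed.
End OnCurve.
End AxisCurves.

(** * Torsion and signed normal curvature under rotations *)

Section CurveInvariants.
Context {R : realType}.
Notation eu := (@e_u R).
Notation ev := (@e_v R).
Notation plane := 'rV[R]_2.
Notation space := 'rV[R]_3.

Lemma derive1n_smooth (gamma : R -> space) k x : smooth_at gamma x -> smooth_at (derive1n k gamma) x.
Proof.
move=> sg; elim: k => [|k IH] //.
apply: smooth_ext (smooth_derive (1 : R) IH); apply: near_all => t.
by rewrite derive1nS derive1E.
Qed.

Lemma derive1n_mulmx (gamma G : R -> space) (N : 'M[R]_3) k : smooth_at gamma 0 ->
  (\forall t \near (0 : R), G t = gamma t *m N) ->
  \forall t \near (0 : R), derive1n k G t = derive1n k gamma t *m N.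
Proof.
move=> sg GE; elim: k => [|k IH] //.
have /near_join IH' := IH.
apply: filterS2 IH' (smooth_near (derive1n_smooth k sg)) => t E st.
by rewrite !derive1nS !derive1E (near_eq_derive _ E) derive_mulmx_row.
Qed.

Lemma torsion_rot (gamma G : R -> space) (N : 'M[R]_3) : N *m N^T = 1%:M -> \det N = 1 ->
  smooth_at gamma 0 -> (\forall t \near (0 : R), G t = gamma t *m N) ->
  torsion G 0 = torsion gamma 0.
Proof.
move=> NN dN sg GE; have E k := nbhs_singleton (derive1n_mulmx k sg GE).
have E1 : derive1 G 0 = derive1 gamma 0 *m N := E 1%N.
by rewrite /torsion E1 (E 2%N) (E 3%N) det3_rot // enorm_cross_rot.
Qed.

Definition skn (x xx e : space) : R := dot xx ((enorm (cross x e))^-1 *: cross x e).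

Lemma skn_rot (x xx e : space) (N : 'M[R]_3) : N *m N^T = 1%:M -> \det N = 1 ->
  skn (x *m N) (xx *m N) (e *m N) = skn x xx e.
Proof.
move=> NN dN; rewrite /skn !dotZr enorm_cross_rot // ![dot _ (cross _ _)]dotC !dot_cross.
by rewrite det3_rot.
Qed.

(** The factor beta^2 occurs in the determinant and in the norm of the cross product; what remains
    is s^2, equal to 1 / [dot a a] by unit speed. Positivity of [s] makes this norm a multiple of s
    itself and thereby fixes the sign. *)
Lemma skn_val (a b c : space) (s beta q m : R) : 0 < s -> beta != 0 -> enorm (s *: a) = 1 -> 0 < axis_W a c ->
  skn (s *: a) (s ^+ 2 *: b + q *: a) (beta ^+ 2 *: c + m *: a) = axis_kn a b c.
Proof.
move=> s0 b0 sa W0.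
have P : s ^+ 2 * dot a a = 1.
  have := enorm_sqr (s *: a); rewrite sa expr1n => ->; rewrite dotZl dotZr mulrA -expr2 //.
have D : dot (s ^+ 2 *: b + q *: a) (cross (s *: a) (beta ^+ 2 *: c + m *: a)) = s ^+ 3 * beta ^+ 2 * det3 a c b.
  rewrite dotC dot_cross !det3E !mxE; ring.
have W : enorm (cross (s *: a) (beta ^+ 2 *: c + m *: a)) = s * beta ^+ 2 * Num.sqrt (axis_W a c).
  apply: enorm_eq; first exact: mulr_ge0 (mulr_ge0 (ltW s0) (sqr_ge0 _)) (sqrtr_ge0 _).
  rewrite exprMn sqr_sqrtr ?(ltW W0) // dot_cross_cross /axis_W !(dotDl, dotDr, dotZl, dotZr) (dotC c a); ring.
have PE : dot a a = (s ^+ 2)^-1.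
  by apply: (mulfI (expf_neq0 2 (lt0r_neq0 s0))); rewrite P divff // expf_neq0 // lt0r_neq0.
rewrite /skn dotZr D W /axis_kn sqr_sqrtr ?dot_ge0 // PE.
have : Num.sqrt (axis_W a c) != 0 by rewrite gt_eqF // sqrtr_gt0.
move: (Num.sqrt _) (det3 a c b) (lt0r_neq0 s0) => w d sN wN; field.
by rewrite sN wN b0.
Qed.
Lemma skn_pull (y yy z a b c : space) (N : 'M[R]_3) (s beta q m : R) : N *m N^T = 1%:M -> \det N = 1 ->
  0 < s -> beta != 0 -> enorm y = 1 -> 0 < axis_W a c -> y *m N = s *: a ->
  yy *m N = s ^+ 2 *: b + q *: a -> z *m N = beta ^+ 2 *: c + m *: a -> skn y yy z = axis_kn a b c.
Proof.
move=> NN dN s0 b0 y1 W0 Ey Eyy Ez; rewrite -(skn_rot y yy z NN dN) Ey Eyy Ez.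
by apply: skn_val => //; rewrite -Ey enorm_rot.
Qed.
End CurveInvariants.

(** * The invariants of [f] in terms of its normal form *)

Section Invariants.
Context {R : realType}.
Notation eu := (@e_u R).
Notation ev := (@e_v R).
Notation plane := 'rV[R]_2.
Notation space := 'rV[R]_3.
Variables (f : plane -> space) (phi psi : plane -> plane) (M : 'M[R]_3) (a20 a30 b20 b30 b12 b03 : R).
Variables (xi eta : plane -> plane) (nu : plane -> space).
Hypotheses (sf : smooth_at f 0) (nc : normal_coords f phi M a20 a30 b20 b30 b12 b03) (J0 : 0 < jac phi 0).
Hypotheses (adm : adapted f xi eta) (un : unit_normal f nu).
Hypotheses (q0 : psi 0 = 0) (spsi : smooth_at psi 0).
Hypotheses (phiK : \forall x \near (0 : plane), psi (phi x) = x).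
Hypotheses (psiK : \forall x \near (0 : plane), phi (psi x) = x).

Let ec : edge_coords f phi. Proof. by have [] := nc. Qed.
Let p0 : phi 0 = 0. Proof. by have [[]] := ec. Qed.
Let sphi : smooth_at phi 0. Proof. by have [[]] := ec. Qed.
Let NN : M^T *m M^T^T = 1%:M. Proof. by rewrite trmxK; apply: mulmx1C; have [] := nc. Qed.
Let dN : \det M^T = 1. Proof. by rewrite det_tr; have [] := nc. Qed.
Let F x := f (phi x) *m M^T.
Let mF : model F a20 a30 b20 b30 b12 b03.
Proof.
have [_ _ _ [F0 F1 F2]] := nc; split; [| |exact: F0|exact: F1|exact: F2].
  have s : smooth_at (f \o phi) 0 by apply: smooth_comp_row; rewrite ?p0.
  exact: (smooth_mulmx M^T s).
exact: (Fv_axis M^T p0 sphi sf ec).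
Qed.
Let sF : smooth_at F 0. Proof. by have [] := mF. Qed.
Let Fu0 : 'D_eu F 0 0 0 != 0.
Proof.
have [[u0 _ _ _] _ _] := model_jets mF.
by rewrite (derive_coord _ _ (smooth_diff sF)) u0 oner_neq0.
Qed.
Let sxi : smooth_at xi 0. Proof. by have [] := adm. Qed.
Let seta : smooth_at eta 0. Proof. by have [] := adm. Qed.
Let xi1 := pull_xi_axis p0 sphi q0 spsi psiK ec adm.
Let eta0 := pull_eta_axis p0 sphi q0 spsi phiK psiK sf ec adm Fu0.
Let pos := pull_pos p0 sphi q0 spsi phiK psiK sf ec adm J0 Fu0.
Let spxi := smooth_pull p0 sphi spsi sxi.
Let speta := smooth_pull p0 sphi spsi seta.
Let n := pull_normal phi nu M^T.
Let sn : smooth_at n 0 := smooth_pull_normal M^T p0 sphi un.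
Let normal := pull_normalP p0 sphi NN sf un.

Let ks_axis : \forall x \near (0 : plane), on_axis x -> kappa_s f xi eta nu (phi x) = Ks F x.
Proof.
have E := kappa_s_axis mF spxi sn xi1 eta0 pos normal.
have E' := kappa_s_pull p0 sphi q0 spsi phiK psiK NN dN sf ec adm J0 un.
by apply: filterS2 E E' => x e1 e2 ax; exact: etrans (e2 ax) (e1 ax).
Qed.

Lemma invariants_at0 : [/\ kappa_s f xi eta nu 0 = a20, kappa_n f xi eta 0 = `|b20|,
  kappa_c f xi eta 0 = b03, kappa_t f xi eta 0 = b12 & kappa_i f xi eta 0 = b30].
Proof.
have [k1 k2 k3 k4] := model_kappas mF spxi speta xi1 eta0 (near_axis0 pos).
have [] := nbhs_singleton (kappas_pull p0 sphi q0 spsi phiK psiK sf sxi seta NN dN).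
rewrite p0 => -> -> -> ->; split; [|exact: k1|exact: k2|exact: k3|exact: k4].
by have [_ <- _] := Ks_jet mF; rewrite -(near_axis0 ks_axis) p0.
Qed.

Section Curve.
Variable c : R -> plane.
Hypothesis cP : sing_param f c.
Let c1 := psi \o c.
Let x t := c1 t 0 0.
Let sc : smooth_at c 0. Proof. by have [] := cP. Qed.
Let c0 : c 0 = 0. Proof. by have [] := cP. Qed.
Let sc1 : smooth_at c1 0. Proof. by apply: smooth_comp_row; rewrite ?c0. Qed.
Let c10 : c1 0 = 0. Proof. by rewrite /c1 /= c0 q0. Qed.
Let ax : \forall t \near (0 : R), c1 t 0 1 = 0.
Proof.
have [_ _ _ S] := cP.
by apply: filterS2 S (near_comp sc c0 (sing_axis q0 spsi psiK ec)) => t s [e _]; exact: e.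
Qed.
Let cE : \forall t \near (0 : R), c t = phi (c1 t).
Proof. by apply: filterS (near_comp sc c0 psiK) => t ->. Qed.
Let sx : smooth_at x 0. Proof. exact: smooth_coord. Qed.
Let sfc : smooth_at (f \o c) 0. Proof. by apply: smooth_comp_row; rewrite ?c0. Qed.
Let GE : \forall t \near (0 : R), (F \o c1) t = (f \o c) t *m M^T.
Proof. by apply: filterS cE => t E; rewrite /= /F -E. Qed.

(** Near 0 the curve is the image under [phi] of a curve in the axis; the sign of the factor tells
    whether it runs with or against u. *)
Lemma sing_speed : derive1 c 0 = 'D_1 x 0 *: 'D_eu phi 0.
Proof.
have E := curve_chain sc1 c10 ax sphi.
by rewrite derive1E (near_eq_derive _ cE) (nbhs_singleton E) c10.
Qed.

Lemma sing_speed_neq0 : 'D_1 x 0 != 0.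
Proof.
have [_ _ + _] := cP; rewrite sing_speed; apply: contraNneq => ->; by rewrite scale0r.
Qed.

Lemma torsion_val : torsion (f \o c) 0 = (a20 * b30 - b20 * a30) / (a20 ^+ 2 + b20 ^+ 2).
Proof.
rewrite -(torsion_rot NN dN sfc GE) (curve_torsion sF sc1 c10 ax sing_speed_neq0).
exact: (model_torsion mF).
Qed.

Lemma kappa_s'_val : kappa_s' f xi eta nu c = 'D_1 x 0 * (a30 + b20 * b12).
Proof.
have [sK _ dK] := Ks_jet mF.
rewrite -dK -(curve_derive sc1 c10 ax sK) /kappa_s' !derive1E; apply: near_eq_derive.
by apply: filterS3 cE ax (near_comp sc1 c10 ks_axis) => t E at0 K; rewrite /= E K.
Qed.

(** Positive speed means that the curve runs in the direction of growing u, which fixes the sign of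
    [curve_normal]. The identity is established near 0, not just at 0, because it is differentiated
    afterwards. *)
Lemma signed_kappa_n_axis : 0 < 'D_1 x 0 -> (\forall t \near (0 : R), enorm (derive1 (f \o c) t) = 1) ->
  \forall t \near (0 : R), signed_kappa_n f eta c t = Kn F (c1 t).
Proof.
move=> x0 arc.
have se := smooth_vf_row seta sf.
have FE : \forall x \near (0 : plane), F x = f (phi x) *m M^T by exact: near_all.
have E2 := vf_pull p0 sphi q0 spsi phiK psiK eta se (vf_pull p0 sphi q0 spsi phiK psiK eta sf FE).
have D1 : \forall t \near (0 : R), derive1 (F \o c1) t = derive1 (f \o c) t *m M^T.
  exact: (derive1n_mulmx 1 sfc GE).
have D2 : \forall t \near (0 : R), derive1n 2 (F \o c1) t = derive1n 2 (f \o c) t *m M^T.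
  exact: (derive1n_mulmx 2 sfc GE).
have A2 := model_eta2 mF speta eta0.
have sD : smooth_at ('D_1 x) 0 := smooth_derive (1 : R) sx.
have S := near_gt0 sD x0.
have V : \forall t \near (0 : R), [/\ on_axis (c1 t), c t = phi (c1 t), enorm (derive1 (f \o c) t) = 1 & 0 < 'D_1 x t].
  by apply: filterS3 (filterI ax cE) arc S => t [? ?] ? ?; split.
have Q : \forall t \near (0 : R), [/\ on_axis (c1 t) -> exists m : R,
      vf_derive (pull phi psi eta) (vf_derive (pull phi psi eta) F) (c1 t) =
      pull phi psi eta (c1 t) 0 1 ^+ 2 *: 'D_ev ('D_ev F) (c1 t) + m *: 'D_eu F (c1 t),
    vf_derive (pull phi psi eta) (vf_derive (pull phi psi eta) F) (c1 t) =
      vf_derive eta (vf_derive eta f) (phi (c1 t)) *m M^T,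
    on_axis (c1 t) -> 0 < pull phi psi xi (c1 t) 0 0 * pull phi psi eta (c1 t) 0 1 &
    0 < axis_W ('D_eu F (c1 t)) ('D_ev ('D_ev F) (c1 t))].
  apply: filterS3 (near_comp sc1 c10 A2) (near_comp sc1 c10 E2) (near_comp sc1 c10 (filterI pos (model_regular mF))).
  by move=> t h1 h2 [h3 [_ h4]]; split; [exact: h1|exact: h2|exact: h3|exact: h4].
have G1 : \forall t \near (0 : R), derive1 (F \o c1) t = 'D_1 x t *: 'D_eu F (c1 t).
  exact: (curve_d1 sF sc1 c10 ax).
have G2 : \forall t \near (0 : R), derive1n 2 (F \o c1) t =
    'D_1 x t ^+ 2 *: 'D_eu ('D_eu F) (c1 t) + 'D_1 ('D_1 x) t *: 'D_eu F (c1 t).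
  exact: (curve_d2 sF sc1 c10 ax).
apply: filterS3 (filterI D1 D2) (filterI G1 G2) (filterI V Q).
move=> t [d1 d2] [g1 g2] [[a1 ce ar st] [ee pe ps W0]].
have [m {}ee] := ee a1.
have e3 := etrans (congr1 (fun y => vf_derive eta (vf_derive eta f) y *m M^T) ce) (etrans (esym pe) ee).
have b0 : pull phi psi eta (c1 t) 0 1 != 0 by apply: contraTneq (ps a1) => ->; rewrite mulr0 ltxx.
exact: (skn_pull NN dN st b0 ar W0 (etrans (esym d1) g1) (etrans (esym d2) g2) e3).
Qed.

Lemma signed_kappa_n_val : 0 < 'D_1 x 0 -> (\forall t \near (0 : R), enorm (derive1 (f \o c) t) = 1) ->
  [/\ signed_kappa_n f eta c 0 = b20, kappa_n' f eta c = b30 - a20 * b12 & kappa_s' f xi eta nu c = a30 + b20 * b12].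
Proof.
move=> x0 arc; have K := signed_kappa_n_axis x0 arc; have [sK K0 dK] := Kn_jet mF.
(* The arc-length condition and the unit length of F_u at 0 force speed 1 in u, so derivatives in s
   and in u agree at 0. *)
have x1 : 'D_1 x 0 = 1.
  have := nbhs_singleton (derive1n_mulmx 1 sfc GE); rewrite derive1n1 (nbhs_singleton (curve_d1 sF sc1 c10 ax)) c10.
  move=> E; have := congr1 (@enorm R 3) E; rewrite enorm_rot // (nbhs_singleton arc) enormZ.
  rewrite (model_speed mF).
  by rewrite mulr1 gtr0_norm.
split; first by rewrite (nbhs_singleton K) c10.
- rewrite /kappa_n' -dK -[RHS]mul1r -x1 -(curve_derive sc1 c10 ax sK) !derive1E.
  exact: near_eq_derive.
- by rewrite kappa_s'_val x1 mul1r.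
Qed.
End Curve.
End Invariants.

#[local] Opaque skn.

(** * Fixing the signs of u and v *)

Section Orientation.
Context {R : realType}.
Notation eu := (@e_u R).
Notation ev := (@e_v R).
Notation plane := 'rV[R]_2.
Notation space := 'rV[R]_3.

Lemma derive_flip s t w x : smooth_at (flip s t) x -> 'D_w (flip s t) x = flip s t w :> plane.
Proof.
move=> sh.
have d i (r : R) : 'D_w (fun y : plane => r * y 0 i) x = r * w 0 i.
  apply: derive_val; apply: is_derive_eq (isD_mul (isD_cst x w r) (is_derive_proj x w i)) _.
  by rewrite mulr0 addr0.
have e0 : \forall y \near x, flip s t y 0 0 = s * y 0 0 by apply: near_all => y; rewrite mk20.
have e1 : \forall y \near x, flip s t y 0 1 = t * y 0 1 by apply: near_all => y; rewrite mk21.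
by apply: plane_eq; rewrite (derive_coord _ _ (smooth_diff sh)) ?(near_eq_derive w e0) ?(near_eq_derive w e1) d ?mk20 ?mk21.
Qed.

Lemma derive_comp_flip (phi : plane -> plane) s t : smooth_at phi 0 ->
  'D_eu (phi \o flip s t) 0 = s *: 'D_eu phi 0 /\ 'D_ev (phi \o flip s t) 0 = t *: 'D_ev phi 0.
Proof.
move=> sp; have z : flip s t 0 = 0 by rewrite /flip; apply: mk2_eq; rewrite !mxE //; ring.
have sh := smooth_flip s t; have dp : differentiable phi (flip s t 0) by rewrite z; exact: smooth_diff.
split; rewrite (derive_chain _ (smooth_diff sh) dp) z (derive_flip _ sh) (derive2 _ (smooth_diff sp)) mk20 mk21.
  by rewrite eu0 eu1 mulr1 mulr0 scale0r addr0.
by rewrite ev0 ev1 mulr1 mulr0 scale0r add0r.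
Qed.

(** If the determinant vanished, the two vectors formed from its cofactors would be killed by the
    derivative of [phi] and hence be 0. Then ['D_eu phi 0] would be 0 too, against injectivity. *)
Lemma jac_neq0 (phi : plane -> plane) : diffeo_germ 0 0 phi -> jac phi 0 != 0.
Proof.
move=> dphi; have /nbhs_singleton inj := diffeo_inj dphi; have [_ sp _] := dphi.
have lin w : 'D_w phi 0 = w 0 0 *: 'D_eu phi 0 + w 0 1 *: 'D_ev phi 0 := derive2 w (smooth_diff sp).
apply/negP => /eqP; rewrite /jac.
move: ('D_eu phi 0) ('D_ev phi 0) lin => a b lin j0.
have k0 : mk2 (b 0 1) (- a 0 1) = 0.
  apply: inj; rewrite lin mk20 mk21; apply: plane_eq; rewrite !mxE; last by ring.
  by rewrite -j0; ring.
have k1 : mk2 (b 0 0) (- a 0 0) = 0.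
  apply: inj; rewrite lin mk20 mk21; apply: plane_eq; rewrite !mxE; first by ring.
  by apply: oppr_inj; rewrite oppr0 -j0; ring.
have a0 : a 0 0 = 0 by have := congr1 (fun x : plane => x 0 1) k1; rewrite mk21 mxE => /eqP; rewrite oppr_eq0 => /eqP.
have a1 : a 0 1 = 0 by have := congr1 (fun x : plane => x 0 1) k0; rewrite mk21 mxE => /eqP; rewrite oppr_eq0 => /eqP.
have : eu = 0 by apply: inj; rewrite lin eu0 eu1 scale0r addr0 scale1r; apply: plane_eq; rewrite ?a0 ?a1 mxE.
by move/rowP/(_ 0); rewrite eu0 mxE => /eqP; rewrite oner_eq0.
Qed.

(** Flipping by s and t multiplies the Jacobian determinant by s t, so t can be chosen to make it
    positive whatever s is. The sign of u remains free. *)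
Lemma oriented_coords (f : plane -> space) phi M a20 a30 b20 b30 b12 b03 s : smooth_at f 0 ->
  normal_coords f phi M a20 a30 b20 b30 b12 b03 -> s ^+ 2 = 1 ->
  exists phi' M' b03', [/\ normal_coords f phi' M' a20 (s * a30) (s * b20) b30 b12 b03',
    0 < jac phi' 0 & 'D_eu phi' 0 = s *: 'D_eu phi 0].
Proof.
move=> sf nc s2; have [[dphi _ _] _ _ _] := nc; have [_ sp _] := dphi.
have j0 := jac_neq0 dphi.
pose t := s * Num.sg (jac phi 0).
have t2 : t ^+ 2 = 1 by rewrite exprMn s2 sqr_sg j0 mulr1.
have [N nc'] := normal_coords_flip sf s2 t2 nc.
have [du dv] := derive_comp_flip s t sp.
exists (phi \o flip s t), N, (s * t * b03); split=> //.
have alg (a b : plane) : (s *: a) 0 0 * (t *: b) 0 1 - (s *: a) 0 1 * (t *: b) 0 0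
  = s * t * (a 0 0 * b 0 1 - a 0 1 * b 0 0) by rewrite !mxE; ring.
have -> : jac (phi \o flip s t) 0 = s * t * jac phi 0.
  exact: etrans (congr2 (fun a b : plane => a 0 0 * b 0 1 - a 0 1 * b 0 0) du dv) (alg _ _).
by rewrite /t mulrA -expr2 s2 mul1r -normrEsg normr_gt0.
Qed.

(** The torsion is affine in a30 with slope - b20 / (a20^2 + b20^2); this is the use of nonzero
    kappa_n in the first part. *)
Lemma torsion_cancel (p q n a b : R) : n != 0 ->
  (p * q - n * a) / (p ^+ 2 + n ^+ 2) = (p * q - n * b) / (p ^+ 2 + n ^+ 2) -> a = b.
Proof.
move=> n0; have d : p ^+ 2 + n ^+ 2 != 0 by rewrite paddr_eq0 ?sqr_ge0 // !sqrf_eq0 (negbTE n0) andbF.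
by move=> /(divIf d) /addrI /oppr_inj /(mulfI n0).
Qed.

Variables (f : plane -> space) (xi eta : plane -> plane) (nu : plane -> space).
Hypotheses (f0 : f 0 = 0) (sf : smooth_at f 0) (cf : cuspidal_edge f 0).
Hypotheses (adm : adapted f xi eta) (un : unit_normal f nu).

Lemma normal_coords_torsion : exists phi M a30,
  normal_coords f phi M (kappa_s f xi eta nu 0) a30 (kappa_n f xi eta 0) (kappa_i f xi eta 0)
    (kappa_t f xi eta 0) (kappa_c f xi eta 0) /\
  forall c, sing_param f c -> torsion (f \o c) 0 =
    (kappa_s f xi eta nu 0 * kappa_i f xi eta 0 - kappa_n f xi eta 0 * a30) /
    (kappa_s f xi eta nu 0 ^+ 2 + kappa_n f xi eta 0 ^+ 2).
Proof.
have [phi0 [M0 [a20 [a30 [b20 [b30 [b12 [b03 nc0]]]]]]]] := normal_coords_exist sf f0 cf.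
(* The free sign of u is spent on making the coefficient b20 nonnegative, so that it equals
   kappa_n. *)
have [s s2 sb] : exists2 s : R, s ^+ 2 = 1 & 0 <= s * b20.
  have [b0|b0] := leP 0 b20; first by exists 1; rewrite ?expr1n ?mul1r.
  by exists (-1); rewrite ?sqrrN ?expr1n // mulN1r oppr_ge0 ltW.
have [phi [M [b03' [nc J0 _]]]] := oriented_coords sf nc0 s2.
have [[dphi _ _] _ _ _] := nc; have [_ _ [psi [q0 spsi phiK psiK]]] := dphi.
have [-> kn' -> -> ->] := invariants_at0 sf nc J0 adm un q0 spsi phiK psiK.
rewrite kn' ger0_norm //.
exists phi, M, (s * a30); split=> // c cP.
exact: (torsion_val sf nc q0 spsi psiK cP).
Qed.

(** The entries in the places of a30 and b30 are the formulas for [kappa_s'] and [kappa_n'] solved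
    for these coefficients. Here the sign of u follows the direction of [c]. *)
Lemma normal_coords_directed c : directed_param f eta c -> exists phi M,
  normal_coords f phi M (kappa_s f xi eta nu 0)
    (kappa_s' f xi eta nu c - kappa_n f xi eta 0 * kappa_t f xi eta 0) (kappa_n f xi eta 0)
    (kappa_n' f eta c + kappa_s f xi eta nu 0 * kappa_t f xi eta 0)
    (kappa_t f xi eta 0) (kappa_c f xi eta 0).
Proof.
move=> [[cP arc] dir].
have [phi0 [M0 [a20 [a30 [b20 [b30 [b12 [b03 nc0]]]]]]]] := normal_coords_exist sf f0 cf.
have [[dphi0 _ _] _ _ _] := nc0; have [_ _ [psi0 [q00 spsi0 _ psiK0]]] := dphi0.
have [r r0 sp0] : exists2 r : R, r != 0 & derive1 c 0 = r *: 'D_eu phi0 0.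
  by eexists; [exact: (sing_speed_neq0 nc0 q00 spsi0 psiK0 cP)|exact: (sing_speed nc0 q00 spsi0 psiK0 cP)].
(* Flipping u by the sign of [r] makes [c] run in the direction of growing u; its speed in the new
   coordinate is the absolute value of [r]. *)
have s2 : Num.sg r ^+ 2 = 1 by rewrite sqr_sg r0.
have [phi [M [b03' [nc J0 du]]]] := oriented_coords sf nc0 s2.
have [[dphi _ _] _ _ _] := nc; have [_ _ [psi [q0 spsi phiK psiK]]] := dphi.
have sp := sing_speed nc q0 spsi psiK cP.
have x0 : 0 < 'D_1 (fun t : R => (psi \o c) t 0 0) 0.
  move: sp; rewrite sp0 du; move: ('D_(1 : R) (fun t : R => (psi \o c) t 0 0) 0) => r' /eqP.
  rewrite scalerA -subr_eq0 -scalerBl scaler_eq0 subr_eq0 => /orP[/eqP E|/eqP E].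
    have : `|r| = r' by rewrite normrEsg {2}E mulrCA -expr2 s2 mulr1.
    by move=> <-; rewrite normr_gt0.
  by have [_ _ + _] := cP; rewrite sp0 E scaler0 eqxx.
have [K1 K2 K3] := signed_kappa_n_val sf nc J0 adm un q0 spsi phiK psiK cP x0 arc.
have [-> kn' -> -> _] := invariants_at0 sf nc J0 adm un q0 spsi phiK psiK.
(* By [K1] the allowed direction of [c] says that the coefficient in the place of b20 is
   nonnegative, which removes the absolute value in kappa_n. *)
rewrite K1 in dir; rewrite K2 K3 kn' (ger0_norm dir) addrK subrK.
by exists phi, M.
Qed.
End Orientation.

(* The invariants do not depend on the adapted pair, the unit normal or the
   parametrization of the singular curve, so these are arbitrary. In the second
   part the direction of the parametrization matters only when kappa_n = 0, and
   then equality for some choice of the directions is enough. *)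
Theorem theorem6p1 (R : realType) (f g : 'rV[R]_2 -> 'rV[R]_3)
    (xi_f eta_f : 'rV[R]_2 -> 'rV[R]_2) (nu_f : 'rV[R]_2 -> 'rV[R]_3)
    (xi_g eta_g : 'rV[R]_2 -> 'rV[R]_2) (nu_g : 'rV[R]_2 -> 'rV[R]_3) :
  f 0 = 0 -> smooth_at f 0 -> cuspidal_edge f 0 ->
  g 0 = 0 -> smooth_at g 0 -> cuspidal_edge g 0 ->
  adapted f xi_f eta_f -> unit_normal f nu_f ->
  adapted g xi_g eta_g -> unit_normal g nu_g ->
  (forall c_f c_g : R -> 'rV[R]_2,
     sing_param f c_f -> sing_param g c_g ->
     torsion (f \o c_f) 0 = torsion (g \o c_g) 0 ->
     kappa_s f xi_f eta_f nu_f 0 = kappa_s g xi_g eta_g nu_g 0 ->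
     kappa_n f xi_f eta_f 0 = kappa_n g xi_g eta_g 0 ->
     kappa_c f xi_f eta_f 0 = kappa_c g xi_g eta_g 0 ->
     kappa_t f xi_f eta_f 0 = kappa_t g xi_g eta_g 0 ->
     kappa_i f xi_f eta_f 0 = kappa_i g xi_g eta_g 0 ->
     kappa_n f xi_f eta_f 0 != 0 ->
     congruent_mod_O4 f g) /\
  (forall c_f c_g : R -> 'rV[R]_2,
     directed_param f eta_f c_f -> directed_param g eta_g c_g ->
     kappa_s f xi_f eta_f nu_f 0 = kappa_s g xi_g eta_g nu_g 0 ->
     kappa_n f xi_f eta_f 0 = kappa_n g xi_g eta_g 0 ->
     kappa_c f xi_f eta_f 0 = kappa_c g xi_g eta_g 0 ->
     kappa_t f xi_f eta_f 0 = kappa_t g xi_g eta_g 0 ->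
     kappa_s' f xi_f eta_f nu_f c_f = kappa_s' g xi_g eta_g nu_g c_g ->
     kappa_n' f eta_f c_f = kappa_n' g eta_g c_g ->
     congruent_mod_O4 f g).
Proof.
move=> f0 sf cf g0 sg cg af uf ag ug; split=> c_f c_g.
- move=> cfP cgP tau ks kn kc kt ki kn0.
  have [phi [M [a [nf tf]]]] := normal_coords_torsion f0 sf cf af uf.
  have [chi [N [b [ng tg]]]] := normal_coords_torsion g0 sg cg ag ug.
  (* Five of the six coefficients are invariants by construction; the torsion supplies equality of
     the remaining ones [a] and [b]. *)
  move: tau; rewrite (tf _ cfP) (tg _ cgP) -ks -kn -ki => /(torsion_cancel kn0) ab.
  rewrite -ks -kn -kc -kt -ki -ab in ng.
  exact: normal_coords_congruent nf ng.
- move=> cfP cgP ks kn kc kt ks' kn'.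
  have [phi [M nf]] := normal_coords_directed f0 sf cf af uf cfP.
  have [chi [N ng]] := normal_coords_directed g0 sg cg ag ug cgP.
  rewrite -ks -kn -kc -kt -ks' -kn' in ng.
  exact: normal_coords_congruent nf ng.
Qed.
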